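(* Let $p>2$, let $f\in C^2([0,\infty))$ be nonnegative, and suppose there exists $\tau_0>0$ such that $f(t)=\frac{4(p-1)}{p^2}t^{1-2p}e^{t^p}$ for all $t\ge\tau_0$. Let $\alpha\in(0,1)$ and let $\mu\mapsto(\lambda(\mu),u(\mu,\cdot))$, $\mu>0$, be the $C^1$ curve in $\mathbb R\times C^{2,\alpha}([0,1])$ such that, for each $\mu>0$, $(\lambda(\mu),u(\mu,\cdot))$ is the unique pair $(\lambda,u)$ with $\lambda>0$ solving \[ -u''-\tfrac1ru'=\lambda f(u),\quad u>0\ \text{in }(0,1),\qquad u'(0)=0=u(1), \tag{P} \] and $u(0)=\mu$. Let $(\lambda^*,U^* )$ be the pair defined in the context. Then $\lambda(\mu)$ oscillates around $\lambda^*$ infinitely many times as $\mu\to\infty$, i.e. there exist sequences $(\mu_n),(\mu_n')\subset(0,\infty)$ with $\mu_n,\mu_n'\to\infty$ as $n\to\infty$ and $\lambda(\mu_n')<\lambda^*<\lambda(\mu_n)$ for all $n\in\mathbb N$. In particular: (i) $(\lambda,U)=(\lambda^*,U^* )$ solves $-U''-\frac1rU'=\lambda f(U)$, $U>0$ in $(0,1)$, $\lim_{r\to0^+}U(r)=\infty$, $U(1)=0$. (ii) There exist a sequence $(\mu_n)\subset(0,\infty)$ and a nonincreasing function $u^*$ on $(0,1]$ such that $\mu_n\to\infty$, $\lambda(\mu_n)\to\lambda^*$, $u(\mu_n,\cdot)\to u^*$ in $C^2_{\mathrm{loc}}((0,1])$ as $n\to\infty$, and $-u^{*\prime\prime}-\frac1ru^{*\prime}=\lambda^*f(u^*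 )$, $u^*\ge0$ in $(0,1)$, $u^*(1)=0$, $\int_0^1\lambda^*f(u^* )r\,dr<\infty$. (iii) For each $N\in\mathbb N$ there exists $\varepsilon\in(0,\lambda^* )$ such that (P) admits at least $N$ distinct solutions for all $\lambda^*-\varepsilon<\lambda<\lambda^*+\varepsilon$, and (P) admits infinitely many solutions for $\lambda=\lambda^*$. (iv) If $\inf_{t>0}(f(t)/t)>0$, then $\lim_{\mu\to\infty}Z_{(0,1)}[u(\mu,\cdot)-U^*]=\infty$.
   Context: $Z_I[v]$ denotes the number of zeros of a function $v$ on an interval $I$ (possibly $\infty$). Definition of $(\lambda^*,U^* )$: under the assumption on $f$ there exist a number $\bar R^*>e^{-\tau_0^p/2}$ and a $C^2$ function $\bar U^*$ on $(0,\bar R^*]$ such that $\bar U^*(r)=(2\log(1/r))^{1/p}$ for all $r\in(0,e^{-\tau_0^p/2}]$ and $-\bar U^{*\prime\prime}-\frac1r\bar U^{*\prime}=f(\bar U^* )$, $\bar U^*>0$ in $(0,\bar R^* )$, $\lim_{r\to0^+}\bar U^*(r)=\infty$, $\bar U^*(\bar R^* )=0$ (this pair is determined uniquely by continuing the explicit solution by the ODE until its first zero). Put $\lambda^*=(\bar R^* )^2$ and $U^*(r)=\bar U^*(\sqrt{\lambda^*}\,r)$ for $r\in(0,1]$. *)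

(* Defs.v *)
From Stdlib Require Import Reals List.
From Coquelicot Require Import Coquelicot.
Open Scope R_scope.

Definition Icc (a b : R) : R -> Prop := fun x => a <= x <= b.
Definition Ioo (a b : R) : R -> Prop := fun x => a < x < b.
Definition Ioc (a b : R) : R -> Prop := fun x => a < x <= b.
Definition Ici (a : R) : R -> Prop := fun x => a <= x.

(* The derivative relative to [D] is the usual one at interior points of [D]
   and the one-sided one at the endpoints belonging to [D]; values of the
   function outside [D] play no role. *)
Definition is_derive_on (D : R -> Prop) (v v1 : R -> R) : Prop :=
  forall x, D x ->
    filterdiff v (within D (locally x))
      (fun h : R => @scal R_AbsRing R_NormedModule h (v1 x)).

Definition continuous_on_set (D : R -> Prop) (v : R -> R) : Prop :=
  forall x, D x -> filterlim v (within D (locally x)) (locally (v x)).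

(* [v] is of class C^2 on the interval [D], with v' = v1 and v'' = v2 there. *)
Definition C2_with (D : R -> Prop) (v v1 v2 : R -> R) : Prop :=
  is_derive_on D v v1 /\ is_derive_on D v1 v2 /\ continuous_on_set D v2.

Definition C2_on (D : R -> Prop) (v : R -> R) : Prop :=
  exists v1 v2, C2_with D v v1 v2.

(* [v] belongs to C^{2,alpha}([0,1]) and
   sup|v| + sup|v'| + sup|v''| + [v'']_alpha <= K.
   The restriction [x <> y] is needed since [Rpower 0 alpha] is not 0. *)
Definition C2alpha_norm_le (alpha : R) (v : R -> R) (K : R) : Prop :=
  exists v1 v2, C2_with (Icc 0 1) v v1 v2 /\
  exists K0 K1 K2 H, K0 + K1 + K2 + H <= K /\
    (forall x, Icc 0 1 x ->
       Rabs (v x) <= K0 /\ Rabs (v1 x) <= K1 /\ Rabs (v2 x) <= K2) /\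
    0 <= H /\
    (forall x y, Icc 0 1 x -> Icc 0 1 y -> x <> y ->
       Rabs (v2 x - v2 y) <= H * Rpower (Rabs (x - y)) alpha).

(* mu |-> (lam mu, u mu) is a C^1 map from (0,oo) to R x C^{2,alpha}([0,1]):
   it has a (Frechet) derivative (dlam, du), continuous in the norm. *)
Definition C1_curve (alpha : R) (lam : R -> R) (u : R -> R -> R) : Prop :=
  (forall mu, 0 < mu -> exists K, C2alpha_norm_le alpha (u mu) K) /\
  exists (dlam : R -> R) (du : R -> R -> R),
    (forall mu, 0 < mu -> is_derive lam mu (dlam mu) /\ continuous dlam mu) /\
    (forall mu, 0 < mu -> exists K, C2alpha_norm_le alpha (du mu) K) /\
    (forall mu, 0 < mu -> forall eps, 0 < eps ->
       locally mu (fun nu =>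
         C2alpha_norm_le alpha
           (fun r => u nu r - u mu r - (nu - mu) * du mu r)
           (eps * Rabs (nu - mu)))) /\
    (forall mu, 0 < mu -> forall eps, 0 < eps ->
       locally mu (fun nu =>
         C2alpha_norm_le alpha (fun r => du nu r - du mu r) eps)).

(* - v'' - v' / r = g(v) at r, where v1 and v2 stand for v' and v''. *)
Definition radial_eq (g v v1 v2 : R -> R) (r : R) : Prop :=
  - v2 r - / r * v1 r = g (v r).

Definition solves_P (f : R -> R) (l : R) (v : R -> R) : Prop :=
  exists v1 v2, C2_with (Icc 0 1) v v1 v2 /\
    (forall r, Ioo 0 1 r -> radial_eq (fun t => l * f t) v v1 v2 r /\ 0 < v r) /\
    v1 0 = 0 /\ v 1 = 0.

Definition eq_on (D : R -> Prop) (v w : R -> R) : Prop :=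
  forall x, D x -> v x = w x.

Definition unique_P_solution_with_max
    (f : R -> R) (mu l : R) (v : R -> R) : Prop :=
  (0 < l /\ solves_P f l v /\ v 0 = mu) /\
  forall l' w, 0 < l' -> solves_P f l' w -> w 0 = mu ->
    l' = l /\ eq_on (Icc 0 1) w v.

Definition nonlinearity (p tau0 : R) (f : R -> R) : Prop :=
  C2_on (Ici 0) f /\
  (forall t, 0 <= t -> 0 <= f t) /\
  (forall t, tau0 <= t ->
     f t = 4 * (p - 1) / p ^ 2 * Rpower t (1 - 2 * p) * exp (Rpower t p)).

Definition singular_profile
    (p tau0 : R) (f : R -> R) (Rstar : R) (Ubar : R -> R) : Prop :=
  exp (- Rpower tau0 p / 2) < Rstar /\
  (forall r, Ioc 0 (exp (- Rpower tau0 p / 2)) r ->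
     Ubar r = Rpower (2 * ln (1 / r)) (1 / p)) /\
  (exists U1 U2, C2_with (Ioc 0 Rstar) Ubar U1 U2 /\
     forall r, Ioo 0 Rstar r -> radial_eq f Ubar U1 U2 r) /\
  (forall r, Ioo 0 Rstar r -> 0 < Ubar r) /\
  filterlim Ubar (at_right 0) (Rbar_locally p_infty) /\
  Ubar Rstar = 0.

Definition lambda_star (Rstar : R) : R := Rstar ^ 2.

Definition U_star (Rstar : R) (Ubar : R -> R) (r : R) : R :=
  Ubar (sqrt (lambda_star Rstar) * r).

Definition solves_singular (f : R -> R) (l : R) (U : R -> R) : Prop :=
  (exists U1 U2, C2_with (Ioc 0 1) U U1 U2 /\
     forall r, Ioo 0 1 r -> radial_eq (fun t => l * f t) U U1 U2 r) /\
  (forall r, Ioo 0 1 r -> 0 < U r) /\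
  filterlim U (at_right 0) (Rbar_locally p_infty) /\
  U 1 = 0.

(* Convergence in C^2_loc((0,1]): every compact subset of (0,1] lies in some
   [a,1] with 0 < a < 1. *)
Definition cvg_C2_loc (w : nat -> R -> R) (v : R -> R) : Prop :=
  exists (w1 w2 : nat -> R -> R) (v1 v2 : R -> R),
    (forall n, C2_with (Ioc 0 1) (w n) (w1 n) (w2 n)) /\
    C2_with (Ioc 0 1) v v1 v2 /\
    forall a, 0 < a < 1 -> forall eps, 0 < eps ->
      eventually (fun n => forall r, Icc a 1 r ->
        Rabs (w n r - v r) < eps /\
        Rabs (w1 n r - v1 r) < eps /\
        Rabs (w2 n r - v2 r) < eps).

(* The integrand is nonnegative and continuous on (0,1], so convergence of the
   improper Riemann integral is finiteness of the Lebesgue one. *)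
Definition weak_singular_limit (f : R -> R) (l : R) (v : R -> R) : Prop :=
  (exists v1 v2, C2_with (Ioc 0 1) v v1 v2 /\
     forall r, Ioo 0 1 r -> radial_eq (fun t => l * f t) v v1 v2 r) /\
  (forall r, Ioo 0 1 r -> 0 <= v r) /\
  v 1 = 0 /\
  ex_RInt_gen (fun r => l * f (v r) * r) (at_right 0) (at_point 1).

(* Cardinality of the zero set of [v] in [I], equal to [p_infty] when that set
   is infinite. *)
Definition num_zeros (I : R -> Prop) (v : R -> R) : Rbar :=
  Lub_Rbar (fun y => exists s : list R,
    NoDup s /\ (forall x, In x s -> I x /\ v x = 0) /\ y = INR (length s)).

(* Main.v *)
(* Write r = exp (- s / 2) / sqrt lambda and s = exp (- xi). In these variables the singular profile
   is s^(1/p), and X = u s^(-1/p) solves, with kappa = 1 - 1/p and as long as u >= tau0,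
     X'' = - (1 - 2/p) X' + (kappa / p) (X - X^(1-2p) exp (s (X^p - 1))).
   This equation has an energy that is nonincreasing in xi. Because p > 2 it is already negative at
   s = 2 mu^p, which keeps X away from 0 from then on, and X is forced to return to 1 within a
   bounded range of xi as long as s is large. Hence the number of crossings of u(mu, .) with the
   singular profile tends to infinity with mu. The zeros of the difference are simple, so its Pruefer
   angle, taken where the first of the two profiles vanishes, is a continuous function of mu that
   tends to infinity; the difference at that point has the sign of lambda(mu) - lambda_star.
   For (ii), take lambda(mu_n) = lambda_star: a crossing at bounded s bounds u'(1), and along a subsequence
   with u'(1) convergent the solutions converge by continuous dependence on the data at r = 1.
   For (iv), u(mu, .) - U* vanishes where s (X^p - 1) = ln (lambda(mu) / lambda_star), a bounded quantity,
   while s (X^p - 1) oscillates with unbounded amplitude, the energy being dissipated slowly. *)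

Require Import Defs.
From Stdlib Require Import Reals List.
From Coquelicot Require Import Coquelicot.
From Stdlib Require Import Lra Lia Classical ClassicalEpsilon.
Open Scope R_scope.

(** * One-variable calculus on intervals *)

(* [auto_derive] treats an abstract function through [Derive]; this substitutes the derivatives
   known from the context. *)
Ltac derive_known :=
  auto_derive;
  [ repeat split; try (eexists; eassumption); try assumption; try lra; try exact I
  | repeat match goal with
      | H : is_derive ?g ?x ?d |- _ =>
          progress change (Derive (fun y : R => g y) x) with (Derive g x);
          rewrite (is_derive_unique g x d H)
      end ].

(** The restoring force in X is lopsided. Above X = 1 it dominates a linear force of stiffness of
    order s; below X = 1 it is at most a multiple of X, however large s is, so the return time is
    bounded only if X is bounded below. The energy supplies this bound: near X = 0 the potential is
    at least - C / s, so strictly negative energy requires a fixed amount of X^2. At the start 0 <=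
    X' <= X / p, and the kinetic term X^2 / (2 p^2) is beaten by (p - 1) X^2 / (2 p^2) exactly when
    p > 2. Crossings are counted against the singular profile at the same parameter, r |-> Ubar
    (sqrt (lam mu) r), which solves the same equation as [u mu]. A double zero of the difference
    would propagate backwards to small radii, where the profile exceeds mu. Statement (iv) compares
    with [U_star], which belongs to another parameter and shifts s by ln (lam mu / ls). Crossings
    must then be upgraded to level sets, so the speed at the crossings must not degenerate; as only
    finitely many of them are needed, the range of xi is fixed before mu grows. *)

Lemma is_derive_on_eps (D : R -> Prop) (v v1 : R -> R) :
  is_derive_on D v v1 <->
  forall x, D x -> forall eps, 0 < eps -> exists delta, 0 < delta /\
    forall y, D y -> Rabs (y - x) < delta ->
      Rabs (v y - v x - (y - x) * v1 x) <= eps * Rabs (y - x).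
Proof.
  split.
  - intros H x Dx eps Heps. destruct (H x Dx) as [_ Hd].
    assert (Hx : is_filter_lim (within D (locally x)) x).
    { intros P HP. apply filter_imp with (2 := HP). tauto. }
    destruct (Hd x Hx (mkposreal eps Heps)) as [delta Hdelta].
    exists delta. split; [apply cond_pos|]. intros y Dy Hy.
    exact (Hdelta y Hy Dy).
  - intros H x Dx. split.
    + apply is_linear_scal_l.
    + intros x' Hx' eps.
      (* [filterdiff] quantifies over every limit of the filter. As [x] itself lies in [D], a ball
         around another limit that avoids [x] contradicts convergence. *)
      assert (Exx : x' = x).
      { destruct (Req_dec x' x) as [E|E]; [exact E|].
        assert (Hp : 0 < Rabs (x - x')) by (apply Rabs_pos_lt; lra).
        assert (HP : locally x' (fun y => Rabs (y - x') < Rabs (x - x'))).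
        { exists (mkposreal _ Hp). intros y Hy. exact Hy. }
        specialize (Hx' _ HP).
        apply locally_singleton in Hx'. specialize (Hx' Dx). lra. }
      subst x'.
      destruct (H x Dx eps (cond_pos eps)) as [delta [Hd0 Hd]].
      exists (mkposreal delta Hd0). intros y Hy Dy. exact (Hd y Dy Hy).
Qed.

Lemma continuous_on_set_eps (D : R -> Prop) (v : R -> R) :
  continuous_on_set D v <->
  forall x, D x -> forall eps, 0 < eps -> exists delta, 0 < delta /\
    forall y, D y -> Rabs (y - x) < delta -> Rabs (v y - v x) < eps.
Proof.
  split.
  - intros H x Dx eps Heps.
    destruct (proj1 (filterlim_locally _ _) (H x Dx) (mkposreal eps Heps)) as [d Hd].
    exists d. split; [apply cond_pos|]. intros y Dy Hy. exact (Hd y Hy Dy).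
  - intros H x Dx. apply filterlim_locally. intros eps.
    destruct (H x Dx eps (cond_pos eps)) as [d [Hd0 Hd]].
    exists (mkposreal d Hd0). intros y Hy Dy. exact (Hd y Dy Hy).
Qed.

Lemma is_derive_on_interior (D : R -> Prop) (v v1 : R -> R) (a b x : R) :
  is_derive_on D v v1 -> (forall y, a < y < b -> D y) -> a < x < b ->
  is_derive v x (v1 x).
Proof.
  intros H HD Hx.
  destruct (H x (HD x Hx)) as [_ Hd]. split; [apply is_linear_scal_l|].
  intros x' Hx' eps.
  assert (E : x = x') by (apply is_filter_lim_locally_unique; exact Hx').
  subst x'.
  assert (Hl : is_filter_lim (within D (locally x)) x).
  { intros P HP. apply filter_imp with (2 := HP). tauto. }
  specialize (Hd x Hl eps).
  assert (HDl : locally x D).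
  { assert (Hm : 0 < Rmin (x - a) (b - x)) by (apply Rmin_pos; lra).
    exists (mkposreal _ Hm). intros y Hy. apply HD.
    change (Rabs (y - x) < Rmin (x - a) (b - x)) in Hy.
    pose proof (Rmin_l (x - a) (b - x)). pose proof (Rmin_r (x - a) (b - x)).
    apply Rabs_def2 in Hy. lra. }
  generalize (filter_and _ _ HDl Hd). apply filter_imp. intros y [A B]. exact (B A).
Qed.

Lemma is_derive_on_continuous (D : R -> Prop) (v v1 : R -> R) :
  is_derive_on D v v1 -> continuous_on_set D v.
Proof.
  intros H. apply continuous_on_set_eps. intros x Dx eps Heps.
  destruct (proj1 (is_derive_on_eps _ _ _) H x Dx 1 Rlt_0_1) as [d [Hd0 Hd]].
  pose proof (Rabs_pos (v1 x)) as Hv.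
  assert (Hp : 0 < eps / (2 + Rabs (v1 x))) by (apply Rdiv_lt_0_compat; lra).
  exists (Rmin d (eps / (2 + Rabs (v1 x)))). split; [apply Rmin_pos; lra|].
  intros y Dy Hy.
  pose proof (Rmin_l d (eps / (2 + Rabs (v1 x)))).
  pose proof (Rmin_r d (eps / (2 + Rabs (v1 x)))).
  assert (Hy2 : Rabs (y - x) < eps / (2 + Rabs (v1 x))) by lra.
  specialize (Hd y Dy ltac:(lra)).
  replace (v y - v x) with ((v y - v x - (y - x) * v1 x) + (y - x) * v1 x) by ring.
  eapply Rle_lt_trans; [apply Rabs_triang|]. rewrite Rabs_mult.
  apply Rmult_lt_compat_r with (r := 2 + Rabs (v1 x)) in Hy2; [|lra].
  replace (eps / (2 + Rabs (v1 x)) * (2 + Rabs (v1 x))) with eps in Hy2 by (field; lra).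
  nra.
Qed.

Lemma continuous_on_set_sub (D D' : R -> Prop) (v : R -> R) :
  (forall x, D' x -> D x) -> continuous_on_set D v -> continuous_on_set D' v.
Proof.
  intros HD H. apply continuous_on_set_eps. intros x Dx eps Heps.
  destruct (proj1 (continuous_on_set_eps _ _) H x (HD x Dx) eps Heps) as [d [Hd0 Hd]].
  exists d. split; [exact Hd0|]. intros y Dy Hy. apply Hd; auto.
Qed.

Lemma is_derive_on_sub (D D' : R -> Prop) (v v1 : R -> R) :
  (forall x, D' x -> D x) -> is_derive_on D v v1 -> is_derive_on D' v v1.
Proof.
  intros HD H. apply is_derive_on_eps. intros x Dx eps Heps.
  destruct (proj1 (is_derive_on_eps _ _ _) H x (HD x Dx) eps Heps) as [d [Hd0 Hd]].
  exists d. split; [exact Hd0|]. intros y Dy Hy. apply Hd; auto.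
Qed.

(** A second-order remainder bound with a uniform constant survives pointwise limits, so this is the
    criterion that differentiates limits of solutions. *)
Lemma is_derive_on_quadratic (D : R -> Prop) (v v1 : R -> R) :
  (forall x, D x -> exists delta C, 0 < delta /\ forall y, D y -> Rabs (y - x) < delta ->
     Rabs (v y - v x - (y - x) * v1 x) <= C * (y - x) ^ 2) ->
  is_derive_on D v v1.
Proof.
  intros H. apply is_derive_on_eps. intros x Dx eps Heps.
  destruct (H x Dx) as [d [C [Hd0 Hd]]].
  pose proof (Rabs_pos C) as HC.
  assert (Hp : 0 < eps / (1 + Rabs C)) by (apply Rdiv_lt_0_compat; lra).
  exists (Rmin d (eps / (1 + Rabs C))). split; [apply Rmin_pos; lra|].
  intros y Dy Hy.
  pose proof (Rmin_l d (eps / (1 + Rabs C))).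
  pose proof (Rmin_r d (eps / (1 + Rabs C))).
  assert (Hy2 : Rabs (y - x) < eps / (1 + Rabs C)) by lra.
  specialize (Hd y Dy ltac:(lra)). eapply Rle_trans; [exact Hd|].
  pose proof (Rabs_pos (y - x)).
  apply Rmult_lt_compat_r with (r := 1 + Rabs C) in Hy2; [|lra].
  replace (eps / (1 + Rabs C) * (1 + Rabs C)) with eps in Hy2 by (field; lra).
  rewrite <- (pow2_abs (y - x)). pose proof (Rle_abs C). nra.
Qed.

Lemma is_derive_on_all (D : R -> Prop) (v v1 : R -> R) :
  (forall x, D x -> is_derive v x (v1 x)) -> is_derive_on D v v1.
Proof.
  intros H x Dx. destruct (H x Dx) as [Hl Hd]. split; [exact Hl|].
  intros x' Hx' eps.
  assert (Exx : x' = x).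
  { destruct (Req_dec x' x) as [E|E]; [exact E|].
    assert (Hp : 0 < Rabs (x - x')) by (apply Rabs_pos_lt; lra).
    assert (HP : locally x' (fun y => Rabs (y - x') < Rabs (x - x'))).
    { exists (mkposreal _ Hp). intros y Hy. exact Hy. }
    specialize (Hx' _ HP).
    apply locally_singleton in Hx'. specialize (Hx' Dx). lra. }
  subst x'. unfold within.
  assert (Hlim : is_filter_lim (locally x) x) by (intros P HP; exact HP).
  generalize (Hd x Hlim eps). apply filter_imp. tauto.
Qed.

(** Composing with the projection onto [a, b] turns continuity relative to the interval into
    continuity on the whole line, as the mean value, intermediate value and integration theorems
    require. Nothing changes near interior points, so derivatives there are kept. *)
Definition clamp (a b x : R) : R := Rmax a (Rmin b x).

Lemma clamp_in (a b x : R) : a <= b -> a <= clamp a b x <= b.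
Proof.
  intros H. split; [apply Rmax_l|].
  apply Rmax_lub; [exact H|apply Rmin_l].
Qed.

Lemma clamp_id (a b x : R) : a <= x <= b -> clamp a b x = x.
Proof.
  intros H. unfold clamp. rewrite Rmin_right by lra. apply Rmax_right; lra.
Qed.

Lemma clamp_lip (a b x y : R) : Rabs (clamp a b x - clamp a b y) <= Rabs (x - y).
Proof.
  unfold clamp, Rmax, Rmin.
  repeat destruct Rle_dec; unfold Rabs; repeat destruct Rcase_abs; lra.
Qed.

Lemma clamp_continuous (a b x : R) (v : R -> R) :
  a <= b -> continuous_on_set (Icc a b) v ->
  continuous (fun y => v (clamp a b y)) x.
Proof.
  intros Hab H. apply filterlim_locally. intros eps.
  destruct (proj1 (continuous_on_set_eps _ _) H (clamp a b x) (clamp_in a b x Hab)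
              eps (cond_pos eps)) as [d [Hd0 Hd]].
  exists (mkposreal d Hd0). intros y Hy. apply Hd; [apply clamp_in; exact Hab|].
  eapply Rle_lt_trans; [apply clamp_lip|exact Hy].
Qed.

Lemma MVT_on (v v1 : R -> R) (a b : R) :
  a < b -> continuous_on_set (Icc a b) v ->
  (forall x, a < x < b -> is_derive v x (v1 x)) ->
  exists c, a < c < b /\ v b - v a = v1 c * (b - a).
Proof.
  intros Hab Hc Hd.
  pose (w := fun y => v (clamp a b y)).
  assert (Hdw : forall x, a < x < b -> is_derive w x (v1 x)).
  { intros x Hx. apply is_derive_ext_loc with v; [|apply Hd; exact Hx].
    assert (Hm : 0 < Rmin (x - a) (b - x)) by (apply Rmin_pos; lra).
    exists (mkposreal _ Hm). intros y Hy.
    change (Rabs (y - x) < Rmin (x - a) (b - x)) in Hy.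
    pose proof (Rmin_l (x - a) (b - x)). pose proof (Rmin_r (x - a) (b - x)).
    apply Rabs_def2 in Hy. unfold w. rewrite clamp_id; [reflexivity|lra]. }
  assert (pr : forall c, a < c < b -> derivable_pt w c).
  { intros c Hcc. exists (v1 c). apply is_derive_Reals. apply Hdw; exact Hcc. }
  assert (pr2 : forall c, a < c < b -> derivable_pt id c).
  { intros c _. apply derivable_pt_id. }
  destruct (MVT w id a b pr pr2 Hab) as [c [P E]].
  - intros c _. apply continuity_pt_filterlim. apply clamp_continuous; [lra|exact Hc].
  - intros c _. apply derivable_continuous_pt. apply derivable_pt_id.
  - exists c. split; [exact P|].
    rewrite (derive_pt_eq_0 w c (v1 c) (pr c P)) in E
      by (apply is_derive_Reals; apply Hdw; exact P).
    rewrite (derive_pt_eq_0 id c 1 (pr2 c P)) in E by apply derivable_pt_lim_id.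
    unfold w, id in E. rewrite !clamp_id in E by lra. lra.
Qed.

Lemma continuous_on_of_derive (D : R -> Prop) (v v1 : R -> R) :
  (forall x, D x -> is_derive v x (v1 x)) -> continuous_on_set D v.
Proof.
  intros H. eapply is_derive_on_continuous. apply is_derive_on_all. exact H.
Qed.

Lemma continuous_on_of_continuous (D : R -> Prop) (v : R -> R) :
  (forall x, D x -> continuous v x) -> continuous_on_set D v.
Proof.
  intros H x Dx P HP.
  assert (Q : locally x (fun y => P (v y))) by exact (H x Dx P HP).
  revert Q. unfold filtermap, within. apply filter_imp. tauto.
Qed.

Lemma MVT_is_derive (v v1 : R -> R) (a b : R) :
  a < b -> (forall x, a <= x <= b -> is_derive v x (v1 x)) ->
  exists c, a < c < b /\ v b - v a = v1 c * (b - a).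
Proof.
  intros Hab Hd. apply MVT_on; [exact Hab| |intros; apply Hd; lra].
  apply continuous_on_of_derive with v1. exact Hd.
Qed.

Lemma nonincr_on (v v1 : R -> R) (a b : R) :
  a <= b -> continuous_on_set (Icc a b) v ->
  (forall x, a < x < b -> is_derive v x (v1 x) /\ v1 x <= 0) -> v b <= v a.
Proof.
  intros Hab Hc Hd. destruct (Rle_lt_or_eq_dec _ _ Hab) as [L|E]; [|subst; lra].
  destruct (MVT_on v v1 a b L Hc) as [c [Hc1 E]]; [intros; apply Hd; lra|].
  destruct (Hd c Hc1) as [_ Hn]. nra.
Qed.

Lemma nondecr_on (v v1 : R -> R) (a b : R) :
  a <= b -> continuous_on_set (Icc a b) v ->
  (forall x, a < x < b -> is_derive v x (v1 x) /\ 0 <= v1 x) -> v a <= v b.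
Proof.
  intros Hab Hc Hd. destruct (Rle_lt_or_eq_dec _ _ Hab) as [L|E]; [|subst; lra].
  destruct (MVT_on v v1 a b L Hc) as [c [Hc1 E]]; [intros; apply Hd; lra|].
  destruct (Hd c Hc1) as [_ Hn]. nra.
Qed.

Lemma IVT_on (v : R -> R) (a b y : R) :
  a <= b -> continuous_on_set (Icc a b) v ->
  (v a <= y <= v b \/ v b <= y <= v a) -> exists c, a <= c <= b /\ v c = y.
Proof.
  intros Hab Hc Hy.
  destruct (IVT_gen (fun x => v (clamp a b x)) a b y) as [c [Hc1 E]].
  - intros x. apply continuity_pt_filterlim. apply clamp_continuous; assumption.
  - rewrite !clamp_id by lra. unfold Rmin, Rmax. repeat destruct Rle_dec; lra.
  - rewrite Rmin_left, Rmax_right in Hc1 by lra.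
    exists c. split; [lra|]. rewrite clamp_id in E by lra. exact E.
Qed.

Lemma continuous_on_bounded (v : R -> R) (a b : R) :
  a <= b -> continuous_on_set (Icc a b) v ->
  exists M, 0 < M /\ forall x, a <= x <= b -> Rabs (v x) <= M.
Proof.
  intros Hab Hc.
  destruct (continuity_ab_maj (fun x => Rabs (v (clamp a b x))) a b Hab) as [m [Hm _]].
  - intros x _. apply continuity_pt_filterlim.
    apply (continuous_comp (fun x => v (clamp a b x)) Rabs).
    + apply clamp_continuous; assumption.
    + apply continuous_Rabs.
  - exists (Rabs (v (clamp a b m)) + 1). split.
    + pose proof (Rabs_pos (v (clamp a b m))). lra.
    + intros x Hx. specialize (Hm x Hx). rewrite clamp_id in Hm by lra. lra.
Qed.

Lemma eq_on_closure (v w : R -> R) (a b : R) :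
  a < b -> continuous_on_set (Icc a b) v -> continuous_on_set (Icc a b) w ->
  (forall x, a < x < b -> v x = w x) -> forall x, a <= x <= b -> v x = w x.
Proof.
  intros Hab Hv Hw H x Hx.
  destruct (Req_dec (v x) (w x)) as [E|E]; [exact E|exfalso].
  assert (He : 0 < Rabs (v x - w x) / 2) by (apply Rdiv_lt_0_compat; [apply Rabs_pos_lt; lra|lra]).
  destruct (proj1 (continuous_on_set_eps _ _) Hv x Hx _ He) as [d1 [Hd1 H1]].
  destruct (proj1 (continuous_on_set_eps _ _) Hw x Hx _ He) as [d2 [Hd2 H2]].
  assert (Hy : exists y, a < y < b /\ Rabs (y - x) < d1 /\ Rabs (y - x) < d2).
  { set (d := Rmin (Rmin d1 d2) (b - a)).
    assert (Hd : 0 < d) by (unfold d; repeat apply Rmin_pos; lra).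
    assert (d <= d1 /\ d <= d2 /\ d <= b - a).
    { unfold d. pose proof (Rmin_l (Rmin d1 d2) (b - a)). pose proof (Rmin_r (Rmin d1 d2) (b - a)).
      pose proof (Rmin_l d1 d2). pose proof (Rmin_r d1 d2). lra. }
    destruct (Rlt_dec x ((a + b) / 2)).
    - exists (x + d / 3). split; [lra|]. rewrite Rabs_right; lra.
    - exists (x - d / 3). split; [lra|]. rewrite Rabs_left; lra. }
  destruct Hy as [y [Hy [Hy1 Hy2]]].
  assert (Iy : Icc a b y) by (unfold Icc; lra).
  specialize (H1 y Iy Hy1). specialize (H2 y Iy Hy2). rewrite (H y Hy) in H1.
  revert H1 H2 He. unfold Rabs. repeat destruct Rcase_abs; lra.
Qed.

(** * The energy of the rescaled equation *)

Definition kap (p : R) : R := 1 - 1 / p.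

(* X^(1-2p) exp (s (X^p - 1)), the nonlinearity in the rescaled unknown X = u s^(-1/p). *)
Definition force (p s x : R) : R := exp ((1 - 2 * p) * ln x + s * (exp (p * ln x) - 1)).

(* Substituting y = u^p = s X^p, the primitive of f becomes, up to a constant, the primitive [Psi]
   of y^(2/p-3) exp y; note 2/p - 3 = -1 - 2 kap. *)
Definition psi (p y : R) : R := exp ((-1 - 2 * kap p) * ln y + y).

Definition Psi (p y : R) : R := RInt (psi p) 1 y.

(** With s = exp (- xi) this is s^(2 kap) exp (- s), the factor for which [weight p xi * psi p s]
    equals 1 / s. *)
Definition weight (p xi : R) : R := exp (- exp (- xi) - 2 * kap p * xi).

Definition height (p : R) (X : R -> R) (xi : R) : R := exp (- xi + p * ln (X xi)).

(** This is [kap p / p] times the integral of [force p s] from 1 to [X], written through the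
    primitive [Psi]; it vanishes at the crossings X = 1. *)
Definition pot (p : R) (X : R -> R) (xi : R) : R :=
  kap p / p ^ 2 * (weight p xi * (Psi p (height p X xi) - Psi p (exp (- xi)))).

(** X = 1 is an equilibrium for every s, and at rest it has energy [- kap p / (2 * p)]; amplitudes
    are later measured from that level. *)
Definition energy (p : R) (X X1 : R -> R) (xi : R) : R :=
  X1 xi ^ 2 / 2 - kap p / (2 * p) * X xi ^ 2 + pot p X xi.

(* [energy' = - (1 - 2/p) X'^2 - dissip]. *)
Definition dissip (p : R) (X : R -> R) (xi : R) : R :=
  kap p / p ^ 2 * (X xi * force p (exp (- xi)) (X xi) - 1
    - (exp (- xi) - 2 * kap p) * (weight p xi * (Psi p (height p X xi) - Psi p (exp (- xi))))).

Definition traj (p a b : R) (X X1 : R -> R) : Prop :=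
  forall xi, a <= xi <= b ->
    0 < X xi /\ is_derive X xi (X1 xi) /\
    is_derive X1 xi (- (1 - 2 / p) * X1 xi + kap p / p * (X xi - force p (exp (- xi)) (X xi))).

Lemma traj_sub (p a b a' b' : R) (X X1 : R -> R) :
  a <= a' -> b' <= b -> traj p a b X X1 -> traj p a' b' X X1.
Proof. intros Ha Hb H xi Hxi. apply H. lra. Qed.

Lemma kap_bounds (p : R) : 2 < p -> 1 / 2 < kap p < 1.
Proof.
  intros hp. unfold kap. split.
  - apply Rmult_lt_reg_r with p; [lra|]. replace ((1 - 1 / p) * p) with (p - 1) by (field; lra). lra.
  - apply Rmult_lt_reg_r with p; [lra|]. replace ((1 - 1 / p) * p) with (p - 1) by (field; lra). lra.
Qed.

Lemma damping_bounds (p : R) : 2 < p -> 0 < 1 - 2 / p < 1.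
Proof.
  intros hp. assert (0 < 2 / p) by (apply Rdiv_lt_0_compat; lra).
  assert (2 / p < 1); [|lra].
  apply Rmult_lt_reg_r with p; [lra|]. replace (2 / p * p) with 2 by (field; lra). lra.
Qed.

Lemma psi_continuous (p y : R) : 0 < y -> continuous (psi p) y.
Proof.
  intros Hy. apply (@ex_derive_continuous R_AbsRing R_NormedModule).
  unfold psi. auto_derive. exact Hy.
Qed.

Lemma Psi_derive (p y : R) : 0 < y -> is_derive (Psi p) y (psi p y).
Proof.
  intros Hy. apply is_derive_RInt with (a := 1).
  - exists (mkposreal y Hy). intros z Hz.
    change (Rabs (z - y) < y) in Hz. apply Rabs_def2 in Hz.
    apply (RInt_correct (psi p)). apply ex_RInt_continuous.
    intros t Ht. apply psi_continuous.
    pose proof (Rmin_glb_lt 1 z 0). lra.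
  - apply psi_continuous. exact Hy.
Qed.

Lemma weight_psi_height (p : R) (X : R -> R) (xi : R) :
  p <> 0 -> 0 < X xi ->
  weight p xi * psi p (height p X xi) * height p X xi = X xi * force p (exp (- xi)) (X xi).
Proof.
  intros hp HX. unfold weight, psi, height, force.
  set (L := ln (X xi)).
  replace (X xi) with (exp L) by (apply exp_ln; exact HX).
  rewrite ln_exp, <- !exp_plus. f_equal.
  rewrite (exp_plus (- xi)). unfold kap. field. exact hp.
Qed.

Lemma weight_psi_time (p xi : R) :
  weight p xi * psi p (exp (- xi)) * exp (- xi) = 1.
Proof.
  unfold weight, psi. rewrite <- !exp_plus, ln_exp. rewrite <- exp_0. f_equal. ring.
Qed.

Lemma energy_derive (p a b : R) (X X1 : R -> R) (xi : R) :
  2 < p -> traj p a b X X1 -> a <= xi <= b ->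
  is_derive (energy p X X1) xi (- (1 - 2 / p) * X1 xi ^ 2 - dissip p X xi).
Proof.
  intros hp HT Hxi. destruct (HT xi Hxi) as [HX [D0 D1]].
  assert (P1 : is_derive (Psi p) (height p X xi) (psi p (height p X xi)))
    by (apply Psi_derive; apply exp_pos).
  assert (P2 : is_derive (Psi p) (exp (- xi)) (psi p (exp (- xi))))
    by (apply Psi_derive; apply exp_pos).
  unfold energy, pot, weight, height. auto_derive.
  - repeat split; try (exact HX); try (eexists; eassumption); try exact I.
  - change (Derive (fun x : R => X x) xi) with (Derive X xi).
    change (Derive (fun x : R => X1 x) xi) with (Derive X1 xi).
    change (fun x : R => Psi p x) with (Psi p).
    rewrite (is_derive_unique _ _ _ D0), (is_derive_unique _ _ _ D1).
    rewrite (is_derive_unique _ _ _ P2).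
    change (exp (- xi + p * ln (X xi))) with (height p X xi).
    rewrite (is_derive_unique _ _ _ P1).
    replace (exp (- exp (- xi) + - (2 * kap p * xi))) with (weight p xi)
      by (unfold weight; f_equal; ring).
    unfold dissip. pose proof (weight_psi_height p X xi ltac:(lra) HX) as E1.
    pose proof (weight_psi_time p xi) as E2.
    set (h := force p (exp (- xi)) (X xi)) in *.
    set (g := weight p xi) in *. set (y := height p X xi) in *. set (s := exp (- xi)) in *.
    set (py := psi p y) in *. set (ps := psi p s) in *.
    set (Py := Psi p y). set (Ps := Psi p s). set (k := kap p).
    (* Both the force and the constant 1 are rewritten with [psi], at y and at s; what remains is an
       identity between rational expressions. *)
    replace h with (g * py * y / X xi) by (rewrite E1; field; lra).
    replace (k / p ^ 2 * (X xi * (g * py * y / X xi) - 1 - (s - 2 * k) * (g * (Py - Ps))))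
      with (k / p ^ 2 * (X xi * (g * py * y / X xi) - g * ps * s - (s - 2 * k) * (g * (Py - Ps))))
      by (rewrite E2; ring).
    field. lra.
Qed.

(** * Asymptotic bounds for [weight] and [Psi], and their effect on the energy *)

Lemma exp_le (x y : R) : x <= y -> exp x <= exp y.
Proof. intros [L|E]; [left; apply exp_increasing; exact L|subst; lra]. Qed.

Lemma exp_ge_pow4 (x : R) : 0 <= x -> (x / 4) ^ 4 <= exp x.
Proof.
  intros Hx. replace (exp x) with (exp (x / 4) ^ 4).
  - apply pow_incr. pose proof (exp_ineq1_le (x / 4)). lra.
  - rewrite <- Rpower_pow by apply exp_pos. unfold Rpower. rewrite ln_exp.
    f_equal. simpl. field.
Qed.

Lemma height_eq (p : R) (X : R -> R) (xi : R) :
  height p X xi = exp (- xi) * exp (p * ln (X xi)).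
Proof. apply exp_plus. Qed.

Lemma weight_mul_psi (p xi : R) : weight p xi * psi p (exp (- xi)) = / exp (- xi).
Proof.
  pose proof (weight_psi_time p xi) as E. pose proof (exp_pos (- xi)).
  apply Rmult_eq_reg_r with (exp (- xi)); [|lra]. rewrite E. field. lra.
Qed.

(** As kap < 1, s^(2 kap) is at most s^2; then exp s >= (s / 4)^4 gives the constant 256 = 4^4. *)
Lemma weight_bound (p xi : R) :
  2 < p -> 1 <= exp (- xi) -> weight p xi <= 256 / exp (- xi) ^ 2.
Proof.
  intros hp Hs. set (s := exp (- xi)) in *.
  assert (Hxi : xi <= 0).
  { destruct (Rle_dec xi 0) as [L|L]; [exact L|exfalso].
    assert (s < exp 0) by (apply exp_increasing; lra). rewrite exp_0 in *. lra. }
  assert (E : weight p xi <= exp (- s) * s ^ 2).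
  { unfold weight. fold s.
    replace (s ^ 2) with (exp (- xi * 2)).
    - rewrite <- exp_plus. apply exp_le. pose proof (kap_bounds p hp).
      assert (0 <= (1 - kap p) * (- xi)) by nra. lra.
    - unfold s. simpl. rewrite Rmult_1_r, <- exp_plus. f_equal. ring. }
  eapply Rle_trans; [exact E|].
  pose proof (exp_ge_pow4 s ltac:(lra)) as H4. pose proof (exp_pos s).
  rewrite exp_Ropp.
  apply Rmult_le_reg_r with (exp s * s ^ 2); [apply Rmult_lt_0_compat; [lra|apply pow_lt; lra]|].
  replace (/ exp s * s ^ 2 * (exp s * s ^ 2)) with (s ^ 4) by (field; lra).
  replace (256 / s ^ 2 * (exp s * s ^ 2)) with (256 * exp s) by (field; lra).
  lra.
Qed.

Lemma psi_pos (p y : R) : 0 < psi p y.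
Proof. apply exp_pos. Qed.

Lemma psi_derive (p y : R) :
  0 < y -> is_derive (psi p) y (psi p y * ((-1 - 2 * kap p) / y + 1)).
Proof.
  intros Hy. unfold psi. auto_derive; [exact Hy|]. field. lra.
Qed.

(** The logarithmic derivative of [psi] is 1 + a / t with a > -3, so [psi p t * (1 + 7 / t)] grows
    at least as fast as [Psi] as soon as (a + 7) t + 7 (a - 1) >= 0. The bound a > -3 makes this
    true from t = 7 on. *)
Lemma Psi_upper (p s : R) :
  2 < p -> 7 <= s -> Psi p s <= Psi p 7 + psi p s * (1 + 7 / s).
Proof.
  intros hp Hs. set (a := -1 - 2 * kap p).
  assert (Ha : -3 < a) by (unfold a; pose proof (kap_bounds p hp); lra).
  assert (H : psi p 7 * (1 + 7 / 7) - Psi p 7 <= psi p s * (1 + 7 / s) - Psi p s).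
  { assert (HD : forall t, 7 <= t -> is_derive (fun t => psi p t * (1 + 7 / t) - Psi p t) t
        (psi p t * ((a / t + 1) * (1 + 7 / t) - 7 / t ^ 2 - 1))).
    { intros t Ht. pose proof (psi_derive p t ltac:(lra)) as D1.
      pose proof (Psi_derive p t ltac:(lra)) as D2. fold a in D1.
      derive_known. field. lra. }
    apply (nondecr_on (fun t => psi p t * (1 + 7 / t) - Psi p t)
        (fun t => psi p t * ((a / t + 1) * (1 + 7 / t) - 7 / t ^ 2 - 1))); [lra| |].
    - eapply continuous_on_of_derive. intros x [Hx _]. apply HD. exact Hx.
    - intros t Ht. split; [apply HD; lra|]. pose proof (psi_pos p t).
      apply Rmult_le_pos; [lra|].
      replace ((a / t + 1) * (1 + 7 / t) - 7 / t ^ 2 - 1)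
        with (((a + 7) * t + 7 * (a - 1)) / t ^ 2) by (field; lra).
      apply Rmult_le_pos; [nra|]. left. apply Rinv_0_lt_compat. nra. }
  pose proof (psi_pos p 7). lra.
Qed.

Lemma Psi_increasing (p x y : R) : 0 < x -> x <= y -> Psi p x <= Psi p y.
Proof.
  intros Hx Hxy. apply (nondecr_on (Psi p) (psi p)); [exact Hxy| |].
  - eapply continuous_on_of_derive. intros t [Ht _]. apply Psi_derive. lra.
  - intros t Ht. split; [apply Psi_derive; lra|]. left. apply psi_pos.
Qed.

Definition theta (p s y : R) : R := psi p y * y - (s - 2 * kap p) * Psi p y.

(* For fixed s the dissipation is proportional to [theta s y - theta s s], and theta is minimal at
   y = s: this is why the energy is monotone. *)
Lemma theta_derive (p s y : R) : 0 < y -> is_derive (theta p s) y (psi p y * (y - s)).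
Proof.
  intros Hy. pose proof (psi_derive p y Hy) as D1. pose proof (Psi_derive p y Hy) as D2.
  unfold theta. derive_known. field. lra.
Qed.

Lemma theta_min (p s y : R) : 0 < s -> 0 < y -> theta p s s <= theta p s y.
Proof.
  intros Hs Hy. destruct (Rle_lt_dec s y) as [L|L].
  - apply (nondecr_on (theta p s) (fun t => psi p t * (t - s))); [exact L| |].
    + eapply continuous_on_of_derive. intros t [Ht _]. apply theta_derive. lra.
    + intros t Ht. split; [apply theta_derive; lra|]. pose proof (psi_pos p t). nra.
  - apply (nonincr_on (theta p s) (fun t => psi p t * (t - s))); [lra| |].
    + eapply continuous_on_of_derive. intros t [Ht _]. apply theta_derive. lra.
    + intros t Ht. split; [apply theta_derive; lra|]. pose proof (psi_pos p t). nra.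
Qed.

Lemma dissip_eq (p : R) (X : R -> R) (xi : R) :
  p <> 0 -> 0 < X xi ->
  dissip p X xi = kap p / p ^ 2 *
    (weight p xi * (theta p (exp (- xi)) (height p X xi) - theta p (exp (- xi)) (exp (- xi)))).
Proof.
  intros hp HX. unfold dissip, theta.
  rewrite <- (weight_psi_height p X xi hp HX).
  pose proof (weight_psi_time p xi). f_equal. lra.
Qed.

Lemma kap_div_pos (p : R) : 2 < p -> 0 < kap p / p ^ 2.
Proof.
  intros hp. pose proof (kap_bounds p hp). apply Rdiv_lt_0_compat; [lra|]. nra.
Qed.

Lemma dissip_nonneg (p : R) (X : R -> R) (xi : R) : 2 < p -> 0 < X xi -> 0 <= dissip p X xi.
Proof.
  intros hp HX. rewrite dissip_eq by lra.
  apply Rmult_le_pos; [left; apply kap_div_pos; exact hp|].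
  apply Rmult_le_pos; [left; apply exp_pos|].
  pose proof (theta_min p (exp (- xi)) (height p X xi) (exp_pos _) (exp_pos _)). lra.
Qed.

Lemma energy_nonincr (p a b x y : R) (X X1 : R -> R) :
  2 < p -> traj p a b X X1 -> a <= x -> x <= y -> y <= b ->
  energy p X X1 y <= energy p X X1 x.
Proof.
  intros hp HT Hx Hxy Hy.
  apply (nonincr_on (energy p X X1) (fun xi => - (1 - 2 / p) * X1 xi ^ 2 - dissip p X xi)); [exact Hxy| |].
  - eapply continuous_on_of_derive. intros t [Ht Ht']. eapply energy_derive; [exact hp|exact HT|lra].
  - intros t Ht. split; [eapply energy_derive; [exact hp|exact HT|lra]|].
    pose proof (dissip_nonneg p X t hp (proj1 (HT t ltac:(lra)))).
    pose proof (damping_bounds p hp).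
    nra.
Qed.

(** Below X = 1 the potential can only go down to about minus the weight times [Psi p s], which is
    of order 1 / s because [Psi p s] is bounded by a constant plus [2 * psi p s]. The height is kept
    above [y0] since [psi] is not integrable at 0. *)
Lemma pot_lower (p y0 : R) : 2 < p -> 0 < y0 -> exists C, 0 < C /\
  forall X xi, y0 <= height p X xi <= exp (- xi) -> 7 <= exp (- xi) ->
    - C / exp (- xi) <= pot p X xi.
Proof.
  intros hp Hy0. set (C0 := Rabs (Psi p y0 - Psi p 7)).
  pose proof (kap_div_pos p hp) as Hk. pose proof (Rabs_pos (Psi p y0 - Psi p 7)) as HC0. fold C0 in HC0.
  exists (kap p / p ^ 2 * (256 * C0 + 2)). split; [apply Rmult_lt_0_compat; lra|].
  intros X xi Hy Hs. set (s := exp (- xi)) in *. unfold pot. fold s.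
  replace (- (kap p / p ^ 2 * (256 * C0 + 2)) / s)
    with (kap p / p ^ 2 * (- (256 * C0 + 2) / s)) by (field; lra).
  apply Rmult_le_compat_l; [lra|].
  pose proof (Psi_increasing p y0 (height p X xi) Hy0 (proj1 Hy)) as H1.
  pose proof (Psi_upper p s hp Hs) as H2.
  assert (H3 : Psi p y0 - Psi p 7 >= - C0).
  { unfold C0. pose proof (Rle_abs (- (Psi p y0 - Psi p 7))) as H. rewrite Rabs_Ropp in H. lra. }
  pose proof (weight_bound p xi hp ltac:(fold s; lra)) as H4. fold s in H4.
  pose proof (weight_mul_psi p xi) as H5. fold s in H5.
  assert (Hg : 0 < weight p xi) by apply exp_pos.
  set (g := weight p xi) in *.
  assert (H6 : psi p s * (1 + 7 / s) <= 2 * psi p s).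
  { pose proof (psi_pos p s).
    assert (7 / s <= 1) by (apply Rmult_le_reg_r with s; [lra|]; replace (7 / s * s) with 7 by (field; lra); lra).
    nra. }
  apply Rle_trans with (g * (- C0 - 2 * psi p s)); [|apply Rmult_le_compat_l; lra].
  replace (g * (- C0 - 2 * psi p s)) with (- C0 * g - 2 * (g * psi p s)) by ring.
  rewrite H5.
  assert (H7 : g <= 256 / s).
  { eapply Rle_trans; [exact H4|]. apply Rmult_le_compat_l; [lra|].
    apply Rinv_le_contravar; [lra|]. nra. }
  nra.
Qed.

(** On (0, s) [theta] decreases, so at y it is at most [theta p s y0], which is O(s); against a
    weight of size O(1 / s^2) this leaves O(1 / s). *)
Lemma dissip_below (p y0 : R) : 2 < p -> 0 < y0 -> exists C, 0 < C /\
  forall X xi, 0 < X xi -> y0 <= height p X xi <= exp (- xi) -> 7 <= exp (- xi) ->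
    dissip p X xi <= C / exp (- xi).
Proof.
  intros hp Hy0. pose proof (kap_bounds p hp) as Hkb.
  set (C1 := psi p y0 * y0 + Rabs (Psi p y0)).
  pose proof (kap_div_pos p hp) as Hk. pose proof (Rabs_pos (Psi p y0)) as H0.
  pose proof (Rabs_pos (Psi p 7)) as H07.
  assert (HC1 : 0 < C1) by (unfold C1; pose proof (psi_pos p y0); nra).
  exists (kap p / p ^ 2 * (256 * (C1 + Rabs (Psi p 7)) + 7)).
  split; [apply Rmult_lt_0_compat; lra|].
  intros X xi HX Hy Hs. rewrite dissip_eq by lra. set (s := exp (- xi)) in *.
  unfold Rdiv at 2. rewrite Rmult_assoc. apply Rmult_le_compat_l; [lra|].
  assert (T1 : theta p s (height p X xi) <= theta p s y0).
  { apply (nonincr_on (theta p s) (fun t => psi p t * (t - s))); [lra| |].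
    + eapply continuous_on_of_derive. intros t [Ht _]. apply theta_derive. lra.
    + intros t Ht. split; [apply theta_derive; lra|]. pose proof (psi_pos p t). nra. }
  assert (T2 : theta p s y0 <= C1 * s).
  { unfold theta, C1. pose proof (psi_pos p y0) as Hps. pose proof (Rle_abs (- Psi p y0)) as Ha.
    rewrite Rabs_Ropp in Ha. assert (0 < psi p y0 * y0) by nra.
    nra. }
  (* The leading terms [s * psi p s] cancel, and the remainder [psi p s * 7] becomes 7 / s once
     multiplied by the weight. *)
  assert (T3 : - theta p s s <= Rabs (Psi p 7) * s + psi p s * 7).
  { unfold theta. pose proof (Psi_upper p s hp Hs) as HU. pose proof (psi_pos p s) as Hps.
    assert (Ha : (s - 2 * kap p) * Psi p 7 <= s * Rabs (Psi p 7)).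
    { pose proof (Rle_abs (Psi p 7)). nra. }
    assert (Hb : (s - 2 * kap p) * Psi p s <= (s - 2 * kap p) * (Psi p 7 + psi p s * (1 + 7 / s)))
      by (apply Rmult_le_compat_l; lra).
    assert (Hc : (s - 2 * kap p) * (psi p s * (1 + 7 / s)) <= psi p s * (s + 7)).
    { replace ((s - 2 * kap p) * (psi p s * (1 + 7 / s))) with
        (psi p s * (s + 7) - psi p s * (2 * kap p) * (1 + 7 / s)) by (field; lra).
      assert (0 < 7 / s) by (apply Rdiv_lt_0_compat; lra).
      assert (0 < psi p s * (2 * kap p)) by nra. nra. }
    lra. }
  pose proof (weight_bound p xi hp ltac:(fold s; lra)) as H4.
  pose proof (weight_mul_psi p xi) as H5. fold s in H5.
  assert (Hg : 0 < weight p xi) by apply exp_pos.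
  set (g := weight p xi) in *.
  apply Rle_trans with (g * ((C1 + Rabs (Psi p 7)) * s + psi p s * 7));
    [apply Rmult_le_compat_l; lra|].
  replace (g * ((C1 + Rabs (Psi p 7)) * s + psi p s * 7))
    with (g * ((C1 + Rabs (Psi p 7)) * s) + (g * psi p s) * 7) by ring.
  rewrite H5.
  replace ((256 * (C1 + Rabs (Psi p 7)) + 7) * / s)
    with (256 / s ^ 2 * ((C1 + Rabs (Psi p 7)) * s) + / s * 7) by (field; lra).
  apply Rplus_le_compat_r. apply Rmult_le_compat_r; [nra|exact H4].
Qed.

(** A mean value estimate for [theta], with psi(c) <= psi(s) exp (y - s) because the power factor of
    [psi] decreases. The exponential is kept since it is comparable with the force, which
    [amplitude] exploits. *)
Lemma dissip_above (p : R) (X : R -> R) (xi : R) :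
  2 < p -> 0 < X xi -> exp (- xi) <= height p X xi ->
  dissip p X xi <= kap p / p ^ 2 *
    (exp (height p X xi - exp (- xi)) * (height p X xi - exp (- xi)) ^ 2 / exp (- xi)).
Proof.
  intros hp HX Hy. rewrite dissip_eq by lra. pose proof (kap_div_pos p hp) as Hk.
  pose proof (kap_bounds p hp) as Hkb.
  apply Rmult_le_compat_l; [lra|]. pose proof (weight_mul_psi p xi) as H5.
  assert (Hg : 0 < weight p xi) by apply exp_pos.
  pose proof (exp_pos (- xi)) as Hs.
  set (g := weight p xi) in *. set (s := exp (- xi)) in *. set (y := height p X xi) in *.
  destruct (Rle_lt_or_eq_dec _ _ Hy) as [L|E].
  2:{ rewrite <- E.
      lra. }
  destruct (MVT_is_derive (theta p s) (fun t => psi p t * (t - s)) s y L) as [c [Hc E]].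
  { intros t Ht. apply theta_derive. lra. }
  rewrite E.
  assert (Hpc : psi p c <= psi p s * exp (y - s)).
  { unfold psi. rewrite <- exp_plus. apply exp_le.
    assert (ln s <= ln c) by (left; apply ln_increasing; lra). nra. }
  apply Rle_trans with (g * (psi p s * exp (y - s) * (y - s) * (y - s))).
  - apply Rmult_le_compat_l; [lra|]. apply Rmult_le_compat_r; [lra|].
    pose proof (psi_pos p c). apply Rmult_le_compat; lra.
  - replace (g * (psi p s * exp (y - s) * (y - s) * (y - s)))
      with ((g * psi p s) * (exp (y - s) * (y - s) ^ 2)) by ring.
    rewrite H5. lra.
Qed.

(** * Return times *)

(* arctan of a multiple of W'/W would have to decrease by more than PI. *)
Lemma riccati_blowup (W W1 W2 : R -> R) (a d K : R) :
  d ^ 2 / 4 + 16 <= K ->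
  (forall t, a <= t <= a + 1 -> 0 < W t /\ is_derive W t (W1 t) /\ is_derive W1 t (W2 t) /\
     W2 t <= - d * W1 t - K * W t) -> False.
Proof.
  intros HK H.
  pose (q := fun t => W1 t / W t + d / 2).
  pose (phi := fun t => atan (q t / 4)).
  pose (dphi := fun t => (W2 t / W t - (W1 t / W t) ^ 2) / 4 / (1 + (q t / 4) ^ 2)).
  assert (HD : forall t, a <= t <= a + 1 -> is_derive phi t (dphi t)).
  { intros t Ht. destruct (H t Ht) as [HW [D0 [D1 _]]].
    assert (Dq : is_derive (fun t => q t / 4) t ((W2 t / W t - (W1 t / W t) ^ 2) / 4)).
    { unfold q. derive_known. field. lra. }
    assert (Da : is_derive atan (q t / 4) (/ (1 + (q t / 4) ^ 2))).
    { apply is_derive_Reals. apply derivable_pt_lim_atan. }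
    pose proof (is_derive_comp atan (fun t => q t / 4) t _ _ Da Dq) as Dc.
    exact Dc. }
  destruct (MVT_is_derive phi dphi a (a + 1) ltac:(lra) HD) as [c [Hc E]].
  destruct (H c ltac:(lra)) as [HW [_ [_ HW2]]].
  (* Completing the square, q' <= d^2 / 4 - K - q^2 <= - (q^2 + 16), hence arctan (q / 4) has slope
     at most -4. Over a unit length this drop does not fit into the open range of arctan, of width
     PI <= 4. *)
  assert (Hle : dphi c <= - 4).
  { unfold dphi. set (r := W1 c / W c).
    assert (Hr : W2 c / W c <= - d * r - K).
    { unfold r. apply Rmult_le_reg_r with (W c); [lra|].
      replace (W2 c / W c * W c) with (W2 c) by (field; lra).
      replace ((- d * (W1 c / W c) - K) * W c) with (- d * W1 c - K * W c) by (field; lra). lra. }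
    assert (Hq : q c = r + d / 2) by reflexivity.
    assert (0 < 1 + (q c / 4) ^ 2) by nra.
    apply Rmult_le_reg_r with (1 + (q c / 4) ^ 2); [lra|].
    unfold Rdiv at 1. rewrite Rmult_assoc, Rinv_l by lra. rewrite Hq. nra. }
  pose proof (atan_bound (q a / 4)) as B1. pose proof (atan_bound (q (a + 1) / 4)) as B2.
  unfold phi in E. pose proof PI_4. nra.
Qed.

(** Two uses of exp z >= 1 + z; the 2 lost in [s - 2] pays for the power x^(- 2 p). *)
Lemma force_above (p s x : R) :
  2 < p -> 2 <= s -> 1 <= x -> (s - 2) * (x - 1) <= force p s x - x.
Proof.
  intros hp Hs Hx. unfold force. set (L := ln x).
  assert (HL : 0 <= L).
  { unfold L. rewrite <- ln_1. destruct Hx as [Hx|Hx]; [left; apply ln_increasing; lra|subst; lra]. }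
  assert (Ex : exp L = x) by (apply exp_ln; lra).
  replace ((1 - 2 * p) * L + s * (exp (p * L) - 1))
    with (L + (s * (exp (p * L) - 1) - 2 * (p * L))) by ring.
  rewrite exp_plus, Ex.
  pose proof (exp_ineq1_le (p * L)) as H1.
  assert (H2 : x <= exp (p * L)) by (rewrite <- Ex; apply exp_le; nra).
  pose proof (exp_ineq1_le (s * (exp (p * L) - 1) - 2 * (p * L))) as H3.
  assert (0 <= (s - 2) * (x - 1)) by nra. nra.
Qed.

Lemma no_long_above (p a : R) (X X1 : R -> R) :
  2 < p -> traj p a (a + 1) X X1 ->
  (1 - 2 / p) ^ 2 / 4 + 16 <= kap p / p * (exp (- (a + 1)) - 2) ->
  ~ (forall t, a <= t <= a + 1 -> 1 < X t).
Proof.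
  intros hp HT Hs HX. set (K := kap p / p * (exp (- (a + 1)) - 2)) in *.
  assert (Hkp : 0 < kap p / p).
  { pose proof (kap_bounds p hp). apply Rdiv_lt_0_compat; lra. }
  assert (Hs2 : 0 <= exp (- (a + 1)) - 2).
  { destruct (Rle_dec 0 (exp (- (a + 1)) - 2)) as [L|L]; [exact L|exfalso].
    pose proof (pow2_ge_0 (1 - 2 / p)). unfold K in Hs. nra. }
  apply (riccati_blowup (fun t => X t - 1) X1
    (fun t => - (1 - 2 / p) * X1 t + kap p / p * (X t - force p (exp (- t)) (X t))) a (1 - 2 / p) K Hs).
  intros t Ht. destruct (HT t Ht) as [_ [D0 D1]]. specialize (HX t Ht).
  split; [lra|]. split.
  - derive_known. ring.
  - split; [exact D1|].
    assert (Hst : exp (- (a + 1)) <= exp (- t)) by (apply exp_le; lra).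
    pose proof (force_above p (exp (- t)) (X t) hp ltac:(lra) ltac:(lra)) as HF.
    assert (kap p / p * ((exp (- (a + 1)) - 2) * (X t - 1)) <= kap p / p * (force p (exp (- t)) (X t) - X t)).
    { apply Rmult_le_compat_l; [lra|]. eapply Rle_trans; [|exact HF]. apply Rmult_le_compat_r; lra. }
    unfold K. lra.
Qed.

(** The lower bound on the force is of order [c * sg * W] while [W] is below [1 / sg], and at least
    [c / 2] above that level. In the linear regime a Riccati comparison forbids staying below
    [1 / sg] for a unit of time; in the saturated regime a ballistic estimate forbids staying above
    it for time [T + 1]. So [W] has to descend through the level, after which friction and the sign
    of [g] keep the velocity nonpositive: [W] stays below, against the first claim. *)
Lemma no_long_positive (W W1 W2 g : R -> R) (a d c sg T : R) :
  0 < d -> 0 < c -> 0 < sg -> d ^ 2 / 4 + 16 <= c * sg / 2 ->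
  T = 4 * (2 + d) / c + 2 ->
  (forall t, a <= t <= a + (T + 3) -> 0 < W t <= 1 /\ is_derive W t (W1 t) /\ is_derive W1 t (W2 t) /\
     W2 t = - d * W1 t - g t /\ c * (sg * W t / (1 + sg * W t)) <= g t) -> False.
Proof.
  intros Hd Hc Hsg HK HTe H.
  assert (HTpos : 2 < T).
  { rewrite HTe. assert (0 < 4 * (2 + d) / c) by (apply Rdiv_lt_0_compat; lra). lra. }
  assert (unit : forall b, a <= b <= a + (T + 2) -> exists t, b <= t <= b + 1 /\ 1 / sg < W t).
  { intros b Hb. apply NNPP. intros Hn.
    apply (riccati_blowup W W1 W2 b d (c * sg / 2) HK).
    intros t Ht. destruct (H t ltac:(lra)) as [HW [D0 [D1 [E2 Hg]]]].
    split; [lra|]. split; [exact D0|]. split; [exact D1|].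
    assert (HWs : W t <= 1 / sg).
    { apply Rnot_lt_le. intros Hlt. apply Hn. exists t. split; [lra|exact Hlt]. }
    assert (Hs1 : sg * W t <= 1).
    { apply Rmult_le_compat_l with (r := sg) in HWs; [|lra].
      replace (sg * (1 / sg)) with 1 in HWs by (field; lra). exact HWs. }
    assert (0 < sg * W t) by nra.
    assert (sg * W t / 2 <= sg * W t / (1 + sg * W t)).
    { apply Rmult_le_compat_l; [lra|]. apply Rinv_le_contravar; lra. }
    rewrite E2. assert (c * (sg * W t / 2) <= g t) by nra.
    lra. }
  assert (low : forall b, a <= b <= a + 2 -> exists t, b <= t <= b + (T + 1) /\ W t < 1 / sg).
  { intros b Hb. apply NNPP. intros Hn.
    assert (HWs : forall t, b <= t <= b + (T + 1) -> 1 / sg <= W t).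
    { intros t Ht. apply Rnot_lt_le. intros Hlt. apply Hn. exists t. split; assumption. }
    destruct (MVT_is_derive W W1 b (b + 1) ltac:(lra)) as [b' [Hb' Eb]].
    { intros t Ht. apply H. lra. }
    assert (HW1 : W1 b' <= 1).
    { destruct (H b ltac:(lra)) as [Hb0 _]. destruct (H (b + 1) ltac:(lra)) as [Hb1 _]. lra. }
    assert (Hvel : forall t, b' <= t <= b' + T -> W1 t <= 1 + d - c / 2 * (t - b')).
    { intros t Ht.
      assert (Hm : W1 t + d * W t + c / 2 * t <= W1 b' + d * W b' + c / 2 * b').
      { apply (nonincr_on (fun t => W1 t + d * W t + c / 2 * t) (fun t => W2 t + d * W1 t + c / 2)); [lra| |].
        - apply continuous_on_of_derive with (fun t => W2 t + d * W1 t + c / 2).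
          intros x [Hx Hx']. destruct (H x ltac:(lra)) as [_ [D0 [D1 _]]].
          derive_known. field.
        - intros x Hx. destruct (H x ltac:(lra)) as [HW [D0 [D1 [E2 Hg]]]]. split.
          + derive_known. field.
          + rewrite E2. specialize (HWs x ltac:(lra)).
            assert (Hs1 : 1 <= sg * W x).
            { apply Rmult_le_compat_l with (r := sg) in HWs; [|lra].
              replace (sg * (1 / sg)) with 1 in HWs by (field; lra). exact HWs. }
            assert (1 / 2 <= sg * W x / (1 + sg * W x)).
            { apply Rmult_le_reg_r with (1 + sg * W x); [lra|].
              replace (sg * W x / (1 + sg * W x) * (1 + sg * W x)) with (sg * W x) by (field; lra). lra. }
            nra. }
      destruct (H b' ltac:(lra)) as [Hb0 _]. destruct (H t ltac:(lra)) as [Ht0 _]. nra. }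
    assert (Hfin : W (b' + T) - ((1 + d) * T - c / 4 * T ^ 2) <= W b').
    { pose (Q := fun t => W t - ((1 + d) * (t - b') - c / 4 * (t - b') ^ 2)).
      assert (HQ : Q (b' + T) <= Q b').
      { assert (HDQ : forall x, b' <= x <= b' + T -> is_derive Q x (W1 x - (1 + d - c / 2 * (x - b')))).
        { intros x Hx. destruct (H x ltac:(lra)) as [_ [D0 _]]. unfold Q. derive_known. field. }
        apply (nonincr_on Q (fun t => W1 t - (1 + d - c / 2 * (t - b')))); [lra| |].
        - eapply continuous_on_of_derive. exact HDQ.
        - intros x Hx. split; [apply HDQ; lra|]. specialize (Hvel x ltac:(lra)). lra. }
      unfold Q in HQ.
      lra. }
    destruct (H b' ltac:(lra)) as [Hb0 _]. destruct (H (b' + T) ltac:(lra)) as [Ht0 _].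
    (* [T] is chosen so that the parabola [(1 + d) * T - c / 4 * T ^ 2] equals [- T - c / 2 * T],
       which is below -2, whereas [W] lies in (0, 1]. *)
    assert (E : c / 4 * T ^ 2 = T * (2 + d) + c / 2 * T).
    { replace (T ^ 2) with (T * T) by ring. rewrite HTe at 1. field. lra. }
    nra. }
  destruct (unit a ltac:(lra)) as [ta [Hta Wa]].
  destruct (low ta ltac:(lra)) as [tb [Htb Wb]].
  assert (Hab : ta < tb) by (destruct (Req_dec ta tb) as [e|e]; [subst; lra|lra]).
  destruct (MVT_is_derive W W1 ta tb Hab) as [m [Hm Em]].
  { intros t Ht. apply H. lra. }
  assert (Hneg : W1 m < 0) by nra.
  assert (Hdec : forall t, m <= t <= a + (T + 3) -> W1 t <= 0).
  { intros t Ht.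
    assert (HDe : forall x, a <= x <= a + (T + 3) ->
        is_derive (fun x => exp (d * x) * W1 x) x (exp (d * x) * (d * W1 x + W2 x))).
    { intros x Hx. destruct (H x Hx) as [_ [_ [D1 _]]]. derive_known. ring. }
    assert (Hm2 : exp (d * t) * W1 t <= exp (d * m) * W1 m).
    { apply (nonincr_on (fun x => exp (d * x) * W1 x) (fun x => exp (d * x) * (d * W1 x + W2 x))); [lra| |].
      - eapply continuous_on_of_derive. intros x [Hx Hx']. apply HDe. lra.
      - intros x Hx. split; [apply HDe; lra|].
        destruct (H x ltac:(lra)) as [HW [_ [_ [E2 Hg]]]]. rewrite E2.
        assert (0 <= sg * W x / (1 + sg * W x)).
        { assert (0 < sg * W x) by nra.
          apply Rmult_le_pos; [lra|]. left. apply Rinv_0_lt_compat. lra. }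
        assert (0 <= c * (sg * W x / (1 + sg * W x))) by nra.
        pose proof (exp_pos (d * x)).
        assert (0 <= exp (d * x) * g x) by nra. lra. }
    pose proof (exp_pos (d * t)). pose proof (exp_pos (d * m)).
    apply Rnot_lt_le. intros Hpos.
    assert (0 < exp (d * t) * W1 t) by nra.
    assert (0 < exp (d * m) * (- W1 m)) by nra. lra. }
  destruct (unit tb ltac:(lra)) as [tc [Htc Wc]].
  assert (W tc <= W tb).
  { apply (nonincr_on W W1); [lra| |].
    - apply continuous_on_of_derive with W1. intros x [Hx Hx']. apply H. lra.
    - intros x Hx. split; [apply H; lra|]. apply Hdec. lra. }
  lra.
Qed.

(** The singular power x^(- 2 p) contributes at most 2 p (1 - x) / x0 to the exponent, which [sg]
    concedes; then exp (- w) <= 1 / (1 + w). The rational form retains both the linear and the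
    saturated regime. *)
Lemma force_below (p s sg x0 x : R) :
  2 < p -> 0 < x0 -> x0 <= x <= 1 -> 0 <= s -> 0 < sg -> sg <= s - 2 * p / x0 ->
  x0 * (sg * (1 - x) / (1 + sg * (1 - x))) <= x - force p s x.
Proof.
  intros hp Hx0 Hx Hs Hsg Hss. unfold force. set (L := ln x).
  assert (Ex : exp L = x) by (apply exp_ln; lra).
  assert (HL : L <= 0).
  { unfold L. rewrite <- ln_1. destruct (proj2 Hx) as [H|H]; [left; apply ln_increasing; lra|rewrite H; lra]. }
  assert (HL2 : - L <= (1 - x) / x0).
  { pose proof (exp_ineq1_le (- L)) as H. rewrite exp_Ropp, Ex in H.
    apply Rle_trans with ((1 - x) / x).
    - apply Rle_trans with (/ x - 1); [lra|]. right. field. lra.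
    - apply Rmult_le_compat_l; [lra|]. apply Rinv_le_contravar; lra. }
  replace ((1 - 2 * p) * L + s * (exp (p * L) - 1))
    with (L + (- 2 * p * L + s * (exp (p * L) - 1))) by ring.
  rewrite exp_plus, Ex.
  assert (H2 : exp (p * L) <= x) by (rewrite <- Ex; apply exp_le; nra).
  assert (H3 : - 2 * p * L + s * (exp (p * L) - 1) <= - (sg * (1 - x))) by nra.
  set (w := sg * (1 - x)) in *. assert (Hw : 0 <= w) by (unfold w; apply Rmult_le_pos; lra).
  assert (H4 : exp (- 2 * p * L + s * (exp (p * L) - 1)) <= / (1 + w)).
  { eapply Rle_trans; [apply exp_le; exact H3|]. rewrite exp_Ropp. apply Rinv_le_contravar; [lra|].
    apply exp_ineq1_le. }
  assert (H5 : w / (1 + w) = 1 - / (1 + w)) by (field; lra).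
  assert (H6 : / (1 + w) <= 1) by nra.
  rewrite H5. nra.
Qed.

Lemma no_long_below (p x0 : R) : 2 < p -> 0 < x0 -> exists S T, 0 < S /\ 0 < T /\
  forall (X X1 : R -> R) a, traj p a (a + T) X X1 -> S <= exp (- (a + T)) ->
  ~ (forall t, a <= t <= a + T -> x0 <= X t < 1).
Proof.
  intros hp Hx0. pose proof (kap_bounds p hp) as Hkb.
  assert (Hkp : 0 < kap p / p) by (apply Rdiv_lt_0_compat; lra).
  set (d := 1 - 2 / p).
  assert (Hd : 0 < d) by (apply damping_bounds; exact hp).
  set (c := kap p / p * x0). assert (Hc : 0 < c) by (apply Rmult_lt_0_compat; lra).
  (* The stiffness for which the Riccati threshold in [no_long_positive] holds with equality. *)
  set (sg := 2 * (d ^ 2 / 4 + 16) / c).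
  assert (Hsg : 0 < sg).
  { apply Rdiv_lt_0_compat; [|lra]. pose proof (pow2_ge_0 d). lra. }
  set (T0 := 4 * (2 + d) / c + 2).
  assert (HT0 : 0 < 4 * (2 + d) / c) by (apply Rdiv_lt_0_compat; lra).
  assert (Hpx : 0 < 2 * p / x0) by (apply Rdiv_lt_0_compat; lra).
  exists (sg + 2 * p / x0), (T0 + 3). split; [lra|]. split; [unfold T0; lra|].
  intros X X1 a HT HS HX.
  apply (no_long_positive (fun t => 1 - X t) (fun t => - X1 t)
    (fun t => - (- d * X1 t + kap p / p * (X t - force p (exp (- t)) (X t))))
    (fun t => kap p / p * (X t - force p (exp (- t)) (X t))) a d c sg T0 Hd Hc Hsg).
  - right. unfold sg. field. lra.
  - reflexivity.
  - intros t Ht. destruct (HT t Ht) as [HXp [D0 D1]]. specialize (HX t Ht). fold d in D1.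
    split; [lra|]. split; [|split; [|split]].
    + derive_known. ring.
    + derive_known. ring.
    + ring.
    + assert (Hst : exp (- (a + (T0 + 3))) <= exp (- t)) by (apply exp_le; lra).
      pose proof (force_below p (exp (- t)) sg x0 (X t) hp Hx0 ltac:(lra) ltac:(lra) Hsg ltac:(lra)) as HF.
      unfold c. rewrite Rmult_assoc. apply Rmult_le_compat_l; [lra|exact HF].
Qed.

(** * Radial solutions and the change of variables *)

(** [solves_P] with the derivatives as parameters, so that estimates can refer to them. *)
Definition psol (f : R -> R) (l : R) (v v1 v2 : R -> R) : Prop :=
  C2_with (Icc 0 1) v v1 v2 /\
  (forall r, Ioo 0 1 r -> radial_eq (fun t => l * f t) v v1 v2 r /\ 0 < v r) /\
  v1 0 = 0 /\ v 1 = 0.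

Lemma psol_derive (f : R -> R) (l r : R) (v v1 v2 : R -> R) :
  psol f l v v1 v2 -> 0 < r < 1 ->
  is_derive v r (v1 r) /\ is_derive v1 r (v2 r) /\ v2 r = - / r * v1 r - l * f (v r) /\ 0 < v r.
Proof.
  intros [[D0 [D1 _]] [H _]] Hr.
  assert (HI : forall y, 0 < y < 1 -> Icc 0 1 y) by (unfold Icc; intros; lra).
  split; [exact (is_derive_on_interior _ _ _ 0 1 r D0 HI Hr)|].
  split; [exact (is_derive_on_interior _ _ _ 0 1 r D1 HI Hr)|].
  destruct (H r Hr) as [E Hv]. split; [|exact Hv]. unfold radial_eq in E. lra.
Qed.

Lemma psol_continuous (f : R -> R) (l : R) (v v1 v2 : R -> R) :
  psol f l v v1 v2 -> continuous_on_set (Icc 0 1) v /\ continuous_on_set (Icc 0 1) v1.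
Proof.
  intros [[D0 [D1 _]] _]. split; eapply is_derive_on_continuous; eassumption.
Qed.

Lemma psol_nonneg (f : R -> R) (l r : R) (v v1 v2 : R -> R) :
  psol f l v v1 v2 -> 0 < r <= 1 -> 0 <= v r.
Proof.
  intros H Hr. destruct (Req_dec r 1) as [E|E].
  - subst. destruct H as [_ [_ [_ E]]]. lra.
  - left. apply (psol_derive f l r v v1 v2 H). lra.
Qed.

(** * Operations on functions continuous relative to a set *)

Lemma continuous_on_set_mult (D : R -> Prop) (v w : R -> R) :
  continuous_on_set D v -> continuous_on_set D w -> continuous_on_set D (fun x => v x * w x).
Proof.
  intros Hv Hw x Dx.
  eapply filterlim_comp_2; [exact (Hv x Dx)|exact (Hw x Dx)|].
  exact (@filterlim_mult R_AbsRing (v x) (w x)).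
Qed.

Lemma continuous_on_set_plus (D : R -> Prop) (v w : R -> R) :
  continuous_on_set D v -> continuous_on_set D w -> continuous_on_set D (fun x => v x + w x).
Proof.
  intros Hv Hw x Dx.
  eapply filterlim_comp_2; [exact (Hv x Dx)|exact (Hw x Dx)|].
  exact (@filterlim_plus R_AbsRing R_NormedModule (v x) (w x)).
Qed.

Lemma continuous_on_set_minus (D : R -> Prop) (v w : R -> R) :
  continuous_on_set D v -> continuous_on_set D w -> continuous_on_set D (fun x => v x - w x).
Proof.
  intros Hv Hw. apply continuous_on_set_plus; [exact Hv|].
  intros x Dx. eapply filterlim_comp; [exact (Hw x Dx)|].
  exact (@filterlim_opp R_AbsRing R_NormedModule (w x)).
Qed.

Lemma continuous_on_set_const (D : R -> Prop) (c : R) : continuous_on_set D (fun _ => c).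
Proof. apply continuous_on_of_continuous. intros; apply continuous_const. Qed.

Lemma continuous_on_set_comp (D D' : R -> Prop) (v w : R -> R) :
  (forall x, D x -> D' (v x)) -> continuous_on_set D v -> continuous_on_set D' w ->
  continuous_on_set D (fun x => w (v x)).
Proof.
  intros H Hv Hw. apply continuous_on_set_eps. intros x Dx eps Heps.
  destruct (proj1 (continuous_on_set_eps _ _) Hw (v x) (H x Dx) eps Heps) as [e [He0 He]].
  destruct (proj1 (continuous_on_set_eps _ _) Hv x Dx e He0) as [d [Hd0 Hd]].
  exists d. split; [exact Hd0|]. intros y Dy Hy. apply He; auto.
Qed.

Lemma continuous_on_set_of_ex_derive (D : R -> Prop) (v : R -> R) :
  (forall x, ex_derive v x) -> continuous_on_set D v.
Proof.
  intros H. apply continuous_on_of_continuous. intros x _.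
  apply (@ex_derive_continuous R_AbsRing R_NormedModule). apply H.
Qed.

(** * Flux estimates, and the equation for the rescaled unknown *)

Section Solution.

Variables (f : R -> R) (l : R) (v v1 v2 : R -> R).
Hypothesis fpos : forall t, 0 <= t -> 0 <= f t.
Hypothesis lpos : 0 < l.
Hypothesis Hsol : psol f l v v1 v2.

Lemma flux_derive (r : R) : 0 < r < 1 -> is_derive (fun r => r * v1 r) r (- (r * (l * f (v r)))).
Proof.
  intros Hr. destruct (psol_derive _ _ _ _ _ _ Hsol Hr) as [_ [D1 [E _]]].
  derive_known. rewrite E. field. lra.
Qed.

Lemma flux_continuous : continuous_on_set (Icc 0 1) (fun r => r * v1 r).
Proof.
  apply continuous_on_set_mult; [|apply (psol_continuous _ _ _ _ _ Hsol)].
  apply continuous_on_set_of_ex_derive. intros x. auto_derive. exact I.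
Qed.

Lemma flux_nonincr (r r' : R) : 0 <= r -> r <= r' -> r' <= 1 -> r' * v1 r' <= r * v1 r.
Proof.
  intros H0 H1 H2.
  apply (nonincr_on (fun r => r * v1 r) (fun r => - (r * (l * f (v r))))); [exact H1| |].
  - apply continuous_on_set_sub with (2 := flux_continuous). unfold Icc. intros; lra.
  - intros x Hx. split; [apply flux_derive; lra|].
    pose proof (fpos (v x) (psol_nonneg _ _ x _ _ _ Hsol ltac:(lra))).
    assert (0 <= x * (l * f (v x))) by (repeat apply Rmult_le_pos; lra). lra.
Qed.

Lemma psol_v1_nonpos (r : R) : 0 <= r <= 1 -> v1 r <= 0.
Proof.
  intros Hr. destruct (Req_dec r 0) as [E|E].
  - subst. destruct Hsol as [_ [_ [E _]]]. lra.
  - pose proof (flux_nonincr 0 r ltac:(lra) ltac:(lra) ltac:(lra)). nra.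
Qed.

Lemma psol_nonincr (r r' : R) : 0 <= r -> r <= r' -> r' <= 1 -> v r' <= v r.
Proof.
  intros H0 H1 H2. apply (nonincr_on v v1); [exact H1| |].
  - apply continuous_on_set_sub with (2 := proj1 (psol_continuous _ _ _ _ _ Hsol)).
    unfold Icc. intros; lra.
  - intros x Hx. split; [apply (psol_derive _ _ _ _ _ _ Hsol); lra|].
    apply psol_v1_nonpos. lra.
Qed.

Lemma flux_lower (M r : R) :
  (forall t, 0 <= t <= v 0 -> f t <= M) -> 0 <= r <= 1 -> - (l * M * r ^ 2 / 2) <= r * v1 r.
Proof.
  intros HM Hr.
  assert (H : 0 * v1 0 + l * M * 0 ^ 2 / 2 <= r * v1 r + l * M * r ^ 2 / 2).
  { apply (nondecr_on (fun r => r * v1 r + l * M * r ^ 2 / 2)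
       (fun r => - (r * (l * f (v r))) + l * M * r)); [lra| |].
    - apply continuous_on_set_plus.
      + apply continuous_on_set_sub with (2 := flux_continuous). unfold Icc; intros; lra.
      + apply continuous_on_set_of_ex_derive. intros x. auto_derive. exact I.
    - intros x Hx. split.
      + apply (@is_derive_plus R_AbsRing R_NormedModule); [apply flux_derive; lra|].
        auto_derive; [exact I|]. field.
      + assert (f (v x) <= M).
        { apply HM. split; [apply (psol_nonneg _ _ _ _ _ _ Hsol); lra|apply psol_nonincr; lra]. }
        assert (0 <= x * (l * (M - f (v x)))) by (repeat apply Rmult_le_pos; lra). lra. }
  lra.
Qed.

Lemma psol_lower (M r : R) :
  (forall t, 0 <= t <= v 0 -> f t <= M) -> 0 <= r <= 1 -> v 0 - l * M * r ^ 2 / 4 <= v r.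
Proof.
  intros HM Hr.
  assert (H : v 0 + l * M * 0 ^ 2 / 4 <= v r + l * M * r ^ 2 / 4).
  { apply (nondecr_on (fun r => v r + l * M * r ^ 2 / 4) (fun r => v1 r + l * M * r / 2)); [lra| |].
    - apply continuous_on_set_plus.
      + apply continuous_on_set_sub with (2 := proj1 (psol_continuous _ _ _ _ _ Hsol)).
        unfold Icc; intros; lra.
      + apply continuous_on_set_of_ex_derive. intros x. auto_derive. exact I.
    - intros x Hx. split.
      + apply (@is_derive_plus R_AbsRing R_NormedModule); [apply (psol_derive _ _ _ _ _ _ Hsol); lra|].
        auto_derive; [exact I|]. field.
      + pose proof (flux_lower M x HM ltac:(lra)). apply Rmult_le_reg_l with x; [lra|]. lra. }
  lra.
Qed.

(* xi = - ln s with s = - 2 ln (sqrt l * r). *)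
Definition rr (xi : R) : R := exp (- (exp (- xi) / 2)) / sqrt l.

Definition Xf (p xi : R) : R := exp (xi / p) * v (rr xi).

Definition Xf1 (p xi : R) : R :=
  Xf p xi / p + exp (xi / p) * (rr xi * v1 (rr xi)) * exp (- xi) / 2.

Lemma rr_pos (xi : R) : 0 < rr xi.
Proof. apply Rdiv_lt_0_compat; [apply exp_pos|apply sqrt_lt_R0; exact lpos]. Qed.

Lemma rr_increasing (x y : R) : x <= y -> rr x <= rr y.
Proof.
  intros H. apply Rmult_le_compat_r.
  - left. apply Rinv_0_lt_compat. apply sqrt_lt_R0. exact lpos.
  - apply exp_le. assert (exp (- y) <= exp (- x)) by (apply exp_le; lra). lra.
Qed.

Lemma rr_strict (x y : R) : x < y -> rr x < rr y.
Proof.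
  intros H. apply Rmult_lt_compat_r.
  - apply Rinv_0_lt_compat. apply sqrt_lt_R0. exact lpos.
  - apply exp_increasing. assert (exp (- y) < exp (- x)) by (apply exp_increasing; lra). lra.
Qed.

Lemma rr_derive (xi : R) : is_derive rr xi (rr xi * exp (- xi) / 2).
Proof.
  assert (0 < sqrt l) by (apply sqrt_lt_R0; exact lpos).
  unfold rr. auto_derive; [lra|]. unfold Rdiv. field. lra.
Qed.

Lemma rr_sq (xi : R) : l * rr xi ^ 2 = exp (- exp (- xi)).
Proof.
  assert (0 < sqrt l) by (apply sqrt_lt_R0; exact lpos).
  assert (E : l = sqrt l ^ 2) by (simpl; rewrite Rmult_1_r, sqrt_sqrt; lra).
  unfold rr. rewrite E at 1.
  replace (sqrt l ^ 2 * (exp (- (exp (- xi) / 2)) / sqrt l) ^ 2)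
    with (exp (- (exp (- xi) / 2)) * exp (- (exp (- xi) / 2))) by (field; lra).
  rewrite <- exp_plus. f_equal. field.
Qed.

Lemma Xf_derive (p xi : R) : p <> 0 -> rr xi < 1 -> is_derive (Xf p) xi (Xf1 p xi).
Proof.
  intros hp Hr. pose proof (rr_pos xi) as Hr0.
  destruct (psol_derive _ _ _ _ _ _ Hsol (conj Hr0 Hr)) as [D0 _].
  pose proof (rr_derive xi) as Dr.
  unfold Xf1, Xf. derive_known. unfold Rdiv. field. exact hp.
Qed.

(** The identity [l * rr xi ^ 2 = exp (- exp (- xi))] removes both [l] and the radius from the
    coefficients; this is why the later constants do not depend on the parameter. *)
Lemma Xf1_derive (p xi : R) : p <> 0 -> rr xi < 1 ->
  is_derive (Xf1 p) xi (- (1 - 2 / p) * Xf1 p xi + kap p / p * Xf p xi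
    - exp (xi / p) * exp (- xi) ^ 2 * exp (- exp (- xi)) * f (v (rr xi)) / 4).
Proof.
  intros hp Hr. pose proof (rr_pos xi) as Hr0.
  pose proof (flux_derive (rr xi) (conj Hr0 Hr)) as DF. pose proof (rr_derive xi) as Dr.
  assert (Dv : is_derive (fun x => rr x * v1 (rr x)) xi
      (rr xi * exp (- xi) / 2 * - (rr xi * (l * f (v (rr xi))))))
    by exact (is_derive_comp (fun r => r * v1 r) rr xi _ _ DF Dr).
  pose proof (Xf_derive p xi hp Hr) as DX.
  assert (Ds : is_derive (fun x => exp (x / p) * (exp (- x) / 2)) xi
     (exp (xi / p) * (exp (- xi) / 2) * (1 / p - 1))).
  { auto_derive; [exact I|]. unfold Rdiv. field. exact hp. }
  pose proof (is_derive_mult _ _ _ _ _ Ds Dv Rmult_comm) as DP.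
  assert (DX' : is_derive (fun x => Xf p x / p) xi (Xf1 p xi / p)).
  { derive_known. field. exact hp. }
  pose proof (is_derive_plus _ _ _ _ _ DX' DP) as DS.
  match type of DS with is_derive _ _ ?V => match goal with |- is_derive _ _ ?U =>
    replace U with V end end.
  - apply is_derive_ext with (2 := DS). intros t. unfold Xf1. unfold plus, mult; simpl. field. exact hp.
  - pose proof (rr_sq xi) as E. unfold plus, mult; simpl.
    replace (exp (xi / p) * (exp (- xi) * (exp (- xi) * 1)) * exp (- exp (- xi)) * f (v (rr xi)) / 4)
      with (exp (xi / p) * (exp (- xi) * (exp (- xi) * 1)) * (l * rr xi ^ 2) * f (v (rr xi)) / 4)
      by (rewrite E; reflexivity).
    unfold Xf1, kap. field. exact hp.
Qed.

End Solution.

(** * Crossings of the singular profile *)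

Lemma nonlinearity_continuous (p tau0 : R) (f : R -> R) :
  nonlinearity p tau0 f -> continuous_on_set (Ici 0) f.
Proof.
  intros [[f1 [f2 [H _]]] _]. eapply is_derive_on_continuous. exact H.
Qed.

Lemma nonlinearity_large (p tau0 t : R) (f : R -> R) :
  0 < p -> nonlinearity p tau0 f -> tau0 <= t ->
  f t = 4 * (kap p / p) * exp ((1 - 2 * p) * ln t + exp (p * ln t)).
Proof.
  intros hp [_ [_ H]] Ht. rewrite (H t Ht), exp_plus. unfold Rpower, kap. field. lra.
Qed.

Lemma nonlinearity_exp_bound (p tau0 : R) (f : R -> R) :
  2 < p -> 0 < tau0 -> nonlinearity p tau0 f -> exists C, 0 < C /\
  forall mu t, 0 <= t <= mu -> tau0 <= mu -> f t <= C * exp (exp (p * ln mu)).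
Proof.
  intros hp ht hf. pose proof (kap_bounds p hp) as Hk.
  assert (Hc : continuous_on_set (Icc 0 tau0) f).
  { apply continuous_on_set_sub with (2 := nonlinearity_continuous _ _ _ hf).
    unfold Icc, Ici; intros; lra. }
  destruct (continuous_on_bounded f 0 tau0 ltac:(lra) Hc) as [M [HM0 HM]].
  set (A := 4 * (kap p / p) * exp ((1 - 2 * p) * ln tau0)).
  assert (HA : 0 < A).
  { apply Rmult_lt_0_compat; [|apply exp_pos]. assert (0 < kap p / p) by (apply Rdiv_lt_0_compat; lra). lra. }
  exists (M + A). split; [lra|]. intros mu t Ht Hmu.
  assert (He : 1 <= exp (exp (p * ln mu))).
  { pose proof (exp_ineq1_le (exp (p * ln mu))). pose proof (exp_pos (p * ln mu)). lra. }
  destruct (Rle_dec t tau0) as [L|L].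
  - specialize (HM t ltac:(lra)). pose proof (Rle_abs (f t)). nra.
  - rewrite (nonlinearity_large p tau0 t f ltac:(lra) hf ltac:(lra)). rewrite exp_plus.
    rewrite <- Rmult_assoc.
    assert (Hl : ln tau0 <= ln t) by (left; apply ln_increasing; lra).
    assert (Hl2 : ln t <= ln mu).
    { apply ln_le; lra. }
    assert (E1 : exp ((1 - 2 * p) * ln t) <= exp ((1 - 2 * p) * ln tau0)) by (apply exp_le; nra).
    assert (E2 : exp (exp (p * ln t)) <= exp (exp (p * ln mu))).
    { apply exp_le. apply exp_le. nra. }
    assert (0 < kap p / p) by (apply Rdiv_lt_0_compat; lra).
    assert (4 * (kap p / p) * exp ((1 - 2 * p) * ln t) <= A)
      by (unfold A; apply Rmult_le_compat_l; lra).
    pose proof (exp_pos ((1 - 2 * p) * ln t)). pose proof (exp_pos (exp (p * ln t))).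
    apply Rle_trans with (A * exp (exp (p * ln mu))); [|nra].
    apply Rmult_le_compat; nra.
Qed.

Lemma force_eq (p tau0 xi V : R) (f : R -> R) :
  2 < p -> 0 < tau0 -> nonlinearity p tau0 f -> tau0 <= V ->
  exp (xi / p) * exp (- xi) ^ 2 * exp (- exp (- xi)) * f V / 4
  = kap p / p * force p (exp (- xi)) (exp (xi / p) * V).
Proof.
  intros hp ht hf HV. rewrite (nonlinearity_large p tau0 V f ltac:(lra) hf HV).
  unfold force. rewrite ln_mult by (try apply exp_pos; lra). rewrite ln_exp.
  replace ((1 - 2 * p) * (xi / p + ln V) + exp (- xi) * (exp (p * (xi / p + ln V)) - 1))
    with (xi / p + (- xi + - xi) + - exp (- xi) + ((1 - 2 * p) * ln V + exp (p * ln V))).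
  - rewrite (exp_plus (xi / p + (- xi + - xi) + - exp (- xi)) ((1 - 2 * p) * ln V + exp (p * ln V))).
    rewrite (exp_plus (xi / p + (- xi + - xi))), (exp_plus (xi / p)), (exp_plus (- xi) (- xi)). field. lra.
  - replace (p * (xi / p + ln V)) with (xi + p * ln V) by (field; lra).
    replace (exp (- xi) * (exp (xi + p * ln V) - 1)) with (exp (p * ln V) - exp (- xi)).
    + field. lra.
    + rewrite Rmult_minus_distr_l, <- exp_plus. replace (- xi + (xi + p * ln V)) with (p * ln V) by ring. ring.
Qed.

Lemma Xf_traj (p tau0 l a b : R) (f v v1 v2 : R -> R) :
  2 < p -> 0 < tau0 -> nonlinearity p tau0 f -> 0 < l -> psol f l v v1 v2 ->
  rr l b < 1 -> tau0 <= v (rr l b) -> traj p a b (Xf l v p) (Xf1 l v v1 p).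
Proof.
  intros hp ht hf hl Hs Hb Hv xi Hxi.
  assert (fpos : forall t, 0 <= t -> 0 <= f t) by apply hf.
  pose proof (rr_increasing l hl xi b ltac:(lra)) as Hr. pose proof (rr_pos l hl xi) as Hr0.
  assert (HV : tau0 <= v (rr l xi)).
  { eapply Rle_trans; [exact Hv|]. apply (psol_nonincr f l v v1 v2); try assumption; lra. }
  split.
  - apply Rmult_lt_0_compat; [apply exp_pos|lra].
  - split; [apply Xf_derive with (f := f) (v2 := v2); try assumption; lra|].
    pose proof (Xf1_derive f l v v1 v2 hl Hs p xi ltac:(lra) ltac:(lra)) as D.
    rewrite (force_eq p tau0 xi (v (rr l xi)) f hp ht hf HV) in D.
    change (exp (xi / p) * v (rr l xi)) with (Xf l v p xi) in D.
    replace (- (1 - 2 / p) * Xf1 l v v1 p xi + kap p / p * (Xf l v p xi - force p (exp (- xi)) (Xf l v p xi)))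
      with (- (1 - 2 / p) * Xf1 l v v1 p xi + kap p / p * Xf l v p xi - kap p / p * force p (exp (- xi)) (Xf l v p xi))
      by ring. exact D.
Qed.

Lemma Xf_height (p l xi : R) (v : R -> R) :
  0 < p -> 0 < v (rr l xi) -> height p (Xf l v p) xi = exp (p * ln (v (rr l xi))).
Proof.
  intros hp Hv. unfold height, Xf. rewrite ln_mult by (try apply exp_pos; lra).
  rewrite ln_exp. f_equal. field. lra.
Qed.

(* The value of xi at s = 2 mu^p: there u is still close to mu, hence X^p < 1. *)
Definition start (p mu : R) : R := - ln (2 * exp (p * ln mu)).

Lemma start_time (p mu : R) : exp (- start p mu) = 2 * exp (p * ln mu).
Proof.
  unfold start. rewrite Ropp_involutive. apply exp_ln. pose proof (exp_pos (p * ln mu)). lra.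
Qed.

(** The energy deficit at the start: there X >= 1/4 and 0 <= X' <= X / p, and the potential is
    nonpositive, so the energy is at most - (p - 2) / (2 p^2) X^2 with X^2 >= 1/16. *)
Definition e0 (p : R) : R := (p - 2) / (32 * p ^ 2).

Lemma exp_p_ln_ge (p mu : R) : 1 < p -> 1 <= mu -> mu <= exp (p * ln mu).
Proof.
  intros hp Hm. rewrite <- (exp_ln mu) at 1 by lra. apply exp_le.
  assert (0 <= ln mu) by (rewrite <- ln_1; apply ln_le; lra).
  nra.
Qed.

Lemma start_energy (p tau0 : R) (f : R -> R) :
  2 < p -> 0 < tau0 -> nonlinearity p tau0 f -> exists mu0, 2 * tau0 < mu0 /\ 1 < mu0 /\
  forall l v v1 v2, 0 < l -> psol f l v v1 v2 -> mu0 <= v 0 ->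
    rr l (start p (v 0)) < 1 /\ v 0 / 2 <= v (rr l (start p (v 0))) /\
    energy p (Xf l v p) (Xf1 l v v1 p) (start p (v 0)) <= - e0 p.
Proof.
  intros hp ht hf.
  destruct (nonlinearity_exp_bound p tau0 f hp ht hf) as [C [HC HCb]].
  assert (fpos : forall t, 0 <= t -> 0 <= f t) by apply hf.
  exists (1 + tau0 + p * C + 2 * C + tau0 + 1).
  assert (HpC : 0 < p * C) by nra.
  split; [lra|]. split; [lra|].
  intros l v v1 v2 hl Hs Hmu. set (mu := v 0) in *. set (xi := start p mu).
  set (Y := exp (p * ln mu)). set (M := C * exp Y).
  assert (HY : mu <= Y) by (apply exp_p_ln_ge; lra).
  assert (Hst : exp (- xi) = 2 * Y) by apply start_time.
  assert (HM : forall t, 0 <= t <= v 0 -> f t <= M).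
  { intros t Ht. apply HCb; [exact Ht|]. lra. }
  assert (Hsq : l * rr l xi ^ 2 = exp (- (2 * Y))) by (rewrite rr_sq by exact hl; rewrite Hst; reflexivity).
  (* On the range of [v], [f] is at most C exp Y, while l r^2 = exp (- 2 Y): the factor 2 in [start]
     makes the change of [v] up to this radius exponentially small. *)
  assert (HMsq : l * M * rr l xi ^ 2 = C * exp (- Y)).
  { replace (l * M * rr l xi ^ 2) with (M * (l * rr l xi ^ 2)) by ring. rewrite Hsq. unfold M.
    rewrite Rmult_assoc, <- exp_plus. do 2 f_equal. ring. }
  assert (HeY : Y * exp (- Y) <= 1).
  { rewrite exp_Ropp. pose proof (exp_ineq1_le Y). apply Rmult_le_reg_r with (exp Y); [apply exp_pos|].
    rewrite Rmult_assoc, Rinv_l by (pose proof (exp_pos Y); lra). lra. }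
  assert (Hr0 : 0 < rr l xi) by (apply rr_pos; exact hl).
  assert (Hr1 : rr l xi < 1).
  (* If the starting radius were at least 1, the same bound at r = 1 would keep [v 1] positive. *)
  { apply Rnot_le_lt. intros Hge.
    pose proof (psol_lower f l v v1 v2 fpos hl Hs M 1 HM ltac:(lra)) as HL.
    destruct Hs as [_ [_ [_ Ev1]]]. rewrite Ev1 in HL. fold mu in HL.
    assert (l * M * 1 ^ 2 <= l * M * rr l xi ^ 2).
    { apply Rmult_le_compat_l; [|apply pow_incr; lra].
      pose proof (exp_pos Y). nra. }
    nra. }
  assert (HVlow : mu / 2 <= v (rr l xi)).
  { pose proof (psol_lower f l v v1 v2 fpos hl Hs M (rr l xi) HM ltac:(lra)) as HL.
    rewrite HMsq in HL. fold mu in HL. nra. }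
  split; [exact Hr1|]. split; [exact HVlow|].
  assert (HVup : v (rr l xi) <= mu) by (unfold mu; apply (psol_nonincr f l v v1 v2); try assumption; lra).
  assert (HB : - (C * exp (- Y) / 2) <= rr l xi * v1 (rr l xi) <= 0).
  { split.
    - pose proof (flux_lower f l v v1 v2 fpos hl Hs M (rr l xi) HM ltac:(lra)) as HL. rewrite HMsq in HL. lra.
    - pose proof (psol_v1_nonpos f l v v1 v2 fpos hl Hs (rr l xi) ltac:(lra)). nra. }
  set (V := v (rr l xi)) in *. set (B := rr l xi * v1 (rr l xi)) in *. set (E := exp (xi / p)).
  assert (HE : 0 < E) by apply exp_pos.
  assert (EX : Xf l v p xi = E * V) by reflexivity.
  assert (EX1 : Xf1 l v v1 p xi = E * (V / p + B * Y)).
  { unfold Xf1. rewrite EX. fold B. fold E. rewrite Hst. field. lra. }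
  (* [Y * exp (- Y) <= 1] bounds the flux term by C / 2, and the threshold on mu exceeds p C, so V /
     p >= mu / (2 p) absorbs it. *)
  assert (HX1 : 0 <= Xf1 l v v1 p xi <= Xf l v p xi / p).
  { rewrite EX1, EX. split.
    - apply Rmult_le_pos; [lra|].
      assert (- (C / 2) <= B * Y) by nra.
      assert (C / 2 <= V / p).
      { apply Rmult_le_reg_r with p; [lra|]. replace (V / p * p) with V by (field; lra). nra. }
      lra.
    - assert (B * Y <= 0) by nra. replace (E * V / p) with (E * (V / p)) by (field; lra).
      apply Rmult_le_compat_l; lra. }
  assert (HElow : 1 / (2 * mu) <= E).
  { unfold E, xi, start.
    replace (1 / (2 * mu)) with (exp (- ln (2 * mu))) by (rewrite exp_Ropp, exp_ln by lra; field; lra).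
    apply exp_le. unfold Y. rewrite !ln_mult by (try apply exp_pos; lra). rewrite ln_exp.
    assert (0 < ln 2) by (rewrite <- ln_1; apply ln_increasing; lra).
    replace (- (ln 2 + p * ln mu) / p) with (- (ln 2 / p) - ln mu) by (field; lra).
    assert (ln 2 / p <= ln 2).
    { apply Rmult_le_reg_r with p; [lra|]. replace (ln 2 / p * p) with (ln 2) by (field; lra). nra. }
    lra. }
  assert (HXlow : 1 / 4 <= Xf l v p xi).
  { rewrite EX. replace (1 / 4) with (1 / (2 * mu) * (mu / 2)) by (field; lra).
    apply Rmult_le_compat; try lra. apply Rdiv_le_0_compat; lra. }
  assert (Hpot : pot p (Xf l v p) xi <= 0).
  { unfold pot. pose proof (kap_div_pos p hp).
    assert (Hh : height p (Xf l v p) xi <= exp (- xi)).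
    { rewrite Xf_height by (try lra; fold V; lra). fold V. rewrite Hst.
      assert (exp (p * ln V) <= Y).
      { apply exp_le. apply Rmult_le_compat_l; [lra|].
        apply ln_le; lra. }
      lra. }
    assert (0 < weight p xi) by apply exp_pos.
    pose proof (Psi_increasing p (height p (Xf l v p) xi) (exp (- xi)) (exp_pos _) Hh).
    assert (0 <= weight p xi * (Psi p (exp (- xi)) - Psi p (height p (Xf l v p) xi)))
      by (apply Rmult_le_pos; lra).
    assert (0 <= kap p / p ^ 2 * (weight p xi * (Psi p (exp (- xi)) - Psi p (height p (Xf l v p) xi))))
      by (apply Rmult_le_pos; lra).
    lra. }
  unfold energy. set (X := Xf l v p xi) in *. set (X1 := Xf1 l v v1 p xi) in *.
  assert (X1 ^ 2 <= (X / p) ^ 2) by (apply pow_incr; lra).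
  assert (Ek : kap p / (2 * p) = (p - 1) / (2 * p ^ 2)) by (unfold kap; field; lra).
  unfold e0. rewrite Ek.
  assert (Hx2 : 1 / 16 <= X ^ 2) by (replace (1 / 16) with ((1 / 4) ^ 2) by field; apply pow_incr; lra).
  apply Rle_trans with ((X / p) ^ 2 / 2 - (p - 1) / (2 * p ^ 2) * X ^ 2); [lra|].
  replace ((X / p) ^ 2 / 2 - (p - 1) / (2 * p ^ 2) * X ^ 2) with (- ((p - 2) / (2 * p ^ 2) * X ^ 2)) by (field; lra).
  assert (0 < (p - 2) / (2 * p ^ 2)) by (apply Rdiv_lt_0_compat; nra).
  replace ((p - 2) / (32 * p ^ 2)) with ((p - 2) / (2 * p ^ 2) * (1 / 16)) by (field; lra).
  nra.
Qed.

Lemma e0_pos (p : R) : 2 < p -> 0 < e0 p.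
Proof. intros hp. unfold e0. apply Rdiv_lt_0_compat; nra. Qed.

(** The value at which [kap p / (2 * p) * x ^ 2] equals half the deficit [e0 p]; the other half
    absorbs the O(1 / s) error of the potential. *)
Definition x0 (p : R) : R := sqrt (p / kap p * e0 p).

Lemma x0_pos (p : R) : 2 < p -> 0 < x0 p.
Proof.
  intros hp. pose proof (kap_bounds p hp). pose proof (e0_pos p hp).
  apply sqrt_lt_R0. apply Rmult_lt_0_compat; [apply Rdiv_lt_0_compat; lra|lra].
Qed.

(* A trajectory of negative energy cannot come close to 0: this is the barrier that fails for
   p <= 2. *)
Lemma energy_barrier (p y0 : R) : 2 < p -> 0 < y0 -> exists S, 7 <= S /\
  forall X X1 xi, 0 < X xi -> y0 <= height p X xi <= exp (- xi) -> S <= exp (- xi) ->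
    energy p X X1 xi <= - e0 p -> x0 p <= X xi.
Proof.
  intros hp Hy0. pose proof (kap_bounds p hp) as Hkb. pose proof (e0_pos p hp) as He.
  destruct (pot_lower p y0 hp Hy0) as [C [HC HCb]].
  exists (7 + 2 * C / e0 p).
  assert (0 < 2 * C / e0 p) by (apply Rdiv_lt_0_compat; lra).
  split; [lra|]. intros X X1 xi HX Hy Hs HE.
  specialize (HCb X xi Hy ltac:(lra)).
  assert (HCs : C / exp (- xi) <= e0 p / 2).
  { apply Rmult_le_reg_r with (exp (- xi)); [lra|].
    replace (C / exp (- xi) * exp (- xi)) with C by (field; lra).
    replace C with (e0 p / 2 * (2 * C / e0 p)) at 1 by (field; lra).
    apply Rmult_le_compat_l; lra. }
  unfold energy in HE. pose proof (pow2_ge_0 (X1 xi)).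
  replace (- C / exp (- xi)) with (- (C / exp (- xi))) in HCb by (field; lra).
  assert (H1 : e0 p / 2 <= kap p / (2 * p) * X xi ^ 2) by lra.
  unfold x0. rewrite <- (sqrt_pow2 (X xi)) by lra. apply sqrt_le_1_alt.
  apply Rmult_le_reg_l with (kap p / (2 * p)).
  - apply Rdiv_lt_0_compat; lra.
  - replace (kap p / (2 * p) * (p / kap p * e0 p)) with (e0 p / 2) by (field; lra). exact H1.
Qed.


Lemma height_le_time (p : R) (X : R -> R) (xi : R) :
  0 < p -> 0 < X xi -> X xi <= 1 <-> height p X xi <= exp (- xi).
Proof.
  intros hp HX. rewrite height_eq. pose proof (exp_pos (- xi)) as Hs. split; intros H.
  - assert (exp (p * ln (X xi)) <= 1).
    { rewrite <- exp_0. apply exp_le.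
      assert (ln (X xi) <= 0) by (rewrite <- ln_1; apply ln_le; lra).
      nra. }
    nra.
  - apply Rnot_lt_le. intros Hl.
    assert (1 < exp (p * ln (X xi))).
    { rewrite <- exp_0. apply exp_increasing.
      assert (0 < ln (X xi)) by (rewrite <- ln_1; apply ln_increasing; lra). nra. }
    nra.
Qed.

(** A continuation argument: the barrier is available only while [v >= tau0], where [f] has its
    explicit form. Where [v] reaches [tau0] the height is exactly tau0^p, whereas the barrier makes
    it at least s x0^p, which is larger once s > y0 / c. So [v] stays above [tau0] as long as s >=
    S0. *)
Lemma persistence (p tau0 : R) (f : R -> R) :
  2 < p -> 0 < tau0 -> nonlinearity p tau0 f -> exists S0 mu0, 7 <= S0 /\ exp (p * ln tau0) <= S0 /\ 1 < mu0 /\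
  forall l v v1 v2, 0 < l -> psol f l v v1 v2 -> mu0 <= v 0 ->
    S0 <= exp (- start p (v 0)) /\
    forall b, start p (v 0) <= b -> S0 <= exp (- b) ->
      rr l b < 1 /\ tau0 <= v (rr l b) /\
      traj p (start p (v 0)) b (Xf l v p) (Xf1 l v v1 p) /\
      forall xi, start p (v 0) <= xi <= b ->
        energy p (Xf l v p) (Xf1 l v v1 p) xi <= - e0 p /\
        exp (p * ln tau0) <= height p (Xf l v p) xi /\
        (Xf l v p xi <= 1 -> x0 p <= Xf l v p xi).
Proof.
  intros hp ht hf. set (y0 := exp (p * ln tau0)). assert (Hy0 : 0 < y0) by apply exp_pos.
  assert (fpos : forall t, 0 <= t -> 0 <= f t) by apply hf.
  destruct (start_energy p tau0 f hp ht hf) as [m1 [Hm1 [Hm1' HSE]]].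
  destruct (energy_barrier p y0 hp Hy0) as [S [HS HSb]].
  pose proof (x0_pos p hp) as Hx0. set (c := exp (p * ln (x0 p))).
  assert (Hc : 0 < c) by apply exp_pos.
  assert (Hyc : 0 < y0 / c) by (apply Rdiv_lt_0_compat; lra).
  exists (S + y0 + y0 / c + 1), (m1 + (S + y0 + y0 / c + 1)).
  split; [lra|]. split; [lra|]. split; [lra|].
  intros l v v1 v2 hl Hs Hmu. destruct (HSE l v v1 v2 hl Hs ltac:(lra)) as [Hr1 [HV1 HE1]].
  set (a := start p (v 0)) in *.
  assert (Hat : S + y0 + y0 / c + 1 <= exp (- a)).
  { unfold a. rewrite start_time. pose proof (exp_p_ln_ge p (v 0) ltac:(lra) ltac:(lra)). lra. }
  split; [exact Hat|]. intros b Hab Hb.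
  (* Everything here is conditional on [v >= tau0] at [b]; [Hgoal] removes the condition by applying
     [core] at the radius where [v] equals [tau0]. *)
  assert (core : forall b, a <= b -> S + y0 + y0 / c + 1 <= exp (- b) -> rr l b < 1 -> tau0 <= v (rr l b) ->
     traj p a b (Xf l v p) (Xf1 l v v1 p) /\
     forall xi, a <= xi <= b ->
        energy p (Xf l v p) (Xf1 l v v1 p) xi <= - e0 p /\
        y0 <= height p (Xf l v p) xi /\ (Xf l v p xi <= 1 -> x0 p <= Xf l v p xi)).
  { clear b Hab Hb. intros b Hab Hb Hrb Hvb.
    pose proof (Xf_traj p tau0 l a b f v v1 v2 hp ht hf hl Hs Hrb Hvb) as HT.
    split; [exact HT|]. intros xi Hxi.
    assert (HE : energy p (Xf l v p) (Xf1 l v v1 p) xi <= - e0 p).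
    { eapply Rle_trans; [|exact HE1]. apply energy_nonincr with a b; try assumption; lra. }
    assert (HV : tau0 <= v (rr l xi)).
    { eapply Rle_trans; [exact Hvb|]. pose proof (rr_increasing l hl xi b ltac:(lra)).
      pose proof (rr_pos l hl xi). apply (psol_nonincr f l v v1 v2); try assumption; lra. }
    assert (Hh : y0 <= height p (Xf l v p) xi).
    { rewrite Xf_height by lra. apply exp_le. apply Rmult_le_compat_l; [lra|].
      apply ln_le; lra. }
    split; [exact HE|]. split; [exact Hh|]. intros HX1.
    destruct (HT xi Hxi) as [HXp _].
    assert (exp (- b) <= exp (- xi)) by (apply exp_le; lra).
    apply HSb with (X1 := Xf1 l v v1 p); try assumption; [|lra].
    split; [exact Hh|]. apply height_le_time; assumption || lra. }
  assert (Hgoal : rr l b < 1 /\ tau0 <= v (rr l b)).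
  { destruct (IVT_on v 0 1 tau0 ltac:(lra) (proj1 (psol_continuous _ _ _ _ _ Hs))) as [rt [Hrt Ert]].
    { right. destruct Hs as [_ [_ [_ E1]]]. rewrite E1. lra. }
    assert (Hrt0 : 0 < rt).
    { destruct (Req_dec rt 0) as [e|e]; [subst; lra|lra]. }
    assert (Hrt1 : rt < 1).
    { destruct (Req_dec rt 1) as [e|e]; [|lra]. destruct Hs as [_ [_ [_ E1]]]. subst rt. lra. }
    destruct (Rle_lt_dec (rr l b) rt) as [L|L].
    - split; [lra|]. rewrite <- Ert. pose proof (rr_pos l hl b). apply (psol_nonincr f l v v1 v2); try assumption; lra.
    - exfalso.
      assert (Hx : exists x, rr l x = rt).
      { assert (Hsl : 0 < sqrt l) by (apply sqrt_lt_R0; exact hl).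
        assert (Hq : 0 < - 2 * ln (sqrt l * rt)).
        { assert (ln (sqrt l * rt) < 0); [|lra]. rewrite <- ln_1. apply ln_increasing; [nra|].
          apply Rlt_trans with (sqrt l * rr l b); [nra|]. unfold rr.
          replace (sqrt l * (exp (- (exp (- b) / 2)) / sqrt l)) with (exp (- (exp (- b) / 2))) by (field; lra).
          rewrite <- exp_0. apply exp_increasing. lra. }
        exists (- ln (- 2 * ln (sqrt l * rt))). unfold rr. rewrite Ropp_involutive, exp_ln by exact Hq.
        replace (- (-2 * ln (sqrt l * rt) / 2)) with (ln (sqrt l * rt)) by field.
        rewrite exp_ln by nra. field. lra. }
      destruct Hx as [x Ex].
      assert (Hxb : x < b).
      { apply Rnot_le_lt. intros Hle. pose proof (rr_increasing l hl b x Hle). lra. }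
      assert (Hax : a <= x).
      { apply Rnot_lt_le. intros Hlt. pose proof (rr_strict l hl x a Hlt).
        assert (v (rr l a) <= v rt) by (apply (psol_nonincr f l v v1 v2); try assumption; lra). lra. }
      assert (Hxs : exp (- b) <= exp (- x)) by (apply exp_le; lra).
      destruct (core x Hax ltac:(lra) ltac:(lra) ltac:(rewrite Ex; lra)) as [HT HX].
      destruct (HX x ltac:(lra)) as [_ [Hh Hx0x]]. destruct (HT x ltac:(lra)) as [HXp _].
      assert (Eh : height p (Xf l v p) x = y0) by (rewrite Xf_height by (try rewrite Ex, Ert; lra); rewrite Ex, Ert; reflexivity).
      assert (HX1 : Xf l v p x <= 1) by (apply height_le_time with p; [lra|exact HXp|lra]).
      specialize (Hx0x HX1). rewrite height_eq in Eh.
      assert (c <= exp (p * ln (Xf l v p x))).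
      { apply exp_le. apply Rmult_le_compat_l; [lra|].
        apply ln_le; lra. }
      assert (Hfin : y0 / c * c < exp (- x) * exp (p * ln (Xf l v p x))).
      { apply Rlt_le_trans with (exp (- x) * c); [apply Rmult_lt_compat_r; lra|].
        apply Rmult_le_compat_l; lra. }
      replace (y0 / c * c) with y0 in Hfin by (field; lra). lra. }
  destruct Hgoal as [G1 G2]. split; [exact G1|]. split; [exact G2|]. apply core; assumption.
Qed.

(** By the intermediate value theorem an interval without crossing lies on one side of X = 1, where
    one of the two return lemmas bounds its length. The conclusions of [persistence] are carried
    along so that later arguments share one set of constants. *)
Lemma frequent_crossings (p tau0 : R) (f : R -> R) :
  2 < p -> 0 < tau0 -> nonlinearity p tau0 f -> exists S1 T mu0, exp (p * ln tau0) <= S1 /\ 7 <= S1 /\ 0 < T /\ 1 < mu0 /\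
  forall l v v1 v2, 0 < l -> psol f l v v1 v2 -> mu0 <= v 0 ->
    S1 <= exp (- start p (v 0)) /\
    (forall b, start p (v 0) <= b -> S1 <= exp (- b) ->
      rr l b < 1 /\ tau0 <= v (rr l b) /\
      traj p (start p (v 0)) b (Xf l v p) (Xf1 l v v1 p) /\
      forall xi, start p (v 0) <= xi <= b ->
        energy p (Xf l v p) (Xf1 l v v1 p) xi <= - e0 p /\
        exp (p * ln tau0) <= height p (Xf l v p) xi /\
        (Xf l v p xi <= 1 -> x0 p <= Xf l v p xi)) /\
    forall c, start p (v 0) <= c -> S1 <= exp (- (c + T)) ->
      exists xi, c <= xi <= c + T /\ Xf l v p xi = 1.
Proof.
  intros hp ht hf. pose proof (kap_bounds p hp) as Hkb.
  destruct (persistence p tau0 f hp ht hf) as [S0 [mu0 [HS0 [HS0' [Hmu0 HP]]]]].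
  destruct (no_long_below p (x0 p) hp (x0_pos p hp)) as [Sb [Tb [HSb [HTb HB]]]].
  set (Sa := 2 + ((1 - 2 / p) ^ 2 / 4 + 16) / (kap p / p)).
  assert (Hkp : 0 < kap p / p) by (apply Rdiv_lt_0_compat; lra).
  assert (HSa : 2 < Sa).
  { unfold Sa. pose proof (pow2_ge_0 (1 - 2 / p)).
    assert (0 < ((1 - 2 / p) ^ 2 / 4 + 16) / (kap p / p)) by (apply Rdiv_lt_0_compat; lra). lra. }
  exists (S0 + Sb + Sa), (Tb + 1), (mu0 + (S0 + Sb + Sa)).
  split; [lra|]. split; [lra|]. split; [lra|]. split; [lra|].
  intros l v v1 v2 hl Hs Hmu.
  destruct (HP l v v1 v2 hl Hs ltac:(lra)) as [_ HPb].
  split.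
  { rewrite start_time. pose proof (exp_p_ln_ge p (v 0) ltac:(lra) ltac:(lra)). lra. }
  split; [intros b Hb HbS; apply HPb; lra|].
  intros c Hc HS.
  destruct (HPb (c + (Tb + 1)) ltac:(lra) ltac:(lra)) as [_ [_ [HT HX]]].
  set (X := Xf l v p) in *. set (X1 := Xf1 l v v1 p) in *. set (a := start p (v 0)) in *.
  apply NNPP. intros Hn.
  assert (Hne : forall t, c <= t <= c + (Tb + 1) -> X t <> 1).
  { intros t Ht E. apply Hn. exists t. split; assumption. }
  assert (Hcont : forall t t', c <= t -> t' <= c + (Tb + 1) -> continuous_on_set (Icc t t') X).
  { intros t t' H1 H2. apply continuous_on_of_derive with X1. intros x [Hx Hx']. apply HT. lra. }
  destruct (Rle_lt_dec (X c) 1) as [L|L].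
  - assert (Hlt : forall t, c <= t <= c + (Tb + 1) -> X t < 1).
    { intros t Ht. apply Rnot_le_lt. intros Hge.
      destruct (IVT_on X c t 1 ltac:(lra) (Hcont c t ltac:(lra) ltac:(lra)) ltac:(left; lra)) as [z [Hz Ez]].
      apply (Hne z); [lra|exact Ez]. }
    apply (HB X X1 c).
    + eapply traj_sub; [| |exact HT]; lra.
    + assert (exp (- (c + (Tb + 1))) <= exp (- (c + Tb))) by (apply exp_le; lra). lra.
    + intros t Ht. specialize (Hlt t ltac:(lra)). split; [|exact Hlt]. apply HX; lra.
  - apply (no_long_above p c X X1 hp).
    + eapply traj_sub; [| |exact HT]; lra.
    + assert (exp (- (c + (Tb + 1))) <= exp (- (c + 1))) by (apply exp_le; lra).
      apply Rle_trans with (kap p / p * (Sa - 2)); [|apply Rmult_le_compat_l; lra].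
      right. unfold Sa. field. lra.
    + intros t Ht. apply Rnot_le_lt. intros Hle.
      destruct (IVT_on X c t 1 ltac:(lra) (Hcont c t ltac:(lra) ltac:(lra)) ltac:(right; lra)) as [z [Hz Ez]].
      apply (Hne z); [lra|exact Ez].
Qed.

(** * Pruefer angle *)

Lemma gronwall_forward (g g1 : R -> R) (a b K : R) :
  a <= b -> continuous_on_set (Icc a b) g ->
  (forall x, a < x < b -> is_derive g x (g1 x) /\ g1 x <= K * g x) ->
  g b <= g a * exp (K * (b - a)).
Proof.
  intros Hab Hc Hd.
  assert (H : g b * exp (- K * b) <= g a * exp (- K * a)).
  { apply (nonincr_on (fun x => g x * exp (- K * x)) (fun x => (g1 x - K * g x) * exp (- K * x))); [exact Hab| |].
    - intros x Dx. eapply filterlim_comp_2; [exact (Hc x Dx)| |exact (@filterlim_mult R_AbsRing _ _)].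
      assert (C : continuous (fun x => exp (- K * x)) x).
      { apply (@ex_derive_continuous R_AbsRing R_NormedModule). auto_derive. exact I. }
      intros P HP. specialize (C P HP). revert C. unfold filtermap, within. apply filter_imp. tauto.
    - intros x Hx. destruct (Hd x Hx) as [D Hg]. split.
      + derive_known. ring.
      + pose proof (exp_pos (- K * x)). nra. }
  replace (K * (b - a)) with (- K * a + K * b) by ring. rewrite exp_plus.
  apply Rmult_le_reg_r with (exp (- K * b)); [apply exp_pos|].
  replace (g a * (exp (- K * a) * exp (K * b)) * exp (- K * b))
    with (g a * exp (- K * a) * (exp (K * b) * exp (- K * b))) by ring.
  rewrite <- exp_plus. replace (K * b + - K * b) with 0 by ring. rewrite exp_0. lra.
Qed.

Lemma derive_pos_local (h : R -> R) (t l : R) :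
  is_derive h t l -> 0 < l -> exists d, 0 < d /\
    forall y, (t < y < t + d -> h t < h y) /\ (t - d < y < t -> h y < h t).
Proof.
  intros [_ H] Hl.
  assert (Hlim : is_filter_lim (locally t) t) by (intros P HP; exact HP).
  destruct (H t Hlim (mkposreal (l / 2) ltac:(lra))) as [d Hd].
  exists d. split; [apply cond_pos|]. intros y.
  assert (Hb : Rabs (y - t) < d -> Rabs (h y - h t - (y - t) * l) <= l / 2 * Rabs (y - t)).
  { intros Hy. exact (Hd y Hy). }
  split; intros Hy.
  - rewrite (Rabs_right (y - t)) in Hb by lra. specialize (Hb ltac:(lra)).
    apply Rabs_le_between in Hb. assert (0 < (y - t) * l) by nra. lra.
  - rewrite (Rabs_left (y - t)) in Hb by lra. specialize (Hb ltac:(lra)).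
    apply Rabs_le_between in Hb. assert (0 < (t - y) * l) by nra. lra.
Qed.

(** At the last point of [[a, x]] where [h >= L] there is equality, and the positive slope there
    pushes [h] above the level again. A second use of the slope, to the left, gives strictness. *)
Lemma stays_above (h h1 : R -> R) (a b L : R) :
  (forall x, a <= x <= b -> is_derive h x (h1 x)) ->
  (forall x, a <= x <= b -> h x = L -> 0 < h1 x) ->
  L <= h a -> forall x, a < x <= b -> L < h x.
Proof.
  intros Hd Hp Ha.
  assert (Hge : forall x, a <= x <= b -> L <= h x).
  { intros x Hx. apply Rnot_lt_le. intros Hlt.
    destruct (completeness (fun t => a <= t <= x /\ L <= h t)) as [m [Hub Hlub]].
    { exists x. intros t [Ht _]. lra. }
    { exists a. lra. }
    assert (Ham : a <= m) by (apply Hub; lra).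
    assert (Hmx : m <= x) by (apply Hlub; intros t [Ht _]; lra).
    assert (Hc : continuous_on_set (Icc a b) h) by (apply continuous_on_of_derive with h1; exact Hd).
    assert (Hafter : forall t, m < t <= x -> h t < L).
    { intros t Ht. apply Rnot_le_lt. intros Hge. assert (t <= m) by (apply Hub; lra). lra. }
    assert (Em : h m = L).
    { destruct (Rtotal_order (h m) L) as [Hl|[E|Hg]]; [|exact E|].
      - destruct (proj1 (continuous_on_set_eps _ _) Hc m ltac:(unfold Icc; lra) (L - h m) ltac:(lra)) as [d [Hd0 Hdd]].
        exfalso. assert (is_upper_bound (fun t => a <= t <= x /\ L <= h t) (m - d / 2)).
        { intros t [Ht HLt]. apply Rnot_lt_le. intros Hgt. assert (t <= m) by (apply Hub; lra).
          specialize (Hdd t ltac:(unfold Icc; lra)).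
          assert (Rabs (t - m) < d) by (apply Rabs_def1; lra). specialize (Hdd H0).
          apply Rabs_def2 in Hdd. lra. }
        specialize (Hlub _ H). lra.
      - exfalso. assert (m < x) by (destruct (Req_dec m x) as [e|e]; [subst; lra|lra]).
        destruct (proj1 (continuous_on_set_eps _ _) Hc m ltac:(unfold Icc; lra) (h m - L) ltac:(lra)) as [d [Hd0 Hdd]].
        set (t := Rmin (m + d / 2) x).
        assert (Ht : m < t <= x /\ t - m < d).
        { unfold t. pose proof (Rmin_l (m + d / 2) x). pose proof (Rmin_r (m + d / 2) x).
          assert (m < Rmin (m + d / 2) x) by (apply Rmin_glb_lt; lra). lra. }
        specialize (Hdd t ltac:(unfold Icc; lra)).
        assert (Rabs (t - m) < d) by (apply Rabs_def1; lra). specialize (Hdd H0).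
        apply Rabs_def2 in Hdd. specialize (Hafter t ltac:(lra)). lra. }
    assert (m < x) by (destruct (Req_dec m x) as [e|e]; [subst; lra|lra]).
    destruct (derive_pos_local h m (h1 m) (Hd m ltac:(lra)) (Hp m ltac:(lra) Em)) as [d [Hd0 Hdd]].
    set (t := Rmin (m + d / 2) x).
    assert (Ht : m < t <= x /\ t - m < d).
    { unfold t. pose proof (Rmin_l (m + d / 2) x). pose proof (Rmin_r (m + d / 2) x).
      assert (m < Rmin (m + d / 2) x) by (apply Rmin_glb_lt; lra). lra. }
    destruct (Hdd t) as [H1 _]. specialize (H1 ltac:(lra)). specialize (Hafter t ltac:(lra)). lra. }
  intros x Hx. destruct (Hge x ltac:(lra)) as [Hl|E]; [exact Hl|exfalso].
  destruct (derive_pos_local h x (h1 x) (Hd x ltac:(lra)) (Hp x ltac:(lra) (eq_sym E))) as [d [Hd0 Hdd]].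
  set (t := Rmax (x - d / 2) a).
  assert (Ht : a <= t < x /\ x - d < t).
  { unfold t. pose proof (Rmax_l (x - d / 2) a). pose proof (Rmax_r (x - d / 2) a).
    assert (Rmax (x - d / 2) a < x) by (apply Rmax_lub_lt; lra). lra. }
  destruct (Hdd t) as [_ H1]. specialize (H1 ltac:(lra)). specialize (Hge t ltac:(lra)). lra.
Qed.

(** The zeros of cos, numbered so that [level 0] lies below every value of arctan, hence below the
    initial angle. *)
Definition level (j : nat) : R := - (PI / 2) + INR j * PI.

Lemma cos_level (j : nat) : cos (level j) = 0.
Proof.
  unfold level. induction j as [|j IH].
  - rewrite Rmult_0_l, Rplus_0_r, cos_neg. apply cos_PI2.
  - rewrite S_INR. replace (- (PI / 2) + (INR j + 1) * PI) with (- (PI / 2) + INR j * PI + PI) by ring.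
    rewrite neg_cos, IH. ring.
Qed.

Lemma level_next (j : nat) (x : R) : level j < x -> cos x = 0 -> level (S j) <= x.
Proof.
  intros Hx Hc. destruct (cos_eq_0_0 x Hc) as [k E]. unfold level in *. rewrite S_INR.
  pose proof PI_RGT_0 as HP.
  assert (Hk : IZR (Z.of_nat j - 1) < IZR k).
  { rewrite minus_IZR, <- INR_IZR_INZ. apply Rmult_lt_reg_r with PI; [exact HP|]. lra. }
  apply lt_IZR in Hk. assert (Hk2 : (Z.of_nat j <= k)%Z) by lia.
  apply IZR_le in Hk2. rewrite <- INR_IZR_INZ in Hk2. nra.
Qed.

Lemma is_derive_sq (g : R -> R) (x d : R) :
  is_derive g x d -> is_derive (fun x => g x ^ 2) x (2 * (d * g x)).
Proof.
  intros D. derive_known. ring.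
Qed.

(** The component of (W, W1) orthogonal to the direction prescribed by the angle solves a linear
    homogeneous equation, so it vanishes identically once it vanishes initially. *)
Lemma rotated_component_derive (w w1 th : R -> R) (y q w2 : R) :
  w y * w y + w1 y * w1 y <> 0 ->
  is_derive w y (q * w1 y) -> is_derive w1 y (q * w2) ->
  is_derive th y (q * (w1 y * w1 y - w y * w2) * / (w y * w y + w1 y * w1 y)) ->
  is_derive (fun x => w x * sin (th x) + w1 x * cos (th x)) y
    (q * (w y + w2) * w1 y * / (w y * w y + w1 y * w1 y) * (w y * sin (th y) + w1 y * cos (th y))).
Proof.
  intros Hn D0 D1 Da. derive_known.
    field. exact Hn.
Qed.

(* W = - P cos angle and W1 = P sin angle: the angle increases through each zero of W. *)
Section Prufer.

Variables (W W1 W2 : R -> R -> R) (q : R -> R) (m0 : R).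
Hypothesis q_pos : forall mu, m0 < mu -> 0 < q mu.
Hypothesis q_cont : forall mu x, m0 < mu -> continuity_2d_pt (fun mu _ => q mu) mu x.
Hypothesis W_cont : forall mu x, m0 < mu -> continuity_2d_pt W mu x.
Hypothesis W1_cont : forall mu x, m0 < mu -> continuity_2d_pt W1 mu x.
Hypothesis W2_cont : forall mu x, m0 < mu -> continuity_2d_pt W2 mu x.
Hypothesis W_derive : forall mu x, m0 < mu -> 0 < x < 1 ->
  is_derive (W mu) x (q mu * W1 mu x) /\ is_derive (W1 mu) x (q mu * W2 mu x).
Hypothesis W_nonzero : forall mu x, m0 < mu -> 0 < W mu x ^ 2 + W1 mu x ^ 2.
Hypothesis W_start : forall mu, m0 < mu -> W mu 0 < 0.

(** The angle is defined by integrating its expected derivative rather than by continuing a branch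
    of arctan: continuity in [mu] then comes from joint continuity of the integrand, and the polar
    representation is proved afterwards. *)
Let K (mu x : R) : R :=
  q mu * (W1 mu x * W1 mu x - W mu x * W2 mu x) * / (W mu x * W mu x + W1 mu x * W1 mu x).

Let theta0 (mu : R) : R := atan (- W1 mu 0 * / W mu 0).

Let angle (mu x : R) : R := theta0 mu + RInt (K mu) 0 x.

Lemma continuity_2d_pt_section (g : R -> R -> R) (mu x : R) :
  continuity_2d_pt g mu x -> continuous (g mu) x.
Proof.
  intros H. apply filterlim_locally. intros eps. destruct (H eps) as [d Hd].
  exists d. intros y Hy. apply Hd; [|exact Hy]. rewrite Rminus_eq_0, Rabs_R0. apply cond_pos.
Qed.

Lemma continuity_2d_pt_section1 (g : R -> R -> R) (mu x : R) :
  continuity_2d_pt g mu x -> continuous (fun mu => g mu x) mu.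
Proof.
  intros H. apply filterlim_locally. intros eps. destruct (H eps) as [d Hd].
  exists d. intros y Hy. apply Hd; [exact Hy|]. rewrite Rminus_eq_0, Rabs_R0. apply cond_pos.
Qed.

Let K_cont (mu x : R) : m0 < mu -> continuity_2d_pt K mu x.
Proof.
  intros Hm.
  assert (Hn : W mu x * W mu x + W1 mu x * W1 mu x <> 0).
  { pose proof (W_nonzero mu x Hm). lra. }
  repeat first [apply continuity_2d_pt_mult | apply continuity_2d_pt_minus | apply continuity_2d_pt_plus
    | apply continuity_2d_pt_inv]; auto.
Qed.

Let K_continuous (mu x : R) : m0 < mu -> continuous (K mu) x.
Proof. intros Hm. apply (continuity_2d_pt_section K). apply K_cont. exact Hm. Qed.

Let angle_derive (mu x : R) : m0 < mu -> is_derive (angle mu) x (K mu x).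
Proof.
  intros Hm.
  assert (D : is_derive (RInt (K mu) 0) x (K mu x)).
  { apply is_derive_RInt with (a := 0); [|apply K_continuous; exact Hm].
    apply filter_forall. intros y. apply (RInt_correct (K mu)). apply ex_RInt_continuous.
    intros t _. apply K_continuous. exact Hm. }
  pose proof (is_derive_plus _ _ _ _ _ (is_derive_const (theta0 mu) x) D) as E.
  rewrite plus_zero_l in E. exact E.
Qed.

(** Gronwall on [N ^ 2] kills the orthogonal component [N]. The radial component [P] is positive at
    0 and cannot vanish, since [P ^ 2 + N ^ 2] is the positive quantity of [W_nonzero]. *)
Let angle_spec (mu x : R) : m0 < mu -> 0 <= x <= 1 ->
  exists P, 0 < P /\ W mu x = - (P * cos (angle mu x)) /\ W1 mu x = P * sin (angle mu x).
Proof.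
  intros Hm.
  pose (N := fun x => W mu x * sin (angle mu x) + W1 mu x * cos (angle mu x)).
  pose (P := fun x => - W mu x * cos (angle mu x) + W1 mu x * sin (angle mu x)).
  pose (c := fun x => q mu * (W mu x + W2 mu x) * W1 mu x * / (W mu x * W mu x + W1 mu x * W1 mu x)).
  assert (Hrho : forall x, P x ^ 2 + N x ^ 2 = W mu x ^ 2 + W1 mu x ^ 2).
  { intros y. unfold P, N. pose proof (sin2_cos2 (angle mu y)) as E. unfold Rsqr in E.
    transitivity ((W mu y ^ 2 + W1 mu y ^ 2) * (sin (angle mu y) * sin (angle mu y) + cos (angle mu y) * cos (angle mu y))).
    - ring.
    - rewrite E. ring. }
  assert (cW : forall y, continuous (W mu) y) by (intros y; apply continuity_2d_pt_section; auto).
  assert (cW1 : forall y, continuous (W1 mu) y) by (intros y; apply continuity_2d_pt_section; auto).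
  assert (ca : forall y, continuous (angle mu) y).
  { intros y. apply (@ex_derive_continuous R_AbsRing R_NormedModule). exists (K mu y). apply angle_derive. exact Hm. }
  assert (cs : forall y, continuous (fun y => sin (angle mu y)) y).
  { intros y. apply (continuous_comp (angle mu) sin); [apply ca|]. apply continuous_sin. }
  assert (cc : forall y, continuous (fun y => cos (angle mu y)) y).
  { intros y. apply (continuous_comp (angle mu) cos); [apply ca|]. apply continuous_cos. }
  assert (cN : forall y, continuous N y).
  { intros y. apply (continuous_plus (fun y => W mu y * sin (angle mu y)) (fun y => W1 mu y * cos (angle mu y))).
    - apply (continuous_mult (W mu) (fun y => sin (angle mu y))); auto.
    - apply (continuous_mult (W1 mu) (fun y => cos (angle mu y))); auto. }
  assert (cP : forall y, continuous P y).
  { intros y. apply (continuous_plus (fun y => - W mu y * cos (angle mu y)) (fun y => W1 mu y * sin (angle mu y))).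
    - apply (continuous_mult (fun y => - W mu y) (fun y => cos (angle mu y))); auto.
      apply (continuous_opp (W mu)); auto.
    - apply (continuous_mult (W1 mu) (fun y => sin (angle mu y))); auto. }
  assert (DN : forall y, 0 < y < 1 -> is_derive N y (c y * N y)).
  { intros y Hy. destruct (W_derive mu y Hm Hy) as [D0 D1]. pose proof (angle_derive mu y Hm) as Da.
    pose proof (W_nonzero mu y Hm) as Hnz.
    exact (rotated_component_derive (W mu) (W1 mu) (angle mu) y (q mu) (W2 mu y) ltac:(lra) D0 D1 Da). }
  assert (cc2 : forall y, continuous c y).
  { intros y. apply (continuity_2d_pt_section
      (fun mu x => q mu * (W mu x + W2 mu x) * W1 mu x * / (W mu x * W mu x + W1 mu x * W1 mu x))).
    assert (Hn : W mu y * W mu y + W1 mu y * W1 mu y <> 0).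
    { pose proof (W_nonzero mu y Hm). simpl in H. lra. }
    repeat first [apply continuity_2d_pt_mult | apply continuity_2d_pt_plus | apply continuity_2d_pt_inv]; auto. }
  destruct (continuous_on_bounded c 0 1 ltac:(lra)
     (continuous_on_of_continuous _ _ (fun y _ => cc2 y))) as [C [HC0 HC]].
  assert (Hcos0 : 0 < cos (theta0 mu)).
  { unfold theta0. destruct (atan_bound (- W1 mu 0 * / W mu 0)). apply cos_gt_0; lra. }
  assert (A0 : angle mu 0 = theta0 mu).
  { unfold angle. rewrite RInt_point. unfold zero; simpl. ring. }
  pose proof (W_start mu Hm) as HW0.
  assert (Et : W mu 0 * sin (theta0 mu) = - W1 mu 0 * cos (theta0 mu)).
  { assert (Etan : tan (theta0 mu) = - W1 mu 0 * / W mu 0) by apply tan_atan.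
    unfold tan in Etan. apply Rmult_eq_reg_r with (/ cos (theta0 mu) * / W mu 0).
    - replace (W mu 0 * sin (theta0 mu) * (/ cos (theta0 mu) * / W mu 0)) with (sin (theta0 mu) / cos (theta0 mu))
        by (field; lra). rewrite Etan. field. lra.
    - apply Rmult_integral_contrapositive_currified; apply Rinv_neq_0_compat; lra. }
  assert (N0 : N 0 = 0) by (unfold N; rewrite A0, Et; ring).
  assert (HN : forall y, 0 <= y <= 1 -> N y = 0).
  { intros y Hy.
    assert (HG : N y ^ 2 <= N 0 ^ 2 * exp (2 * C * (y - 0))).
    { apply (gronwall_forward (fun y => N y ^ 2) (fun y => 2 * (c y * N y ^ 2))); [lra| |].
      - apply continuous_on_of_continuous. intros z _.
        apply continuous_ext with (fun z => N z * N z); [intros; simpl; ring|].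
        apply (continuous_mult N N); auto.
      - intros z Hz. split.
        + replace (c z * N z ^ 2) with (c z * N z * N z) by ring.
          apply is_derive_sq. apply DN. lra.
        + specialize (HC z ltac:(lra)). pose proof (Rle_abs (c z)). pose proof (pow2_ge_0 (N z)). nra. }
    rewrite N0 in HG. replace (0 ^ 2 * exp (2 * C * (y - 0))) with 0 in HG by ring.
    pose proof (pow2_ge_0 (N y)). assert (E : N y ^ 2 = 0) by lra.
    apply Rsqr_0_uniq. unfold Rsqr. simpl in E. lra. }
  assert (P0 : 0 < P 0).
  { unfold P. rewrite A0.
    assert (E : P 0 * cos (theta0 mu) = - W mu 0).
    { unfold P. rewrite A0. pose proof (sin2_cos2 (theta0 mu)) as E. unfold Rsqr in E.
      transitivity (- W mu 0 * (cos (theta0 mu) * cos (theta0 mu)) + - (- W1 mu 0 * cos (theta0 mu)) * sin (theta0 mu)); [ring|].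
      rewrite <- Et. transitivity (- W mu 0 * (sin (theta0 mu) * sin (theta0 mu) + cos (theta0 mu) * cos (theta0 mu))); [ring|].
      rewrite E. ring. }
    unfold P in E. rewrite A0 in E. nra. }
  intros Hx.
  assert (PX : 0 < P x).
  { apply Rnot_le_lt. intros Hle.
    destruct (IVT_on P 0 x 0 ltac:(lra)) as [z [Hz Ez]].
    - apply continuous_on_of_continuous. auto.
    - right. lra.
    - pose proof (Hrho z) as E. rewrite Ez, (HN z ltac:(lra)) in E.
      pose proof (W_nonzero mu z Hm). replace (0 ^ 2 + 0 ^ 2) with 0 in E by ring. lra. }
  exists (P x). split; [exact PX|]. pose proof (HN x Hx) as E. unfold N in E.
  pose proof (sin2_cos2 (angle mu x)) as E2. unfold Rsqr in E2.
  set (sn := sin (angle mu x)) in *. set (cn := cos (angle mu x)) in *. unfold P. fold sn cn. split.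
  - transitivity (W mu x * (sn * sn + cn * cn) - sn * (W mu x * sn + W1 mu x * cn) ); [rewrite E2, E; ring|].
    rewrite E2, E. replace (W mu x * 1 - sn * 0) with (W mu x * (sn * sn + cn * cn) - sn * (W mu x * sn + W1 mu x * cn))
      by (rewrite E2, E; ring). ring.
  - transitivity (W1 mu x * (sn * sn + cn * cn) - cn * (W mu x * sn + W1 mu x * cn)); [rewrite E2, E; ring|]. ring.
Qed.

Let angle_end_cont (mu : R) : m0 < mu -> continuous (fun mu => angle mu 1) mu.
Proof.
  intros Hm. unfold angle.
  apply (continuous_plus theta0 (fun mu => RInt (K mu) 0 1)).
  - unfold theta0. apply (continuous_comp (fun mu => - W1 mu 0 * / W mu 0) atan).
    + apply (continuous_mult (fun mu => - W1 mu 0) (fun mu => / W mu 0)).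
      * apply (continuous_opp (fun mu => W1 mu 0)). apply (continuity_2d_pt_section1 W1). auto.
      * pose proof (W_start mu Hm).
        apply (continuous_comp (fun mu => W mu 0) Rinv); [apply (continuity_2d_pt_section1 W); auto|].
        apply (@ex_derive_continuous R_AbsRing R_NormedModule). auto_derive. lra.
    + apply (@ex_derive_continuous R_AbsRing R_NormedModule). auto_derive. exact I.
  - apply filterlim_locally. intros eps.
    assert (He : 0 < eps / 2) by (pose proof (cond_pos eps); lra).
    destruct (uniform_continuity_2d_1d' K 0 1 mu) with (eps := mkposreal _ He) as [d Hd].
    { intros x _. apply K_cont. exact Hm. }
    assert (Hd2 : 0 < Rmin d (mu - m0)) by (apply Rmin_pos; [apply cond_pos|lra]).
    exists (mkposreal _ Hd2). intros nu Hnu. change (Rabs (nu - mu) < Rmin d (mu - m0)) in Hnu.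
    pose proof (Rmin_l d (mu - m0)). pose proof (Rmin_r d (mu - m0)).
    apply Rabs_def2 in Hnu. assert (Hnum : m0 < nu) by lra.
    assert (EI : forall mu, m0 < mu -> ex_RInt (K mu) 0 1).
    { intros m Hmm. apply (@ex_RInt_continuous R_CompleteNormedModule). intros t _. apply K_continuous. exact Hmm. }
    change (Rabs (RInt (K nu) 0 1 - RInt (K mu) 0 1) < eps).
    assert (Em : RInt (K nu) 0 1 - RInt (K mu) 0 1 = RInt (fun x => K nu x - K mu x) 0 1).
    { symmetry. apply (RInt_minus (K nu) (K mu)); apply EI; assumption. }
    rewrite Em. apply Rle_lt_trans with ((1 - 0) * (eps / 2)).
    + apply abs_RInt_le_const; [lra| |].
      * apply (ex_RInt_minus (K nu) (K mu)); apply EI; assumption.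
      * intros t Ht. left. apply (Hd t mu t nu); try lra. rewrite Rminus_eq_0, Rabs_R0. apply cond_pos.
    + lra.
Qed.

(** At a zero of [W] the derivative of the angle is [q mu > 0], so a level once reached is never
    left downwards, and each new zero lifts the angle to the next level. *)
Let angle_count (mu : R) (M : nat) (zs : nat -> R) : m0 < mu ->
  (forall i, (i < M)%nat -> 0 < zs i < 1 /\ W mu (zs i) = 0) ->
  (forall i, (S i < M)%nat -> zs i < zs (S i)) -> level M <= angle mu 1.
Proof.
  intros Hm Hz Hinc.
  assert (above : forall j a b, 0 <= a -> b <= 1 -> level j <= angle mu a -> forall x, a < x <= b -> level j < angle mu x).
  { intros j a b Ha Hb Hl. apply (stays_above (angle mu) (K mu) a b (level j)); [| |exact Hl].
    - intros x _. apply angle_derive. exact Hm.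
    - intros x Hx E. destruct (angle_spec mu x Hm ltac:(lra)) as [P [HP [EW _]]].
      rewrite E, cos_level in EW. unfold K. pose proof (W_nonzero mu x Hm) as Hnz.
      rewrite EW in Hnz |- *.
      apply Rmult_lt_0_compat.
      + apply Rmult_lt_0_compat; [apply q_pos; exact Hm|]. nra.
      + apply Rinv_0_lt_compat. nra. }
  assert (zero_cos : forall x, 0 <= x <= 1 -> W mu x = 0 -> cos (angle mu x) = 0).
  { intros x Hx E. destruct (angle_spec mu x Hm Hx) as [P [HP [EW _]]]. rewrite E in EW.
    assert (E2 : P * cos (angle mu x) = 0) by lra. apply Rmult_integral in E2. lra. }
  assert (A0 : level 0 <= angle mu 0).
  { unfold angle. rewrite RInt_point. unfold zero; simpl. unfold level, theta0. simpl.
    destruct (atan_bound (- W1 mu 0 * / W mu 0)). lra. }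
  assert (Hi : forall i, (i < M)%nat -> level (S i) <= angle mu (zs i)).
  { induction i as [|i IH]; intros Hi.
    - destruct (Hz 0%nat Hi) as [H1 H2]. apply level_next; [|apply zero_cos; lra].
      apply (above 0%nat 0 1); lra || exact A0.
    - destruct (Hz (S i) Hi) as [H1 H2]. destruct (Hz i ltac:(lia)) as [H3 H4].
      pose proof (Hinc i Hi). apply level_next; [|apply zero_cos; lra].
      apply (above (S i) (zs i) 1); try lra. apply IH. lia. }
  destruct M as [|M].
  - left. apply (above 0%nat 0 1); lra || exact A0.
  - destruct (Hz M ltac:(lia)) as [H1 _]. left. apply (above (S M) (zs M) 1); try lra. apply Hi. lia.
Qed.

Lemma oscillation_of_zeros :
  (forall M : nat, exists muM, forall mu, muM <= mu -> m0 < mu -> exists zs : nat -> R,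
     (forall i, (i < M)%nat -> 0 < zs i < 1 /\ W mu (zs i) = 0) /\
     (forall i, (S i < M)%nat -> zs i < zs (S i))) ->
  forall N : R, (exists mu, N < mu /\ m0 < mu /\ 0 < W mu 1) /\ (exists mu, N < mu /\ m0 < mu /\ W mu 1 < 0).
Proof.
  intros H N. set (ma := Rmax N m0 + 1).
  assert (Hma : N < ma /\ m0 < ma).
  { unfold ma. pose proof (Rmax_l N m0). pose proof (Rmax_r N m0). lra. }
  pose proof PI_RGT_0 as HP.
  destruct (nfloor_ex (Rabs (angle ma 1) / (2 * PI))) as [j [_ Hj]].
  { apply Rdiv_le_0_compat; [apply Rabs_pos|lra]. }
  assert (Hja : angle ma 1 <= 2 * INR (S j) * PI).
  { rewrite S_INR. apply Rmult_lt_compat_r with (r := 2 * PI) in Hj; [|lra].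
    replace (Rabs (angle ma 1) / (2 * PI) * (2 * PI)) with (Rabs (angle ma 1)) in Hj by (field; lra).
    pose proof (Rle_abs (angle ma 1)). lra. }
  (* This many zeros bring the angle to at least 2 (j + 1) PI + 3 PI / 2, past both 2 (j + 1) PI and
     2 (j + 1) PI + PI, where [W] has opposite signs; at [ma] the angle is below both. *)
  destruct (H (2 * S j + 2)%nat) as [muM HM].
  set (mb := Rmax muM (ma + 1)).
  assert (Hmb : muM <= mb /\ ma + 1 <= mb) by (unfold mb; split; [apply Rmax_l|apply Rmax_r]).
  destruct (HM mb ltac:(lra) ltac:(lra)) as [zs [Hz Hinc]].
  pose proof (angle_count mb _ zs ltac:(lra) Hz Hinc) as Hb.
  assert (Hb2 : 2 * INR (S j) * PI + PI <= angle mb 1).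
  { eapply Rle_trans; [|exact Hb]. unfold level. rewrite plus_INR, mult_INR.
    replace (INR 2) with 2 by (simpl; ring). lra. }
  assert (attain : forall y, 2 * INR (S j) * PI <= y <= 2 * INR (S j) * PI + PI -> exists mu, ma <= mu <= mb /\ angle mu 1 = y).
  { intros y Hy. apply (IVT_on (fun mu => angle mu 1) ma mb y); [lra| |left; lra].
    apply continuous_on_of_continuous. intros mu [Hmu _]. apply angle_end_cont. lra. }
  assert (Hcos : forall k, cos (2 * INR k * PI) = 1).
  { intros k. pose proof (cos_period 0 k) as E. rewrite Rplus_0_l, cos_0 in E. exact E. }
  split.
  - destruct (attain (2 * INR (S j) * PI + PI) ltac:(lra)) as [mu [Hmu E]].
    exists mu. split; [lra|]. split; [lra|].
    destruct (angle_spec mu 1 ltac:(lra) ltac:(lra)) as [P [HPp [EW _]]].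
    rewrite EW, E, neg_cos, Hcos. lra.
  - destruct (attain (2 * INR (S j) * PI) ltac:(lra)) as [mu [Hmu E]].
    exists mu. split; [lra|]. split; [lra|].
    destruct (angle_spec mu 1 ltac:(lra) ltac:(lra)) as [P [HPp [EW _]]].
    rewrite EW, E, Hcos. lra.
Qed.

End Prufer.

(** * Stability of the ODE and continuity of the curve *)

Lemma is_derive_on_plus (D : R -> Prop) (v v1 w w1 : R -> R) :
  is_derive_on D v v1 -> is_derive_on D w w1 ->
  is_derive_on D (fun x => v x + w x) (fun x => v1 x + w1 x).
Proof.
  intros Hv Hw x Dx.
  apply filterdiff_ext_lin with (fun h => plus (scal h (v1 x)) (scal h (w1 x))).
  - exact (filterdiff_plus_fct _ _ _ _ (Hv x Dx) (Hw x Dx)).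
  - intros h. symmetry. apply (@scal_distr_l R_AbsRing R_NormedModule).
Qed.

Lemma is_derive_on_scal (D : R -> Prop) (v v1 : R -> R) (c : R) :
  is_derive_on D v v1 -> is_derive_on D (fun x => c * v x) (fun x => c * v1 x).
Proof.
  intros Hv. apply is_derive_on_eps. intros x Dx eps Heps.
  pose proof (Rabs_pos c) as Hc.
  destruct (proj1 (is_derive_on_eps _ _ _) Hv x Dx (eps / (1 + Rabs c))) as [d [Hd0 Hd]].
  { apply Rdiv_lt_0_compat; lra. }
  exists d. split; [exact Hd0|]. intros y Dy Hy. specialize (Hd y Dy Hy).
  replace (c * v y - c * v x - (y - x) * (c * v1 x)) with (c * (v y - v x - (y - x) * v1 x)) by ring.
  rewrite Rabs_mult. pose proof (Rabs_pos (y - x)) as Hp.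
  apply Rle_trans with (Rabs c * (eps / (1 + Rabs c) * Rabs (y - x))).
  - apply Rmult_le_compat_l; assumption.
  -
    assert (Rabs c / (1 + Rabs c) <= 1).
    { apply Rmult_le_reg_r with (1 + Rabs c); [lra|]. unfold Rdiv. rewrite Rmult_assoc, Rinv_l by lra. lra. }
    assert (0 <= eps * Rabs (y - x)) by nra. nra.
Qed.

Lemma C2_with_plus (D : R -> Prop) (v v1 v2 w w1 w2 : R -> R) :
  C2_with D v v1 v2 -> C2_with D w w1 w2 ->
  C2_with D (fun x => v x + w x) (fun x => v1 x + w1 x) (fun x => v2 x + w2 x).
Proof.
  intros [A [B C]] [A' [B' C']].
  split; [apply is_derive_on_plus; assumption|]. split; [apply is_derive_on_plus; assumption|].
  apply continuous_on_set_plus; assumption.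
Qed.

Lemma C2_with_scal (D : R -> Prop) (v v1 v2 : R -> R) (c : R) :
  C2_with D v v1 v2 -> C2_with D (fun x => c * v x) (fun x => c * v1 x) (fun x => c * v2 x).
Proof.
  intros [A [B C]]. split; [apply is_derive_on_scal; assumption|].
  split; [apply is_derive_on_scal; assumption|].
  apply continuous_on_set_mult; [apply continuous_on_set_const|exact C].
Qed.

(** The norm in [C1_curve] hides derivatives behind existential quantifiers; this identifies them
    with the chosen [u1] and [u2], up to the endpoints by continuity. *)
Lemma C2_with_unique (v v1 v2 w w1 w2 : R -> R) :
  C2_with (Icc 0 1) v v1 v2 -> C2_with (Icc 0 1) w w1 w2 -> (forall x, Icc 0 1 x -> v x = w x) ->
  forall x, Icc 0 1 x -> v1 x = w1 x /\ v2 x = w2 x.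
Proof.
  intros [A [B C]] [A' [B' C']] H.
  assert (HI : forall y, 0 < y < 1 -> Icc 0 1 y) by (unfold Icc; intros; lra).
  assert (loc : forall (g h : R -> R) (x : R), 0 < x < 1 -> (forall y, Icc 0 1 y -> g y = h y) ->
     locally x (fun y => g y = h y)).
  { intros g h x Hx E. assert (Hm : 0 < Rmin x (1 - x)) by (apply Rmin_pos; lra).
    exists (mkposreal _ Hm). intros y Hy. change (Rabs (y - x) < Rmin x (1 - x)) in Hy.
    pose proof (Rmin_l x (1 - x)). pose proof (Rmin_r x (1 - x)). apply Rabs_def2 in Hy.
    apply E. unfold Icc. lra. }
  assert (E1 : forall x, Icc 0 1 x -> v1 x = w1 x).
  { apply eq_on_closure; [lra| | |].
    - eapply is_derive_on_continuous; exact B.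
    - eapply is_derive_on_continuous; exact B'.
    - intros x Hx. pose proof (is_derive_on_interior _ _ _ 0 1 x A HI Hx) as D1.
      pose proof (is_derive_on_interior _ _ _ 0 1 x A' HI Hx) as D2.
      rewrite <- (is_derive_unique _ _ _ D1), <- (is_derive_unique _ _ _ D2).
      apply Derive_ext_loc. apply loc; assumption. }
  assert (E2 : forall x, Icc 0 1 x -> v2 x = w2 x).
  { apply eq_on_closure; [lra|exact C|exact C'|].
    intros x Hx. pose proof (is_derive_on_interior _ _ _ 0 1 x B HI Hx) as D1.
    pose proof (is_derive_on_interior _ _ _ 0 1 x B' HI Hx) as D2.
    rewrite <- (is_derive_unique _ _ _ D1), <- (is_derive_unique _ _ _ D2).
    apply Derive_ext_loc. apply loc; assumption. }
  intros x Hx. split; auto.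
Qed.

Lemma C2alpha_norm_le_pointwise (alpha K : R) (v : R -> R) :
  C2alpha_norm_le alpha v K -> exists v1 v2, C2_with (Icc 0 1) v v1 v2 /\
  forall x, Icc 0 1 x -> Rabs (v x) <= K /\ Rabs (v1 x) <= K /\ Rabs (v2 x) <= K.
Proof.
  intros [v1 [v2 [HC [K0 [K1 [K2 [H [Hs [Hb [HH _]]]]]]]]]]. exists v1, v2. split; [exact HC|].
  intros x Hx. destruct (Hb x Hx) as [A [B C]].
  pose proof (Rabs_pos (v x)). pose proof (Rabs_pos (v1 x)). pose proof (Rabs_pos (v2 x)).
  repeat split; lra.
Qed.

Lemma C1_curve_continuous (alpha mu : R) (lam : R -> R) (u u1 u2 : R -> R -> R) :
  C1_curve alpha lam u -> (forall mu, 0 < mu -> C2_with (Icc 0 1) (u mu) (u1 mu) (u2 mu)) ->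
  0 < mu -> forall eps, 0 < eps -> exists d, 0 < d /\ forall nu, Rabs (nu - mu) < d ->
    0 < nu /\ forall r, Icc 0 1 r ->
      Rabs (u nu r - u mu r) < eps /\ Rabs (u1 nu r - u1 mu r) < eps /\ Rabs (u2 nu r - u2 mu r) < eps.
Proof.
  intros [_ [dlam [du [_ [Hdu [Hrem _]]]]]] HC Hmu eps Heps.
  destruct (Hdu mu Hmu) as [K HK].
  destruct (C2alpha_norm_le_pointwise _ _ _ HK) as [d1 [d2 [HCd Hbd]]].
  assert (HK0 : 0 <= K).
  { destruct (Hbd 0 ltac:(unfold Icc; lra)) as [A _]. pose proof (Rabs_pos (du mu 0)). lra. }
  (* Differentiability with [eps = 1] already gives a local Lipschitz bound with constant K + 1. *)
  destruct (Hrem mu Hmu 1 Rlt_0_1) as [d0 Hd0].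
  assert (Hq : 0 < eps / (K + 2)) by (apply Rdiv_lt_0_compat; lra).
  exists (Rmin (Rmin d0 mu) (eps / (K + 2))).
  split; [repeat apply Rmin_pos; try assumption; apply cond_pos|].
  intros nu Hnu.
  pose proof (Rmin_l (Rmin d0 mu) (eps / (K + 2))). pose proof (Rmin_r (Rmin d0 mu) (eps / (K + 2))).
  pose proof (Rmin_l d0 mu). pose proof (Rmin_r d0 mu).
  assert (Hnu0 : 0 < nu) by (apply Rabs_def2 in Hnu; lra).
  split; [exact Hnu0|].
  assert (Hb : ball mu d0 nu) by (change (Rabs (nu - mu) < d0); lra).
  specialize (Hd0 nu Hb). cbv beta in Hd0.
  destruct (C2alpha_norm_le_pointwise _ _ _ Hd0) as [r1 [r2 [HCr Hbr]]].
  pose proof (C2_with_plus _ _ _ _ _ _ _ (C2_with_plus _ _ _ _ _ _ _ (HC mu Hmu) (C2_with_scal _ _ _ _ (nu - mu) HCd)) HCr) as HS.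
  pose proof (C2_with_unique _ _ _ _ _ _ (HC nu Hnu0) HS) as HU. cbv beta in HU.
  intros r Hr. destruct (HU ltac:(intros; ring) r Hr) as [E1 E2].
  destruct (Hbd r Hr) as [B0 [B1 B2]]. destruct (Hbr r Hr) as [R0 [R1 R2]].
  assert (Hsmall : (K + 1) * Rabs (nu - mu) < eps).
  { assert (Hl : Rabs (nu - mu) < eps / (K + 2)) by lra.
    apply Rmult_lt_compat_r with (r := K + 2) in Hl; [|lra].
    replace (eps / (K + 2) * (K + 2)) with eps in Hl by (field; lra).
    nra. }
  assert (tri : forall a b, Rabs a <= K -> Rabs b <= 1 * Rabs (nu - mu) -> Rabs ((nu - mu) * a + b) < eps).
  { intros a b Ha Hb'. eapply Rle_lt_trans; [apply Rabs_triang|]. rewrite Rabs_mult.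
    pose proof (Rabs_pos (nu - mu)). nra. }
  split; [|split].
  - replace (u nu r - u mu r) with ((nu - mu) * du mu r + (u nu r - u mu r - (nu - mu) * du mu r)) by ring.
    apply tri; assumption.
  - rewrite E1. replace (u1 mu r + (nu - mu) * d1 r + r1 r - u1 mu r) with ((nu - mu) * d1 r + r1 r) by ring.
    apply tri; assumption.
  - rewrite E2. replace (u2 mu r + (nu - mu) * d2 r + r2 r - u2 mu r) with ((nu - mu) * d2 r + r2 r) by ring.
    apply tri; assumption.
Qed.

Lemma nonlinearity_lipschitz (p tau0 B : R) (f : R -> R) :
  nonlinearity p tau0 f -> 0 < B -> exists L, 0 < L /\
  forall s t, 0 <= s <= B -> 0 <= t <= B -> Rabs (f s - f t) <= L * Rabs (s - t).
Proof.
  intros [[f1 [f2 [D0 [D1 _]]]] _] HB.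
  assert (sub : forall x, Icc 0 B x -> Ici 0 x) by (unfold Icc, Ici; intros; lra).
  assert (C1 : continuous_on_set (Icc 0 B) f1).
  { apply continuous_on_set_sub with (1 := sub). eapply is_derive_on_continuous. exact D1. }
  assert (C0 : continuous_on_set (Ici 0) f) by (eapply is_derive_on_continuous; exact D0).
  destruct (continuous_on_bounded f1 0 B ltac:(lra) C1) as [L [HL0 HL]].
  exists L. split; [exact HL0|].
  assert (lt_case : forall s t, 0 <= s -> s < t -> t <= B -> Rabs (f t - f s) <= L * Rabs (t - s)).
  { intros s t Hs Hst Ht.
    destruct (MVT_on f f1 s t Hst) as [c [Hc E]].
    - apply continuous_on_set_sub with (2 := C0). unfold Icc, Ici; intros; lra.
    - intros x Hx. apply (is_derive_on_interior (Ici 0) f f1 0 B x D0); [|lra]. unfold Ici; intros; lra.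
    - rewrite E, Rabs_mult. apply Rmult_le_compat_r; [apply Rabs_pos|]. apply HL. lra. }
  intros s t Hs Ht. destruct (Rtotal_order s t) as [H|[H|H]].
  - rewrite Rabs_minus_sym, (Rabs_minus_sym s t). apply lt_case; lra.
  - subst. rewrite !Rminus_eq_0, Rabs_R0. lra.
  - apply lt_case; lra.
Qed.

(** A Gronwall estimate run from right to left, as the data are compared at [b]; keeping r >= a > 0
    bounds the singular coefficient 1 / r. *)
Lemma ode_stability (f u u1 u2 y y1 y2 : R -> R) (l L B a b : R) :
  0 < a -> a <= b -> 0 <= l -> 0 <= L ->
  (forall s t, 0 <= s <= B -> 0 <= t <= B -> Rabs (f s - f t) <= L * Rabs (s - t)) ->
  continuous_on_set (Icc a b) u -> continuous_on_set (Icc a b) u1 ->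
  continuous_on_set (Icc a b) y -> continuous_on_set (Icc a b) y1 ->
  (forall r, a < r < b -> is_derive u r (u1 r) /\ is_derive u1 r (u2 r) /\
     u2 r = - / r * u1 r - l * f (u r) /\ 0 <= u r <= B) ->
  (forall r, a < r < b -> is_derive y r (y1 r) /\ is_derive y1 r (y2 r) /\
     y2 r = - / r * y1 r - l * f (y r) /\ 0 <= y r <= B) ->
  (u a - y a) ^ 2 + (u1 a - y1 a) ^ 2
  <= ((u b - y b) ^ 2 + (u1 b - y1 b) ^ 2) * exp ((1 + 2 / a + l * L) * (b - a)).
Proof.
  intros Ha Hab Hl HL Hlip Cu Cu1 Cy Cy1 Hu Hy.
  set (K := 1 + 2 / a + l * L).
  pose (g := fun r => (u r - y r) ^ 2 + (u1 r - y1 r) ^ 2).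
  pose (h := fun r => g r * exp (K * r)).
  assert (Cdiff : forall v w, continuous_on_set (Icc a b) v -> continuous_on_set (Icc a b) w ->
     continuous_on_set (Icc a b) (fun r => (v r - w r) ^ 2)).
  { intros v w Cv Cw. pose proof (continuous_on_set_minus _ _ _ Cv Cw) as Cm.
    apply continuous_on_set_mult; [exact Cm|].
    apply continuous_on_set_mult; [exact Cm|apply continuous_on_set_const]. }
  assert (Dg : forall r, a < r < b -> is_derive h r
     ((2 * (u r - y r) * (u1 r - y1 r) + 2 * (u1 r - y1 r) * (u2 r - y2 r) + K * g r) * exp (K * r))).
  { intros r Hr. destruct (Hu r Hr) as [A [A1 _]]. destruct (Hy r Hr) as [A' [A1' _]].
    unfold h, g. derive_known. ring. }
  assert (H : h a <= h b).
  { apply (nondecr_on h (fun r => (2 * (u r - y r) * (u1 r - y1 r) + 2 * (u1 r - y1 r) * (u2 r - y2 r) + K * g r) * exp (K * r))); [exact Hab| |].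
    - apply continuous_on_set_mult.
      + apply continuous_on_set_plus; apply Cdiff; assumption.
      + apply continuous_on_set_of_ex_derive. intros x. auto_derive. exact I.
    - intros r Hr. split; [apply Dg; exact Hr|].
      apply Rmult_le_pos; [|left; apply exp_pos].
      destruct (Hu r Hr) as [_ [_ [E Hb]]]. destruct (Hy r Hr) as [_ [_ [E' Hb']]].
      specialize (Hlip (u r) (y r) Hb Hb'). rewrite E, E'. unfold g, K.
      set (w := u r - y r) in *. set (w1 := u1 r - y1 r) in *. set (F := f (u r) - f (y r)) in *.
      replace (- / r * u1 r - l * f (u r) - (- / r * y1 r - l * f (y r))) with (- / r * w1 - l * F)
        by (unfold w1, F; ring).
      clear E E' Hb Hb' Hu Hy Dg. clearbody w w1 F. clear Cdiff h g K.
      assert (Hr2 : / r <= / a) by (apply Rinv_le_contravar; lra).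
      assert (H1 : 2 * w * w1 >= - (w ^ 2 + w1 ^ 2)) by (pose proof (pow2_ge_0 (w + w1)); lra).
      assert (H2 : - (2 * w1 * (- / r * w1)) <= 2 / a * w1 ^ 2) by nra.
      assert (H3' : 2 * w1 * (- (l * F)) >= - (l * L * (w ^ 2 + w1 ^ 2))).
      { assert (Hwf : w1 * F <= L * (Rabs w1 * Rabs w)).
        { apply Rle_trans with (Rabs (w1 * F)); [apply Rle_abs|].
          rewrite Rabs_mult. pose proof (Rabs_pos w1). nra. }
        assert (Rabs w1 * Rabs w <= (w ^ 2 + w1 ^ 2) / 2).
        { rewrite <- (pow2_abs w), <- (pow2_abs w1). pose proof (pow2_ge_0 (Rabs w - Rabs w1)). lra. }
        assert (w1 * F <= L * ((w ^ 2 + w1 ^ 2) / 2)) by nra. nra. }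
      assert (0 <= 2 / a * w ^ 2).
      { apply Rmult_le_pos; [|apply pow2_ge_0]. left. apply Rdiv_lt_0_compat; lra. }
      lra. }
  unfold h, g in H.
  replace (K * (b - a)) with (K * b + - (K * a)) by ring. rewrite exp_plus.
  apply Rmult_le_reg_r with (exp (K * a)); [apply exp_pos|].
  eapply Rle_trans; [exact H|]. right.
  replace (((u b - y b) ^ 2 + (u1 b - y1 b) ^ 2) * (exp (K * b) * exp (- (K * a))) * exp (K * a))
    with (((u b - y b) ^ 2 + (u1 b - y1 b) ^ 2) * exp (K * b) * (exp (- (K * a)) * exp (K * a))) by ring.
  rewrite <- exp_plus. replace (- (K * a) + K * a) with 0 by ring. rewrite exp_0. ring.
Qed.

Lemma continuity_2d_pt_comp (g h k : R -> R -> R) (x y : R) :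
  continuity_2d_pt g (h x y) (k x y) -> continuity_2d_pt h x y -> continuity_2d_pt k x y ->
  continuity_2d_pt (fun x y => g (h x y) (k x y)) x y.
Proof.
  intros Hg Hh Hk eps. destruct (Hg eps) as [d Hd].
  generalize (locally_2d_and _ _ _ _ (Hh d) (Hk d)). apply locally_2d_impl.
  apply locally_2d_forall. intros s t [A B]. apply Hd; assumption.
Qed.

(** * Oscillation of the bifurcation curve *)

Lemma clamp_derive (v : R -> R) (a b x d : R) :
  a < x < b -> is_derive v x d -> is_derive (fun y => v (clamp a b y)) x d.
Proof.
  intros Hx D. apply is_derive_ext_loc with (2 := D).
  assert (Hm : 0 < Rmin (x - a) (b - x)) by (apply Rmin_pos; lra).
  exists (mkposreal _ Hm). intros y Hy. change (Rabs (y - x) < Rmin (x - a) (b - x)) in Hy.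
  pose proof (Rmin_l (x - a) (b - x)). pose proof (Rmin_r (x - a) (b - x)). apply Rabs_def2 in Hy.
  rewrite clamp_id; [reflexivity|lra].
Qed.

Lemma clamp_continuous_Ioc (v : R -> R) (b x : R) :
  0 < b -> 0 < x -> continuous_on_set (Ioc 0 b) v -> continuous (fun y => v (clamp 0 b y)) x.
Proof.
  intros Hb Hx H.
  assert (In : forall y, 0 < y -> Ioc 0 b (clamp 0 b y)).
  { intros y Hy. unfold Ioc, clamp. rewrite Rmax_right.
    - split; [apply Rmin_glb_lt; assumption|apply Rmin_l].
    - apply Rmin_glb; lra. }
  apply filterlim_locally. intros eps.
  destruct (proj1 (continuous_on_set_eps _ _) H _ (In x Hx) eps (cond_pos eps)) as [d [Hd0 Hd]].
  assert (Hm : 0 < Rmin d x) by (apply Rmin_pos; lra).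
  exists (mkposreal _ Hm). intros y Hy. change (Rabs (y - x) < Rmin d x) in Hy.
  pose proof (Rmin_l d x). pose proof (Rmin_r d x).
  apply Hd; [apply In; apply Rabs_def2 in Hy; lra|].
  eapply Rle_lt_trans; [apply clamp_lip|lra].
Qed.

Lemma continuity_2d_pt_of_continuous (g : R -> R) (x y : R) :
  continuous g x -> continuity_2d_pt (fun x _ => g x) x y.
Proof.
  intros H eps. destruct (proj1 (filterlim_locally _ _) H eps) as [d Hd].
  exists d. intros s t Hs _. exact (Hd s Hs).
Qed.

(** Constant continuation in r beyond [0, 1], so that joint continuity in (mu, r) makes sense for
    every real r. *)
Definition ubox (u : R -> R -> R) (mu r : R) : R := u mu (clamp 0 1 r).

Lemma ubox_continuous (u : R -> R -> R) (mu r : R) :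
  continuous_on_set (Icc 0 1) (u mu) ->
  (forall eps, 0 < eps -> exists d, 0 < d /\ forall nu, Rabs (nu - mu) < d ->
     forall r, Icc 0 1 r -> Rabs (u nu r - u mu r) < eps) ->
  continuity_2d_pt (ubox u) mu r.
Proof.
  intros Hc Hu eps. assert (He : 0 < eps / 2) by (pose proof (cond_pos eps); lra).
  destruct (Hu (eps / 2) He) as [d1 [Hd1 H1]].
  pose proof (clamp_continuous 0 1 r (u mu) ltac:(lra) Hc) as Hr.
  destruct (proj1 (filterlim_locally _ _) Hr (mkposreal _ He)) as [d2 H2].
  assert (Hm : 0 < Rmin d1 d2) by (apply Rmin_pos; [exact Hd1|apply cond_pos]).
  exists (mkposreal _ Hm). simpl. intros nu y Hnu Hy.
  pose proof (Rmin_l d1 d2). pose proof (Rmin_r d1 d2). unfold ubox.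
  replace (u nu (clamp 0 1 y) - u mu (clamp 0 1 r))
    with ((u nu (clamp 0 1 y) - u mu (clamp 0 1 y)) + (u mu (clamp 0 1 y) - u mu (clamp 0 1 r))) by ring.
  eapply Rle_lt_trans; [apply Rabs_triang|].
  specialize (H1 nu ltac:(lra) (clamp 0 1 y) (clamp_in 0 1 y ltac:(lra))).
  assert (H3 : Rabs (u mu (clamp 0 1 y) - u mu (clamp 0 1 r)) < eps / 2) by (apply (H2 y); change (Rabs (y - r) < d2); lra).
  lra.
Qed.

(** * Simple zeros and the Pruefer angle along the curve *)

Section Curve.

Variables (p tau0 alpha : R) (f : R -> R) (lam : R -> R) (u u1 u2 : R -> R -> R)
  (Rstar : R) (Ubar U1 U2 : R -> R).
Hypothesis hp : 2 < p.
Hypothesis htau0 : 0 < tau0.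
Hypothesis hf : nonlinearity p tau0 f.
Hypothesis hcurve : C1_curve alpha lam u.
Hypothesis hlam : forall mu, 0 < mu -> 0 < lam mu.
Hypothesis hu : forall mu, 0 < mu -> psol f (lam mu) (u mu) (u1 mu) (u2 mu).
Hypothesis hu0 : forall mu, 0 < mu -> u mu 0 = mu.
Hypothesis hsing : singular_profile p tau0 f Rstar Ubar.
Hypothesis hU : C2_with (Ioc 0 Rstar) Ubar U1 U2.
Hypothesis hUeq : forall r, Ioo 0 Rstar r -> radial_eq f Ubar U1 U2 r.

Lemma Rstar_gt : exp (- exp (p * ln tau0) / 2) < Rstar.
Proof. apply hsing. Qed.

Lemma Rstar_pos : 0 < Rstar.
Proof. pose proof Rstar_gt. pose proof (exp_pos (- exp (p * ln tau0) / 2)). lra. Qed.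

Lemma Ubar_value (s : R) : exp (p * ln tau0) <= s -> Ubar (exp (- (s / 2))) = exp (ln s / p).
Proof.
  intros Hs. destruct hsing as [_ [H _]]. rewrite H.
  - unfold Rpower. f_equal. replace (1 / exp (- (s / 2))) with (exp (s / 2)).
    + rewrite ln_exp. replace (2 * (s / 2)) with s by field. field. lra.
    + rewrite exp_Ropp. field. pose proof (exp_pos (s / 2)). lra.
  - split; [apply exp_pos|]. apply exp_le. unfold Rpower. lra.
Qed.

Lemma Ubar_derive (r : R) : 0 < r < Rstar ->
  is_derive Ubar r (U1 r) /\ is_derive U1 r (U2 r) /\ U2 r = - / r * U1 r - f (Ubar r) /\ 0 < Ubar r.
Proof.
  intros Hr. destruct hU as [D0 [D1 _]].
  assert (HI : forall y, 0 < y < Rstar -> Ioc 0 Rstar y) by (unfold Ioc; intros; lra).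
  split; [exact (is_derive_on_interior _ _ _ 0 Rstar r D0 HI Hr)|].
  split; [exact (is_derive_on_interior _ _ _ 0 Rstar r D1 HI Hr)|].
  split; [|apply hsing; exact Hr]. pose proof (hUeq r Hr) as E. unfold radial_eq in E. lra.
Qed.

Lemma Ubar_nonneg (r : R) : 0 < r <= Rstar -> 0 <= Ubar r.
Proof.
  intros Hr. destruct (Req_dec r Rstar) as [E|E].
  - subst r. destruct hsing as [_ [_ [_ [_ [_ E]]]]]. lra.
  - left. apply Ubar_derive. lra.
Qed.

Lemma Ubar_blowup (M : R) : exists d, 0 < d /\ forall r, 0 < r < d -> M < Ubar r.
Proof.
  destruct hsing as [_ [_ [_ [_ [H _]]]]].
  assert (HP : Rbar_locally p_infty (fun y => M < y)) by (exists M; auto).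
  destruct (H _ HP) as [d Hd]. exists d. split; [apply cond_pos|].
  intros r Hr. apply Hd; [|lra]. change (Rabs (r - 0) < d). rewrite Rabs_right; lra.
Qed.

Lemma Ubar_continuous : continuous_on_set (Ioc 0 Rstar) Ubar /\ continuous_on_set (Ioc 0 Rstar) U1
  /\ continuous_on_set (Ioc 0 Rstar) U2.
Proof.
  destruct hU as [D0 [D1 C2]]. split; [eapply is_derive_on_continuous; exact D0|].
  split; [eapply is_derive_on_continuous; exact D1|exact C2].
Qed.

Lemma curve_continuous (mu r : R) : 0 < mu ->
  continuity_2d_pt (ubox u) mu r /\ continuity_2d_pt (ubox u1) mu r /\ continuity_2d_pt (ubox u2) mu r.
Proof.
  intros Hmu.
  assert (HC : forall mu, 0 < mu -> C2_with (Icc 0 1) (u mu) (u1 mu) (u2 mu)) by (intros; apply hu; assumption).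
  pose proof (C1_curve_continuous alpha mu lam u u1 u2 hcurve HC Hmu) as H.
  destruct (HC mu Hmu) as [D0 [D1 C2]].
  split; [|split]; apply ubox_continuous.
  - eapply is_derive_on_continuous; exact D0.
  - intros eps He. destruct (H eps He) as [d [Hd0 Hd]]. exists d. split; [exact Hd0|].
    intros nu Hnu s Hs. apply (proj2 (Hd nu Hnu) s Hs).
  - eapply is_derive_on_continuous; exact D1.
  - intros eps He. destruct (H eps He) as [d [Hd0 Hd]]. exists d. split; [exact Hd0|].
    intros nu Hnu s Hs. apply (proj2 (Hd nu Hnu) s Hs).
  - exact C2.
  - intros eps He. destruct (H eps He) as [d [Hd0 Hd]]. exists d. split; [exact Hd0|].
    intros nu Hnu s Hs. apply (proj2 (Hd nu Hnu) s Hs).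
Qed.

Lemma lam_continuous (mu : R) : 0 < mu -> continuous lam mu.
Proof.
  intros Hmu. destruct hcurve as [_ [dlam [du [H _]]]]. destruct (H mu Hmu) as [D _].
  apply (@ex_derive_continuous R_AbsRing R_NormedModule). exists (dlam mu). exact D.
Qed.

Lemma sqrt_lam_pos (mu : R) : 0 < mu -> 0 < sqrt (lam mu).
Proof. intros Hmu. apply sqrt_lt_R0. apply hlam. exact Hmu. Qed.

Lemma sqrt_lam_sq (mu : R) : 0 < mu -> sqrt (lam mu) * sqrt (lam mu) = lam mu.
Proof. intros Hmu. apply sqrt_sqrt. left. apply hlam. exact Hmu. Qed.

Lemma profile_derive (mu r : R) : 0 < mu -> 0 < r -> sqrt (lam mu) * r < Rstar ->
  is_derive (fun r => Ubar (sqrt (lam mu) * r)) r (sqrt (lam mu) * U1 (sqrt (lam mu) * r)) /\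
  is_derive (fun r => sqrt (lam mu) * U1 (sqrt (lam mu) * r)) r (lam mu * U2 (sqrt (lam mu) * r)) /\
  lam mu * U2 (sqrt (lam mu) * r)
    = - / r * (sqrt (lam mu) * U1 (sqrt (lam mu) * r)) - lam mu * f (Ubar (sqrt (lam mu) * r)).
Proof.
  intros Hmu Hr HR. pose proof (sqrt_lam_pos mu Hmu) as Hs. pose proof (sqrt_lam_sq mu Hmu) as Hsq.
  destruct (Ubar_derive (sqrt (lam mu) * r)) as [D0 [D1 [E _]]].
  { split; [apply Rmult_lt_0_compat; assumption|exact HR]. }
  set (c := sqrt (lam mu)) in *. split; [|split].
  - derive_known. ring.
  - rewrite <- Hsq. derive_known. ring.
  - rewrite E, <- Hsq. field. lra.
Qed.

(** Backward uniqueness from [r] would make both functions agree at a radius so small that the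
    singular profile already exceeds [mu], the maximum of [u mu]. *)
Lemma no_tangency (mu r : R) : 0 < mu -> 0 < r <= 1 -> sqrt (lam mu) * r <= Rstar ->
  u mu r = Ubar (sqrt (lam mu) * r) -> u1 mu r = sqrt (lam mu) * U1 (sqrt (lam mu) * r) -> False.
Proof.
  intros Hmu Hr HR E E1.
  pose proof (sqrt_lam_pos mu Hmu) as Hs. pose proof (sqrt_lam_sq mu Hmu) as Hsq.
  assert (fpos : forall t, 0 <= t -> 0 <= f t) by apply hf.
  set (c := sqrt (lam mu)) in *.
  destruct (Ubar_blowup mu) as [d [Hd0 Hd]].
  set (a := Rmin (d / c) r / 2).
  assert (Hdc : 0 < d / c) by (apply Rdiv_lt_0_compat; assumption).
  assert (Ha : 0 < a /\ a < r /\ a < d / c).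
  { unfold a. assert (0 < Rmin (d / c) r) by (apply Rmin_pos; lra).
    pose proof (Rmin_l (d / c) r). pose proof (Rmin_r (d / c) r). lra. }
  assert (Hca : 0 < c * a < d).
  { split; [apply Rmult_lt_0_compat; lra|]. replace d with (c * (d / c)) by (field; lra).
    apply Rmult_lt_compat_l; lra. }
  assert (Hsub : forall x, Icc a r x -> Ioc 0 Rstar (c * x)).
  { unfold Icc, Ioc. intros x Hx. split; [apply Rmult_lt_0_compat; lra|].
    apply Rle_trans with (c * r); [apply Rmult_le_compat_l; lra|exact HR]. }
  assert (scaled : forall V, continuous_on_set (Ioc 0 Rstar) V -> continuous_on_set (Icc a r) (fun x => V (c * x))).
  { intros V. apply continuous_on_set_comp; [exact Hsub|].
    apply continuous_on_set_of_ex_derive. intros x. auto_derive. exact I. }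
  destruct Ubar_continuous as [CU0 [CU1 _]].
  destruct (psol_continuous _ _ _ _ _ (hu mu Hmu)) as [Cu Cu1].
  destruct (continuous_on_bounded (fun x => Ubar (c * x)) a r ltac:(lra) (scaled _ CU0)) as [B [HB0 HB]].
  destruct (nonlinearity_lipschitz p tau0 (B + mu) f hf ltac:(lra)) as [L [HL0 HL]].
  assert (Hsubu : forall x, Icc a r x -> Icc 0 1 x) by (unfold Icc; intros; lra).
  pose proof (ode_stability f (u mu) (u1 mu) (u2 mu) (fun x => Ubar (c * x)) (fun x => c * U1 (c * x))
    (fun x => lam mu * U2 (c * x)) (lam mu) L (B + mu) a r ltac:(lra) ltac:(lra)
    ltac:(left; apply hlam; exact Hmu) ltac:(lra) HL
    (continuous_on_set_sub _ _ _ Hsubu Cu) (continuous_on_set_sub _ _ _ Hsubu Cu1) (scaled _ CU0)) as ST.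
  assert (E0 : (u mu a - Ubar (c * a)) ^ 2 + (u1 mu a - c * U1 (c * a)) ^ 2 <= 0).
  { rewrite <- (Rmult_0_l (exp ((1 + 2 / a + lam mu * L) * (r - a)))).
    replace 0 with ((u mu r - Ubar (c * r)) ^ 2 + (u1 mu r - c * U1 (c * r)) ^ 2) at 1 by (rewrite E, E1; ring).
    apply ST.
    - apply continuous_on_set_mult; [apply continuous_on_set_const|apply scaled; exact CU1].
    - intros x Hx. destruct (psol_derive _ _ x _ _ _ (hu mu Hmu) ltac:(lra)) as [D0 [D1 [Eq Hpos]]].
      split; [exact D0|]. split; [exact D1|]. split; [exact Eq|]. split; [lra|].
      assert (u mu x <= u mu 0) by (apply (psol_nonincr f (lam mu) (u mu) (u1 mu) (u2 mu) fpos (hlam mu Hmu) (hu mu Hmu)); lra).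
      rewrite hu0 in H by exact Hmu. lra.
    - intros x Hx.
      assert (Hcx : c * x < Rstar).
      { apply Rlt_le_trans with (c * r); [apply Rmult_lt_compat_l; lra|exact HR]. }
      destruct (profile_derive mu x Hmu ltac:(lra) Hcx) as [D0 [D1 Eq]].
      split; [exact D0|]. split; [exact D1|]. split; [exact Eq|].
      split; [apply Ubar_nonneg; apply Hsub; unfold Icc; lra|].
      specialize (HB x ltac:(lra)). pose proof (Rle_abs (Ubar (c * x))). lra. }
  assert (Ea : u mu a = Ubar (c * a)).
  { pose proof (pow2_ge_0 (u mu a - Ubar (c * a))). pose proof (pow2_ge_0 (u1 mu a - c * U1 (c * a))).
    assert (Z : (u mu a - Ubar (c * a)) ^ 2 = 0) by lra.
    assert (u mu a - Ubar (c * a) = 0) by (apply Rsqr_0_uniq; unfold Rsqr; simpl in Z; lra). lra. }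
  assert (u mu a <= u mu 0) by (apply (psol_nonincr f (lam mu) (u mu) (u1 mu) (u2 mu) fpos (hlam mu Hmu) (hu mu Hmu)); lra).
  rewrite hu0 in H by exact Hmu. specialize (Hd (c * a) Hca). lra.
Qed.

(** The comparison runs from the starting radius to the first zero of either profile. This interval
    moves with [mu] and is mapped affinely onto [0, 1]; [q] is its length, the factor in the chain
    rule, and the clamps give continuity beyond the interval. *)
Let ra (mu : R) : R := rr (lam mu) (start p mu).
Let re (mu : R) : R := Rmin 1 (Rstar / sqrt (lam mu)).
Let q (mu : R) : R := re mu - ra mu.
Let rad (mu x : R) : R := ra mu + q mu * clamp 0 1 x.
Let Ubox (V : R -> R) (y : R) : R := V (clamp 0 Rstar y).
Let W (mu x : R) : R := ubox u mu (rad mu x) - Ubox Ubar (sqrt (lam mu) * rad mu x).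
Let W1 (mu x : R) : R := ubox u1 mu (rad mu x) - sqrt (lam mu) * Ubox U1 (sqrt (lam mu) * rad mu x).
Let W2 (mu x : R) : R := ubox u2 mu (rad mu x) - lam mu * Ubox U2 (sqrt (lam mu) * rad mu x).

Lemma lambda_oscillates :
  forall N : R, (exists mu, N < mu /\ 0 < mu /\ Rstar ^ 2 < lam mu) /\
                (exists mu, N < mu /\ 0 < mu /\ lam mu < Rstar ^ 2).
Proof.
  pose proof Rstar_pos as HR0. pose proof Rstar_gt as HRg.
  destruct (frequent_crossings p tau0 f hp htau0 hf) as [S1 [T [mb [HS1 [HS1' [HT [Hmb HF]]]]]]].
  set (m0 := mb + tau0).
  assert (Hstart : forall mu, m0 < mu -> 0 < ra mu /\ ra mu < 1 /\ sqrt (lam mu) * ra mu < Rstar /\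
     sqrt (lam mu) * ra mu = exp (- (2 * exp (p * ln mu) / 2))).
  { intros mu Hmu. assert (Hmu0 : 0 < mu) by (unfold m0 in Hmu; lra).
    assert (Hmus : mb <= u mu 0) by (rewrite hu0 by exact Hmu0; unfold m0 in Hmu; lra).
    destruct (HF (lam mu) (u mu) (u1 mu) (u2 mu) (hlam mu Hmu0) (hu mu Hmu0) Hmus) as [Hs [HPb _]].
    destruct (HPb (start p (u mu 0)) ltac:(lra) Hs) as [Hr1 _]. rewrite hu0 in Hr1 by exact Hmu0.
    pose proof (sqrt_lam_pos mu Hmu0) as Hsl.
    split; [apply rr_pos; apply hlam; exact Hmu0|]. split; [exact Hr1|].
    assert (E : sqrt (lam mu) * ra mu = exp (- (2 * exp (p * ln mu) / 2))).
    { unfold ra, rr. rewrite start_time. field. lra. }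
    split; [|exact E]. rewrite E. eapply Rle_lt_trans; [|exact HRg]. apply exp_le.
    assert (exp (p * ln tau0) <= exp (p * ln mu)).
    { apply exp_le. apply Rmult_le_compat_l; [lra|]. left. apply ln_increasing; [exact htau0|]. unfold m0 in Hmu. lra. }
    pose proof (exp_pos (p * ln mu)). lra. }
  assert (Hm0 : forall mu, m0 < mu -> 0 < mu) by (intros mu; unfold m0; lra).
  assert (Hre : forall mu, m0 < mu -> ra mu < re mu <= 1 /\ sqrt (lam mu) * re mu <= Rstar).
  { intros mu Hmu. destruct (Hstart mu Hmu) as [H1 [H2 [H3 _]]].
    pose proof (sqrt_lam_pos mu (Hm0 mu Hmu)) as Hsl. split; [split|].
    - apply Rmin_glb_lt; [exact H2|].
      apply Rmult_lt_reg_l with (sqrt (lam mu)); [exact Hsl|].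
      replace (sqrt (lam mu) * (Rstar / sqrt (lam mu))) with Rstar by (field; lra). exact H3.
    - apply Rmin_l.
    - apply Rle_trans with (sqrt (lam mu) * (Rstar / sqrt (lam mu))).
      + apply Rmult_le_compat_l; [lra|apply Rmin_r].
      + right. field. lra. }
  assert (Hrad : forall mu x, m0 < mu -> 0 < rad mu x <= 1 /\ 0 < sqrt (lam mu) * rad mu x <= Rstar).
  { intros mu x Hmu. destruct (Hre mu Hmu) as [H1 H2]. destruct (Hstart mu Hmu) as [H3 _].
    pose proof (sqrt_lam_pos mu (Hm0 mu Hmu)) as Hsl.
    pose proof (clamp_in 0 1 x ltac:(lra)) as Hc.
    assert (ra mu <= rad mu x <= re mu).
    { unfold rad, q. split; nra. }
    split; [lra|]. split; [apply Rmult_lt_0_compat; lra|].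
    apply Rle_trans with (sqrt (lam mu) * re mu); [apply Rmult_le_compat_l; lra|exact H2]. }
  assert (Hbox : forall V mu x, m0 < mu -> ubox V mu (rad mu x) = V mu (rad mu x)).
  { intros V mu x Hmu. unfold ubox. rewrite clamp_id; [reflexivity|]. destruct (Hrad mu x Hmu); lra. }
  assert (HUbox : forall V mu x, m0 < mu -> Ubox V (sqrt (lam mu) * rad mu x) = V (sqrt (lam mu) * rad mu x)).
  { intros V mu x Hmu. unfold Ubox. rewrite clamp_id; [reflexivity|]. destruct (Hrad mu x Hmu); lra. }
  assert (Clam : forall mu, m0 < mu -> continuous lam mu) by (intros; apply lam_continuous; auto).
  assert (Csq : forall mu, m0 < mu -> continuous (fun mu => sqrt (lam mu)) mu).
  { intros mu Hmu. apply (continuous_comp lam sqrt); [auto|]. apply continuous_sqrt. }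
  assert (Csqi : forall mu, m0 < mu -> continuous (fun mu => / sqrt (lam mu)) mu).
  { intros mu Hmu. apply (continuous_comp (fun mu => sqrt (lam mu)) Rinv); [auto|].
    apply (@ex_derive_continuous R_AbsRing R_NormedModule). auto_derive.
    pose proof (sqrt_lam_pos mu (Hm0 mu Hmu)). lra. }
  assert (Cra : forall mu, m0 < mu -> continuous ra mu).
  { intros mu Hmu.
    apply continuous_ext_loc with (fun mu => exp (- exp (p * ln mu)) * / sqrt (lam mu)).
    - exists (mkposreal (mu - m0) ltac:(lra)). intros nu Hnu. change (Rabs (nu - mu) < mu - m0) in Hnu.
      unfold ra, rr. rewrite start_time. replace (2 * exp (p * ln nu) / 2) with (exp (p * ln nu)) by field. reflexivity.
    - apply (continuous_mult (fun mu => exp (- exp (p * ln mu))) (fun mu => / sqrt (lam mu))); [|auto].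
      apply (@ex_derive_continuous R_AbsRing R_NormedModule). auto_derive. apply Hm0. exact Hmu. }
  assert (Cre : forall mu, m0 < mu -> continuous re mu).
  { intros mu Hmu. pose proof (sqrt_lam_pos mu (Hm0 mu Hmu)) as Hsl.
    apply continuous_ext with (fun mu => clamp 0 1 (Rstar / sqrt (lam mu))).
    - intros nu. unfold re, clamp. assert (0 <= Rstar / sqrt (lam nu)).
      { destruct (Req_dec (sqrt (lam nu)) 0) as [z|z].
        - rewrite z. unfold Rdiv. rewrite Rinv_0. lra.
        - pose proof (sqrt_pos (lam nu)). apply Rdiv_le_0_compat; lra. }
      apply Rmax_right. apply Rmin_glb; lra.
    - apply (continuous_comp (fun mu => Rstar / sqrt (lam mu)) (clamp 0 1)).
      + apply (continuous_mult (fun _ => Rstar) (fun mu => / sqrt (lam mu))); [apply continuous_const|auto].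
      + apply filterlim_locally. intros eps. exists eps. intros y Hy.
        eapply Rle_lt_trans; [apply clamp_lip|exact Hy]. }
  assert (Cq2 : forall mu x, m0 < mu -> continuity_2d_pt (fun mu _ => q mu) mu x).
  { intros mu x Hmu. apply continuity_2d_pt_of_continuous. apply (continuous_minus re ra); auto. }
  assert (Crad : forall mu x, m0 < mu -> continuity_2d_pt rad mu x).
  { intros mu x Hmu. apply continuity_2d_pt_plus; [apply continuity_2d_pt_of_continuous; auto|].
    apply continuity_2d_pt_mult; [apply Cq2; exact Hmu|].
    intros eps. exists eps. intros s t _ Ht. eapply Rle_lt_trans; [apply clamp_lip|exact Ht]. }
  assert (Csr : forall mu x, m0 < mu -> continuity_2d_pt (fun mu x => sqrt (lam mu) * rad mu x) mu x).
  { intros mu x Hmu. apply continuity_2d_pt_mult; [|auto]. apply continuity_2d_pt_of_continuous; auto. }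
  assert (CU : forall V mu x, m0 < mu -> continuous_on_set (Ioc 0 Rstar) V ->
     continuity_2d_pt (fun mu x => Ubox V (sqrt (lam mu) * rad mu x)) mu x).
  { intros V mu x Hmu HV. apply (continuity_1d_2d_pt_comp (Ubox V)); [|apply Csr; exact Hmu].
    apply continuity_pt_filterlim. apply clamp_continuous_Ioc; [exact HR0| |exact HV].
    apply Hrad. exact Hmu. }
  assert (Cu : forall V, (forall mu r, 0 < mu -> continuity_2d_pt (ubox V) mu r) -> forall mu x, m0 < mu ->
     continuity_2d_pt (fun mu x => ubox V mu (rad mu x)) mu x).
  { intros V HV mu x Hmu. apply (continuity_2d_pt_comp (ubox V) (fun mu _ => mu) rad); [|apply continuity_2d_pt_id1|auto].
    apply HV. apply Hm0. exact Hmu. }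
  destruct Ubar_continuous as [CU0 [CU1 CU2]].
  assert (radD : forall mu x, 0 < x < 1 -> is_derive (rad mu) x (q mu)).
  { intros mu x Hx. apply (clamp_derive (fun x => ra mu + q mu * x) 0 1 x); [exact Hx|].
    auto_derive; [exact I|]. ring. }
  assert (radI : forall mu x, m0 < mu -> 0 < x < 1 -> 0 < rad mu x < 1 /\ 0 < sqrt (lam mu) * rad mu x < Rstar).
  { intros mu x Hmu Hx. destruct (Hre mu Hmu) as [H1 H2]. destruct (Hstart mu Hmu) as [H3 _].
    pose proof (sqrt_lam_pos mu (Hm0 mu Hmu)) as Hsl.
    assert (ra mu < rad mu x < re mu).
    { unfold rad, q. rewrite clamp_id by lra. split; nra. }
    split; [lra|]. split; [apply Rmult_lt_0_compat; lra|].
    apply Rlt_le_trans with (sqrt (lam mu) * re mu); [apply Rmult_lt_compat_l; lra|exact H2]. }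
  assert (WD : forall mu x, m0 < mu -> 0 < x < 1 ->
     is_derive (W mu) x (q mu * W1 mu x) /\ is_derive (W1 mu) x (q mu * W2 mu x)).
  { intros mu x Hmu Hx. destruct (radI mu x Hmu Hx) as [R1 R2]. pose proof (Hm0 mu Hmu) as Hmu0.
    pose proof (radD mu x Hx) as Dr.
    destruct (psol_derive _ _ _ _ _ _ (hu mu Hmu0) R1) as [D0 [D1 _]].
    destruct (profile_derive mu (rad mu x) Hmu0 ltac:(lra) ltac:(lra)) as [P0 [P1 _]].
    pose proof (is_derive_comp _ _ _ _ _ D0 Dr) as A0. pose proof (is_derive_comp _ _ _ _ _ D1 Dr) as A1.
    pose proof (is_derive_comp _ _ _ _ _ P0 Dr) as B0. pose proof (is_derive_comp _ _ _ _ _ P1 Dr) as B1.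
    unfold W2. rewrite (Hbox u2 mu x Hmu), (HUbox U2 mu x Hmu).
    unfold W1 at 1. rewrite (Hbox u1 mu x Hmu), (HUbox U1 mu x Hmu). split.
    - apply is_derive_ext with (fun x => minus (u mu (rad mu x)) (Ubar (sqrt (lam mu) * rad mu x))).
      + intros t. unfold W. rewrite (Hbox u mu t Hmu), (HUbox Ubar mu t Hmu). reflexivity.
      + match goal with |- is_derive _ _ ?V => replace V with (minus (scal (q mu) (u1 mu (rad mu x)))
          (scal (q mu) (sqrt (lam mu) * U1 (sqrt (lam mu) * rad mu x)))) end.
        * exact (is_derive_minus _ _ _ _ _ A0 B0).
        * unfold minus, plus, opp, scal; simpl. unfold mult; simpl. ring.
    - apply is_derive_ext with (fun x => minus (u1 mu (rad mu x)) (sqrt (lam mu) * U1 (sqrt (lam mu) * rad mu x))).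
      + intros t. unfold W1. rewrite (Hbox u1 mu t Hmu), (HUbox U1 mu t Hmu). reflexivity.
      + match goal with |- is_derive _ _ ?V => replace V with (minus (scal (q mu) (u2 mu (rad mu x)))
          (scal (q mu) (lam mu * U2 (sqrt (lam mu) * rad mu x)))) end.
        * exact (is_derive_minus _ _ _ _ _ A1 B1).
        * unfold minus, plus, opp, scal; simpl. unfold mult; simpl. ring. }
  assert (Wnz : forall mu x, m0 < mu -> 0 < W mu x ^ 2 + W1 mu x ^ 2).
  { intros mu x Hmu. apply Rnot_le_lt. intros Hle.
    pose proof (pow2_ge_0 (W mu x)). pose proof (pow2_ge_0 (W1 mu x)).
    assert (Z0 : W mu x = 0) by nra.
    assert (Z1 : W1 mu x = 0) by nra.
    unfold W in Z0. rewrite (Hbox u mu x Hmu), (HUbox Ubar mu x Hmu) in Z0.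
    unfold W1 in Z1. rewrite (Hbox u1 mu x Hmu), (HUbox U1 mu x Hmu) in Z1.
    destruct (Hrad mu x Hmu) as [R1 R2].
    apply (no_tangency mu (rad mu x) (Hm0 mu Hmu)); lra. }
  (* At the starting radius the profile takes the value (2 mu^p)^(1/p), which exceeds [mu] and hence
     [u mu]. *)
  assert (Wstart : forall mu, m0 < mu -> W mu 0 < 0).
  { intros mu Hmu. pose proof (Hm0 mu Hmu) as Hmu0. unfold W. rewrite (Hbox u mu 0 Hmu), (HUbox Ubar mu 0 Hmu).
    assert (Er : rad mu 0 = ra mu) by (unfold rad; rewrite clamp_id by lra; ring). rewrite Er.
    destruct (Hstart mu Hmu) as [H1 [H2 [_ E]]]. rewrite E.
    assert (Hln : ln tau0 < ln mu) by (apply ln_increasing; [exact htau0|unfold m0 in Hmu; lra]).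
    rewrite Ubar_value.
    - assert (u mu (ra mu) <= u mu 0).
      { apply (psol_nonincr f (lam mu) (u mu) (u1 mu) (u2 mu) (proj1 (proj2 hf)) (hlam mu Hmu0) (hu mu Hmu0)); lra. }
      rewrite hu0 in H by exact Hmu0.
      assert (mu < exp (ln (2 * exp (p * ln mu)) / p)); [|lra].
      rewrite <- (exp_ln mu) at 1 by exact Hmu0. apply exp_increasing.
      rewrite ln_mult by (try apply exp_pos; lra). rewrite ln_exp.
      assert (0 < ln 2) by (rewrite <- ln_1; apply ln_increasing; lra).
      replace ((ln 2 + p * ln mu) / p) with (ln 2 / p + ln mu) by (field; lra).
      assert (0 < ln 2 / p) by (apply Rdiv_lt_0_compat; lra). lra.
    - assert (exp (p * ln tau0) < exp (p * ln mu)) by (apply exp_increasing; nra).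
      pose proof (exp_pos (p * ln mu)). lra. }
  assert (Hzeros : forall M : nat, exists muM, forall mu, muM <= mu -> m0 < mu -> exists zs : nat -> R,
     (forall i, (i < M)%nat -> 0 < zs i < 1 /\ W mu (zs i) = 0) /\
     (forall i, (S i < M)%nat -> zs i < zs (S i))).
  (* Crossings are sought in the windows from (2 i + 1) T to (2 i + 2) T after the start. These are
     disjoint, and the threshold on mu keeps s >= S1 in all of them, since s is at least mu at the
     start. *)
  { intros M. exists (S1 * exp (2 * INR (S M) * T)). intros mu Hmu1 Hmu.
    pose proof (Hm0 mu Hmu) as Hmu0.
    assert (Hmus : mb <= u mu 0) by (rewrite hu0 by exact Hmu0; unfold m0 in Hmu; lra).
    destruct (HF (lam mu) (u mu) (u1 mu) (u2 mu) (hlam mu Hmu0) (hu mu Hmu0) Hmus) as [Hs [HPb HFb]].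
    rewrite hu0 in HPb, HFb by exact Hmu0. set (a := start p mu) in *.
    assert (Ha : mu <= exp (- a)).
    { unfold a. rewrite start_time. pose proof (exp_p_ln_ge p mu ltac:(lra) ltac:(unfold m0 in Hmu; lra)). lra. }
    assert (Htime : forall i, (i < M)%nat -> S1 <= exp (- (a + (2 * INR i + 1) * T + T))).
    { intros i Hi. assert (INR i + 1 <= INR M) by (rewrite <- S_INR; apply le_INR; lia).
      assert (Hi2 : (2 * INR i + 1) * T + T <= 2 * INR (S M) * T).
      { rewrite S_INR. nra. }
      replace (- (a + (2 * INR i + 1) * T + T)) with (- a + - ((2 * INR i + 1) * T + T)) by ring.
      rewrite exp_plus.
      apply Rle_trans with (exp (- a) * exp (- (2 * INR (S M) * T))).
      - apply Rmult_le_reg_r with (exp (2 * INR (S M) * T)); [apply exp_pos|].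
        rewrite (Rmult_assoc (exp (- a))), <- (exp_plus (- (2 * INR (S M) * T))).
        replace (- (2 * INR (S M) * T) + 2 * INR (S M) * T) with 0 by ring.
        rewrite exp_0. lra.
      - apply Rmult_le_compat_l; [left; apply exp_pos|]. apply exp_le. lra. }
    assert (Hex : forall i : nat, exists xi, (i < M)%nat ->
       a + (2 * INR i + 1) * T <= xi <= a + (2 * INR i + 1) * T + T /\ Xf (lam mu) (u mu) p xi = 1).
    { intros i. destruct (Compare_dec.le_lt_dec M i) as [Hi|Hi].
      - exists 0. intros; lia.
      - destruct (HFb (a + (2 * INR i + 1) * T)) as [xi Hxi].
        + pose proof (pos_INR i). nra.
        + apply Htime. exact Hi.
        + exists xi. intros _. exact Hxi. }
    assert (Hz : exists xis : nat -> R, forall i, (i < M)%nat ->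
       a + (2 * INR i + 1) * T <= xis i <= a + (2 * INR i + 1) * T + T /\ Xf (lam mu) (u mu) p (xis i) = 1).
    { exists (fun i => proj1_sig (constructive_indefinite_description _ (Hex i))).
      intros i. exact (proj2_sig (constructive_indefinite_description _ (Hex i))). }
    destruct Hz as [xis Hxis].
    destruct (Hre mu Hmu) as [Hre1 Hre2].
    assert (Hq : 0 < q mu) by (unfold q; lra).
    pose proof (sqrt_lam_pos mu Hmu0) as Hsl.
    exists (fun i => (rr (lam mu) (xis i) - ra mu) / q mu). split.
    - intros i Hi. destruct (Hxis i Hi) as [Hx EX].
      pose proof (pos_INR i) as Hi0.
      assert (Hax : a < xis i) by nra.
      assert (HS : S1 <= exp (- xis i)).
      { eapply Rle_trans; [apply (Htime i Hi)|]. apply exp_le. lra. }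
      assert (Hr1 : ra mu < rr (lam mu) (xis i)) by (apply rr_strict; [apply hlam; exact Hmu0|exact Hax]).
      assert (Eslr : sqrt (lam mu) * rr (lam mu) (xis i) = exp (- (exp (- xis i) / 2))) by (unfold rr; field; lra).
      assert (Hu1 : 0 < u mu (rr (lam mu) (xis i)) /\ u mu (rr (lam mu) (xis i)) = exp (ln (exp (- xis i)) / p)).
      { unfold Xf in EX. rewrite ln_exp. replace (- xis i / p) with (- (xis i / p)) by (field; lra).
        rewrite exp_Ropp. pose proof (exp_pos (xis i / p)) as He.
        assert (E : u mu (rr (lam mu) (xis i)) = / exp (xis i / p)).
        { apply Rmult_eq_reg_l with (exp (xis i / p)); [|lra]. rewrite EX. field. lra. }
        split; [|exact E]. rewrite E. apply Rinv_0_lt_compat. exact He. }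
      assert (Hr2 : rr (lam mu) (xis i) < re mu).
      { apply Rmin_glb_lt.
        - apply (HPb (xis i)); lra.
        - apply Rmult_lt_reg_l with (sqrt (lam mu)); [exact Hsl|]. rewrite Eslr.
          replace (sqrt (lam mu) * (Rstar / sqrt (lam mu))) with Rstar by (field; lra).
          eapply Rle_lt_trans; [|exact HRg]. apply exp_le. lra. }
      split.
      + split; [apply Rdiv_lt_0_compat; lra|]. apply Rmult_lt_reg_r with (q mu); [exact Hq|].
        unfold Rdiv. rewrite Rmult_assoc, Rinv_l by lra. unfold q. lra.
      + set (x := (rr (lam mu) (xis i) - ra mu) / q mu).
        assert (Hx1 : 0 < x < 1).
        { split; [apply Rdiv_lt_0_compat; lra|]. apply Rmult_lt_reg_r with (q mu); [exact Hq|].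
          unfold x, Rdiv. rewrite Rmult_assoc, Rinv_l by lra. unfold q. lra. }
        assert (Er : rad mu x = rr (lam mu) (xis i)).
        { unfold rad. rewrite clamp_id by lra. unfold x. field. lra. }
        unfold W. rewrite (Hbox u mu x Hmu), (HUbox Ubar mu x Hmu), Er, Eslr, Ubar_value by lra.
        rewrite (proj2 Hu1). ring.
    - intros i Hi. destruct (Hxis i ltac:(lia)) as [Hx _]. destruct (Hxis (S i) Hi) as [Hx' _].
      rewrite S_INR in Hx'. apply Rmult_lt_compat_r; [apply Rinv_0_lt_compat; exact Hq|].
      apply Rplus_lt_compat_r. apply rr_strict; [apply hlam; exact Hmu0|]. lra. }
  intros N.
  destruct (oscillation_of_zeros W W1 W2 q m0) with (N := N) as [[m1 [A1 [A2 A3]]] [m2 [B1 [B2 B3]]]].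
  - intros mu Hmu. unfold q. destruct (Hre mu Hmu). lra.
  - exact Cq2.
  - intros mu x Hmu. apply continuity_2d_pt_minus; [|apply CU; assumption].
    apply Cu; [|exact Hmu]. intros; apply curve_continuous; assumption.
  - intros mu x Hmu. apply continuity_2d_pt_minus.
    + apply Cu; [|exact Hmu]. intros; apply curve_continuous; assumption.
    + apply continuity_2d_pt_mult; [apply continuity_2d_pt_of_continuous; auto|apply CU; assumption].
  - intros mu x Hmu. apply continuity_2d_pt_minus.
    + apply Cu; [|exact Hmu]. intros; apply curve_continuous; assumption.
    + apply continuity_2d_pt_mult; [apply continuity_2d_pt_of_continuous; auto|apply CU; assumption].
  - exact WD.
  - exact Wnz.
  - exact Wstart.
  - exact Hzeros.
  - assert (Wend : forall mu, m0 < mu -> W mu 1 = u mu (re mu) - Ubar (sqrt (lam mu) * re mu)).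
    { intros mu Hmu. unfold W. rewrite (Hbox u mu 1 Hmu), (HUbox Ubar mu 1 Hmu).
      assert (Er : rad mu 1 = re mu) by (unfold rad; rewrite clamp_id by lra; unfold q; ring).
      rewrite Er. reflexivity. }
    split.
    + exists m1. pose proof (Hm0 m1 A2) as Hm1. split; [exact A1|]. split; [exact Hm1|].
      rewrite Wend in A3 by exact A2. pose proof (sqrt_lam_pos m1 Hm1) as Hsl.
      (* Were the parameter at most Rstar^2, the endpoint would be r = 1, where [u] vanishes and the
         profile is nonnegative. The other sign exchanges the two roles. *)
      rewrite <- (sqrt_lam_sq m1 Hm1). destruct (Rle_lt_dec (sqrt (lam m1)) Rstar) as [L|L]; [exfalso|nra].
      assert (Er : re m1 = 1).
      { apply Rmin_left. apply Rmult_le_reg_r with (sqrt (lam m1)); [exact Hsl|].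
        unfold Rdiv. rewrite Rmult_assoc, Rinv_l by lra. lra. }
      rewrite Er in A3. destruct (hu m1 Hm1) as [_ [_ [_ E1]]]. rewrite E1 in A3.
      pose proof (Ubar_nonneg (sqrt (lam m1) * 1) ltac:(lra)). lra.
    + exists m2. pose proof (Hm0 m2 B2) as Hm2. split; [exact B1|]. split; [exact Hm2|].
      rewrite Wend in B3 by exact B2. pose proof (sqrt_lam_pos m2 Hm2) as Hsl.
      rewrite <- (sqrt_lam_sq m2 Hm2). destruct (Rle_lt_dec Rstar (sqrt (lam m2))) as [L|L]; [exfalso|nra].
      assert (Er : sqrt (lam m2) * re m2 = Rstar).
      { assert (Er : re m2 = Rstar / sqrt (lam m2)); [|rewrite Er; field; lra].
        apply Rmin_right. apply Rmult_le_reg_r with (sqrt (lam m2)); [exact Hsl|].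
        unfold Rdiv. rewrite Rmult_assoc, Rinv_l by lra. lra. }
      rewrite Er in B3. destruct hsing as [_ [_ [_ [_ [_ E]]]]]. rewrite E in B3.
      destruct (Hre m2 B2) as [R1 _]. destruct (Hstart m2 B2) as [R2 _].
      pose proof (psol_nonneg f (lam m2) (re m2) _ _ _ (hu m2 Hm2) ltac:(lra)). lra.
Qed.

End Curve.

(** * Bounds at the boundary and compactness *)

Lemma pot_crossing (p xi : R) (X : R -> R) : X xi = 1 -> pot p X xi = 0.
Proof. intros E. unfold pot, height. rewrite E, ln_1, Rmult_0_r, Rplus_0_r. ring. Qed.

(** The crossing is taken in the window where s runs from [C = S1 * exp T] down to [S1], so s is
    bounded independently of mu. Negative energy at X = 1 gives X'^2 <= kap / p < 1, hence X' >= -1,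
    and undoing the change of variables turns this into the flux bound 4. Finally r < 1 and l r^2 =
    exp (- s) bound [l] from below. *)
Lemma crossing_bounds (p tau0 : R) (f : R -> R) :
  2 < p -> 0 < tau0 -> nonlinearity p tau0 f -> exists C mu0, 0 < C /\ 1 < mu0 /\
  forall l v v1 v2, 0 < l -> psol f l v v1 v2 -> mu0 <= v 0 ->
    exists r, 0 < r < 1 /\ 0 <= v r <= C /\ - (r * v1 r) <= 4 /\ exp (- C) <= l.
Proof.
  intros hp ht hf. pose proof (kap_bounds p hp) as Hk. pose proof (e0_pos p hp) as He.
  destruct (frequent_crossings p tau0 f hp ht hf) as [S1 [T [mb [HS1 [HS1' [HT [Hmb HF]]]]]]].
  set (c := - ln S1 - T). set (C := exp (- c)).
  assert (HC : S1 <= C).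
  { unfold C, c. rewrite <- (exp_ln S1) at 1 by lra. apply exp_le. lra. }
  exists C, (mb + C). split; [lra|]. split; [lra|].
  intros l v v1 v2 hl Hs Hmu.
  destruct (HF l v v1 v2 hl Hs ltac:(lra)) as [Hst [HPb HFb]].
  assert (Hc : start p (v 0) <= c).
  { apply Ropp_le_cancel. apply Rnot_lt_le. intros Hlt.
    assert (Hlt2 : exp (- start p (v 0)) < C) by (apply exp_increasing; exact Hlt).
    rewrite start_time in Hlt2. pose proof (exp_p_ln_ge p (v 0) ltac:(lra) ltac:(lra)). lra. }
  assert (HcT : exp (- (c + T)) = S1).
  { unfold c. replace (- (- ln S1 - T + T)) with (ln S1) by ring. apply exp_ln. lra. }
  destruct (HFb c Hc ltac:(lra)) as [xi [Hxi EX]].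
  assert (Hxs : S1 <= exp (- xi) <= C).
  { split; [rewrite <- HcT|unfold C]; apply exp_le; lra. }
  destruct (HPb xi ltac:(lra) ltac:(lra)) as [Hr1 [HV [HTr HE]]].
  destruct (HE xi ltac:(lra)) as [HEn _].
  pose proof (rr_pos l hl xi) as Hr0.
  exists (rr l xi). split; [lra|].
  assert (Hxi0 : xi < 0).
  { apply Rnot_le_lt. intros Hge. assert (exp (- xi) <= exp 0) by (apply exp_le; lra).
    rewrite exp_0 in H. lra. }
  assert (EV : v (rr l xi) = exp (- (xi / p))).
  { unfold Xf in EX. rewrite exp_Ropp. pose proof (exp_pos (xi / p)).
    apply Rmult_eq_reg_l with (exp (xi / p)); [|lra]. rewrite EX. field. lra. }
  assert (Hxp : - (xi / p) <= - xi).
  { apply Rmult_le_reg_r with p; [lra|]. replace (- (xi / p) * p) with (- xi) by (field; lra). nra. }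
  assert (HVC : exp (- (xi / p)) <= exp (- xi)) by (apply exp_le; exact Hxp).
  split; [rewrite EV; split; [left; apply exp_pos|lra]|]. split.
  - unfold energy in HEn. rewrite pot_crossing in HEn by exact EX. rewrite EX in HEn.
    assert (Hkp : kap p / (2 * p) <= 1 / 2).
    { apply Rmult_le_reg_r with (2 * p); [lra|]. replace (kap p / (2 * p) * (2 * p)) with (kap p) by (field; lra). lra. }
    set (x1 := Xf1 l v v1 p xi) in *.
    assert (Hx1 : - x1 <= 1) by nra.
    assert (Ex1 : x1 = 1 / p + exp (xi / p) * (rr l xi * v1 (rr l xi)) * exp (- xi) / 2).
    { unfold x1, Xf1. rewrite EX. reflexivity. }
    set (B := rr l xi * v1 (rr l xi)) in *. set (s := exp (- xi)) in *.
    assert (H1p : 1 / p <= 1) by nra.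
    rewrite exp_Ropp in HVC. pose proof (exp_pos (xi / p)) as Hep.
    assert (Hge : 1 <= exp (xi / p) * s).
    { apply Rmult_le_compat_l with (r := exp (xi / p)) in HVC; [|lra].
      rewrite Rinv_r in HVC by lra. exact HVC. }
    destruct (Rle_lt_dec 0 (- B)); [|lra]. nra.
  - pose proof (rr_sq l hl xi) as E.
    apply Rle_trans with (exp (- exp (- xi))); [apply exp_le; lra|]. rewrite <- E.
    assert (rr l xi ^ 2 <= 1) by nra. nra.
Qed.

(** From the crossing to r = 1 the values of [v] stay in [[0, C]], so the flux changes by at most
    [l * M]. *)
Lemma end_slope_bound (p tau0 Lam : R) (f : R -> R) :
  2 < p -> 0 < tau0 -> nonlinearity p tau0 f -> exists beta mu0, 0 < beta /\ 1 < mu0 /\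
  forall l v v1 v2, 0 < l <= Lam -> psol f l v v1 v2 -> mu0 <= v 0 -> - v1 1 <= beta.
Proof.
  intros hp ht hf. destruct (crossing_bounds p tau0 f hp ht hf) as [C [mu0 [HC [Hmu0 H]]]].
  assert (Hc : continuous_on_set (Icc 0 C) f).
  { apply continuous_on_set_sub with (2 := nonlinearity_continuous _ _ _ hf).
    unfold Icc, Ici; intros; lra. }
  assert (fpos : forall t, 0 <= t -> 0 <= f t) by apply hf.
  destruct (continuous_on_bounded f 0 C ltac:(lra) Hc) as [M [HM0 HM]].
  exists (5 + Rabs Lam * M), mu0. split; [pose proof (Rabs_pos Lam); nra|]. split; [exact Hmu0|].
  intros l v v1 v2 hl Hs Hmu. destruct (H l v v1 v2 (proj1 hl) Hs Hmu) as [r [Hr [Hv [HB _]]]].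
  assert (HI : r * v1 r + l * M * r <= 1 * v1 1 + l * M * 1).
  { apply (nondecr_on (fun r => r * v1 r + l * M * r) (fun r => - (r * (l * f (v r))) + l * M)); [lra| |].
    - apply continuous_on_set_plus.
      + apply continuous_on_set_sub with (2 := flux_continuous f l v v1 v2 Hs). unfold Icc; intros; lra.
      + apply continuous_on_set_of_ex_derive. intros x. auto_derive. exact I.
    - intros x Hx. split.
      + apply (@is_derive_plus R_AbsRing R_NormedModule); [apply flux_derive with v2; [exact Hs|lra]|].
        auto_derive; [exact I|]. ring.
      + assert (Hvx : 0 <= v x <= C).
        { split; [apply (psol_nonneg f l x v v1 v2 Hs); lra|].
          apply Rle_trans with (v r); [|lra]. apply (psol_nonincr f l v v1 v2 fpos (proj1 hl) Hs); lra. }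
        specialize (HM (v x) Hvx). pose proof (Rle_abs (f (v x))). pose proof (fpos (v x) (proj1 Hvx)).
        assert (x * (l * f (v x)) <= l * M).
        { replace (l * M) with (1 * (l * M)) by ring. apply Rmult_le_compat; try lra.
          - apply Rmult_le_pos; lra.
          - apply Rmult_le_compat_l; lra. }
        lra. }
  assert (l * M <= Rabs Lam * M) by (apply Rmult_le_compat_r; [lra|]; pose proof (Rle_abs Lam); lra).
  assert (0 <= l * M * r) by (repeat apply Rmult_le_pos; lra). lra.
Qed.

Lemma lim_seq_Rabs_bound (x d : nat -> R) (y e C xn dn : R) :
  (forall m, Rabs (xn - x m) <= C * Rabs (dn - d m)) ->
  is_lim_seq x y -> is_lim_seq d e -> Rabs (xn - y) <= C * Rabs (dn - e).
Proof.
  intros H Hx Hd.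
  assert (A : is_lim_seq (fun m => Rabs (xn - x m)) (Rabs (xn - y))).
  { apply (is_lim_seq_abs _ (xn - y)). apply is_lim_seq_minus'; [apply is_lim_seq_const|exact Hx]. }
  assert (B : is_lim_seq (fun m => C * Rabs (dn - d m)) (C * Rabs (dn - e))).
  { apply (is_lim_seq_scal_l _ C (Rabs (dn - e))). apply (is_lim_seq_abs _ (dn - e)).
    apply is_lim_seq_minus'; [apply is_lim_seq_const|exact Hd]. }
  exact (is_lim_seq_le _ _ (Rabs (xn - y)) (C * Rabs (dn - e)) H A B).
Qed.

Lemma taylor_quadratic (v v1 : R -> R) (a b M : R) :
  continuous_on_set (Icc a b) v -> (forall x, a < x < b -> is_derive v x (v1 x)) ->
  (forall x y, a <= x <= b -> a <= y <= b -> Rabs (v1 y - v1 x) <= M * Rabs (y - x)) ->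
  forall x y, a <= x <= b -> a <= y <= b -> Rabs (v y - v x - (y - x) * v1 x) <= M * (y - x) ^ 2.
Proof.
  intros Hc Hd HL x y Hx Hy.
  assert (HM : forall c, Rabs (c - x) <= Rabs (y - x) -> a <= c <= b -> v y - v x = v1 c * (y - x) ->
     Rabs (v y - v x - (y - x) * v1 x) <= M * (y - x) ^ 2).
  { intros c Hcx Hcab E. rewrite E. replace (v1 c * (y - x) - (y - x) * v1 x) with ((v1 c - v1 x) * (y - x)) by ring.
    rewrite Rabs_mult. pose proof (HL x c Hx Hcab) as HLc. rewrite <- (pow2_abs (y - x)).
    pose proof (Rabs_pos (c - x)) as Pc. pose proof (Rabs_pos (v1 c - v1 x)) as Pv.
    destruct (Rle_lt_dec 0 M) as [HM|HM].
    - assert (M * Rabs (c - x) <= M * Rabs (y - x)) by nra. nra.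
    - destruct (Req_dec (Rabs (c - x)) 0) as [e|e].
      + destruct (Req_dec (Rabs (y - x)) 0) as [e'|e']; [rewrite e'; lra|].
        assert (Hyx : M * Rabs (y - x) < 0) by nra.
        pose proof (HL x y Hx Hy). pose proof (Rabs_pos (v1 y - v1 x)). lra.
      + assert (M * Rabs (c - x) < 0) by nra. lra. }
  destruct (Rtotal_order x y) as [L|[L|L]].
  - destruct (MVT_on v v1 x y L) as [c [Hcc E]].
    + apply continuous_on_set_sub with (2 := Hc). unfold Icc; intros; lra.
    + intros z Hz. apply Hd. lra.
    + apply (HM c); [rewrite !Rabs_right by lra; lra|lra|exact E].
  - subst. apply (HM y); [lra|lra|ring].
  - destruct (MVT_on v v1 y x L) as [c [Hcc E]].
    + apply continuous_on_set_sub with (2 := Hc). unfold Icc; intros; lra.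
    + intros z Hz. apply Hd. lra.
    + apply (HM c); [rewrite !Rabs_left by lra; lra|lra|]. lra.
Qed.

(** * Limits of solutions sharing one parameter and a bounded end slope *)

Section Compactness.

Variables (p tau0 l beta dinf : R) (f : R -> R) (v v1 v2 : nat -> R -> R).
Hypothesis hf : nonlinearity p tau0 f.
Hypothesis hl : 0 < l.
Hypothesis hbeta : 0 < beta.
Hypothesis hs : forall n, psol f l (v n) (v1 n) (v2 n).
Hypothesis hb : forall n, - v1 n 1 <= beta.
Hypothesis hd : is_lim_seq (fun n => v1 n 1) dinf.

Let fpos (t : R) : 0 <= t -> 0 <= f t.
Proof. apply hf. Qed.

Lemma uniform_slope (n : nat) (r : R) : 0 < r <= 1 -> Rabs (v1 n r) <= beta / r.
Proof.
  intros Hr. pose proof (psol_v1_nonpos f l (v n) (v1 n) (v2 n) fpos hl (hs n) r ltac:(lra)).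
  pose proof (flux_nonincr f l (v n) (v1 n) (v2 n) fpos hl (hs n) r 1 ltac:(lra) ltac:(lra) ltac:(lra)) as HF.
  specialize (hb n). rewrite Rabs_left1 by lra. apply Rmult_le_reg_r with r; [lra|].
  replace (beta / r * r) with beta by (field; lra). lra.
Qed.

Lemma uniform_value (n : nat) (r : R) : 0 < r <= 1 -> 0 <= v n r <= - beta * ln r.
Proof.
  intros Hr. split; [apply (psol_nonneg f l r _ _ _ (hs n) Hr)|].
  assert (H : v n r + beta * ln r <= v n 1 + beta * ln 1).
  { apply (nondecr_on (fun r => v n r + beta * ln r) (fun r => v1 n r + beta / r)); [lra| |].
    - apply continuous_on_set_plus.
      + apply continuous_on_set_sub with (2 := proj1 (psol_continuous _ _ _ _ _ (hs n))). unfold Icc; intros; lra.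
      + apply continuous_on_of_continuous. intros x [Hx _].
        apply (@ex_derive_continuous R_AbsRing R_NormedModule). auto_derive. lra.
    - intros x Hx. split.
      + apply (@is_derive_plus R_AbsRing R_NormedModule); [apply (psol_derive _ _ _ _ _ _ (hs n)); lra|].
        auto_derive; [lra|]. field. lra.
      + pose proof (uniform_slope n x ltac:(lra)) as HS. pose proof (Rle_abs (- v1 n x)) as HA.
        rewrite Rabs_Ropp in HA. lra. }
  rewrite ln_1 in H. destruct (hs n) as [_ [_ [_ E]]]. lra.
Qed.

(** The equation is assumed inside the interval only; continuity of [v2 n] carries it to r = 1. *)
Lemma second_derivative_eq (n : nat) (r : R) : 0 < r <= 1 -> v2 n r = - / r * v1 n r - l * f (v n r).
Proof.
  intros Hr. destruct (Req_dec r 1) as [E|E].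
  2:{ apply (psol_derive _ _ _ _ _ _ (hs n)). lra. }
  destruct (hs n) as [[D0 [D1 C2]] _].
  assert (Hsub : forall x, Icc (1 / 2) 1 x -> Icc 0 1 x) by (unfold Icc; intros; lra).
  apply (eq_on_closure (v2 n) (fun r => - / r * v1 n r - l * f (v n r)) (1 / 2) 1); [lra| | | |lra].
  - exact (continuous_on_set_sub _ _ _ Hsub C2).
  - destruct (psol_continuous _ _ _ _ _ (hs n)) as [Cv C1].
    apply continuous_on_set_minus.
    + apply continuous_on_set_mult; [|exact (continuous_on_set_sub _ _ _ Hsub C1)].
      apply continuous_on_of_continuous. intros x [Hx _].
      apply (@ex_derive_continuous R_AbsRing R_NormedModule). auto_derive. lra.
    + apply continuous_on_set_mult; [apply continuous_on_set_const|].
      apply continuous_on_set_comp with (Ici 0); [|exact (continuous_on_set_sub _ _ _ Hsub Cv)|exact (nonlinearity_continuous _ _ _ hf)].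
      intros x [Hx Hx1]. apply (psol_nonneg f l x _ _ _ (hs n)). lra.
  - intros x Hx. apply (psol_derive _ _ _ _ _ _ (hs n)). lra.
Qed.

(** All [v n] solve the same equation and vanish at r = 1, so on [[a, 1]] they are determined by the
    single number [v1 n 1], and [ode_stability] makes them Lipschitz in it. [M] and [M3] are common
    Lipschitz constants of [v1 n] and [v2 n], used to pass Taylor remainders to the limit. *)
Lemma uniform_constants (a : R) : 0 < a < 1 -> exists B L C M M3, 0 < B /\ 0 < L /\ 0 < C /\
  (forall s t, 0 <= s <= B -> 0 <= t <= B -> Rabs (f s - f t) <= L * Rabs (s - t)) /\
  (forall n r, a <= r <= 1 -> 0 <= v n r <= B) /\
  (forall n m r, a <= r <= 1 -> Rabs (v n r - v m r) <= C * Rabs (v1 n 1 - v1 m 1) /\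
     Rabs (v1 n r - v1 m r) <= C * Rabs (v1 n 1 - v1 m 1)) /\
  (forall n x y, a <= x <= 1 -> a <= y <= 1 -> Rabs (v1 n y - v1 n x) <= M * Rabs (y - x)) /\
  (forall n x y, a <= x <= 1 -> a <= y <= 1 -> Rabs (v2 n y - v2 n x) <= M3 * Rabs (y - x)).
Proof.
  intros Ha. set (B := - beta * ln a).
  assert (HB : 0 < B).
  { unfold B. assert (ln a < 0) by (rewrite <- ln_1; apply ln_increasing; lra). nra. }
  assert (HvB : forall n r, a <= r <= 1 -> 0 <= v n r <= B).
  { intros n r Hr. destruct (uniform_value n r ltac:(lra)) as [H1 H2]. split; [exact H1|].
    eapply Rle_trans; [exact H2|]. unfold B.
    assert (ln a <= ln r) by (apply ln_le; lra).
    assert (beta * ln a <= beta * ln r) by nra. lra. }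
  destruct (nonlinearity_lipschitz p tau0 B f hf HB) as [L [HL0 HL]].
  assert (Hc : continuous_on_set (Icc 0 B) f).
  { apply continuous_on_set_sub with (2 := nonlinearity_continuous _ _ _ hf). unfold Icc, Ici; intros; lra. }
  destruct (continuous_on_bounded f 0 B ltac:(lra) Hc) as [Mf [HMf0 HMf]].
  set (C := exp (1 + 2 / a + l * L)).
  assert (HC1 : 1 <= C).
  { unfold C. rewrite <- exp_0 at 1. apply exp_le. assert (0 < 2 / a) by (apply Rdiv_lt_0_compat; lra).
    assert (0 <= l * L) by (apply Rmult_le_pos; lra). lra. }
  set (M := beta / a / a + l * Mf).
  set (M3 := M / a + beta / a / (a * a) + l * (L * (beta / a))).
  assert (Hba : 0 < beta / a) by (apply Rdiv_lt_0_compat; lra).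
  assert (Hinv : forall r, a <= r <= 1 -> 0 < / r <= / a).
  { intros r Hr. split; [apply Rinv_0_lt_compat; lra|apply Rinv_le_contravar; lra]. }
  assert (Hslope : forall n r, a <= r <= 1 -> Rabs (v1 n r) <= beta / a).
  { intros n r Hr. eapply Rle_trans; [apply uniform_slope; lra|].
    apply Rmult_le_compat_l; [lra|]. apply Hinv. exact Hr. }
  assert (H2 : forall n r, a <= r <= 1 -> Rabs (v2 n r) <= M).
  { intros n r Hr. rewrite second_derivative_eq by lra. unfold Rminus.
    eapply Rle_trans; [apply Rabs_triang|]. rewrite Rabs_Ropp, !Rabs_mult, Rabs_Ropp.
    destruct (Hinv r Hr). rewrite (Rabs_right (/ r)) by lra. rewrite (Rabs_right l) by lra.
    unfold M. apply Rplus_le_compat.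
    - unfold Rdiv at 1. rewrite Rmult_comm. apply Rmult_le_compat; try lra; [apply Rabs_pos|]. apply Hslope; exact Hr.
    - apply Rmult_le_compat_l; [lra|]. apply HMf. apply HvB. exact Hr. }
  assert (lip : forall (g g1 : R -> R) K, continuous_on_set (Icc a 1) g -> (forall x, a < x < 1 -> is_derive g x (g1 x)) ->
     (forall x, a <= x <= 1 -> Rabs (g1 x) <= K) ->
     forall x y, a <= x <= 1 -> a <= y <= 1 -> Rabs (g y - g x) <= K * Rabs (y - x)).
  { intros g g1 K Cg Dg Hg.
    assert (lt_case : forall x y, a <= x -> x < y -> y <= 1 -> Rabs (g y - g x) <= K * Rabs (y - x)).
    { intros x y H1 H3 H4. destruct (MVT_on g g1 x y H3) as [c [Hcc E]].
      - apply continuous_on_set_sub with (2 := Cg). unfold Icc; intros; lra.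
      - intros z Hz. apply Dg. lra.
      - rewrite E, Rabs_mult. apply Rmult_le_compat_r; [apply Rabs_pos|]. apply Hg. lra. }
    intros x y Hx Hy. destruct (Rtotal_order x y) as [h|[h|h]].
    - apply lt_case; lra.
    - subst. rewrite !Rminus_eq_0, Rabs_R0. lra.
    - rewrite Rabs_minus_sym, (Rabs_minus_sym y x). apply lt_case; lra. }
  assert (Hsub : forall x, Icc a 1 x -> Icc 0 1 x) by (unfold Icc; intros; lra).
  assert (Cv : forall n, continuous_on_set (Icc a 1) (v n)).
  { intros n. apply continuous_on_set_sub with (1 := Hsub). apply (psol_continuous _ _ _ _ _ (hs n)). }
  assert (Cv1 : forall n, continuous_on_set (Icc a 1) (v1 n)).
  { intros n. apply continuous_on_set_sub with (1 := Hsub). apply (psol_continuous _ _ _ _ _ (hs n)). }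
  assert (HM : forall n x y, a <= x <= 1 -> a <= y <= 1 -> Rabs (v1 n y - v1 n x) <= M * Rabs (y - x)).
  { intros n. apply (lip (v1 n) (v2 n) M (Cv1 n)); [|apply H2].
    intros x Hx. apply (psol_derive _ _ _ _ _ _ (hs n)). lra. }
  assert (Hv : forall n x y, a <= x <= 1 -> a <= y <= 1 -> Rabs (v n y - v n x) <= beta / a * Rabs (y - x)).
  { intros n. apply (lip (v n) (v1 n) (beta / a) (Cv n)); [|apply Hslope].
    intros x Hx. apply (psol_derive _ _ _ _ _ _ (hs n)). lra. }
  exists B, L, C, M, M3. split; [exact HB|]. split; [exact HL0|]. split; [lra|]. split; [exact HL|].
  split; [exact HvB|]. split; [|split; [exact HM|]].
  - intros n m r Hr.
    assert (ST : (v n r - v m r) ^ 2 + (v1 n r - v1 m r) ^ 2 <= (C * Rabs (v1 n 1 - v1 m 1)) ^ 2).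
    { assert (Hsubr : forall x, Icc r 1 x -> Icc a 1 x) by (unfold Icc; intros; lra).
      eapply Rle_trans; [apply (ode_stability f (v n) (v1 n) (v2 n) (v m) (v1 m) (v2 m) l L B r 1); try lra; try exact HL;
        try (apply continuous_on_set_sub with (1 := Hsubr); auto)|].
      - intros x Hx. destruct (psol_derive _ _ x _ _ _ (hs n) ltac:(lra)) as [D0 [D1 [E _]]].
        split; [exact D0|]. split; [exact D1|]. split; [exact E|]. apply HvB. lra.
      - intros x Hx. destruct (psol_derive _ _ x _ _ _ (hs m) ltac:(lra)) as [D0 [D1 [E _]]].
        split; [exact D0|]. split; [exact D1|]. split; [exact E|]. apply HvB. lra.
      - destruct (hs n) as [_ [_ [_ En]]]. destruct (hs m) as [_ [_ [_ Em]]]. rewrite En, Em.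
        rewrite Rpow_mult_distr, pow2_abs.
        replace ((0 - 0) ^ 2 + (v1 n 1 - v1 m 1) ^ 2) with ((v1 n 1 - v1 m 1) ^ 2) by ring.
        rewrite Rmult_comm. apply Rmult_le_compat_r; [apply pow2_ge_0|].
        apply Rle_trans with C; [|simpl; nra]. unfold C. apply exp_le.
        assert (Hr1 : 0 <= 1 - r <= 1) by lra. destruct (Hinv r Hr) as [I1 I2].
        assert (2 / r <= 2 / a) by (unfold Rdiv; lra).
        assert (0 < 2 / r) by (unfold Rdiv; lra).
        assert (0 <= l * L) by (apply Rmult_le_pos; lra). nra. }
    assert (HCd : 0 <= C * Rabs (v1 n 1 - v1 m 1)) by (apply Rmult_le_pos; [lra|apply Rabs_pos]).
    pose proof (pow2_ge_0 (v n r - v m r)). pose proof (pow2_ge_0 (v1 n r - v1 m r)).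
    split.
    + apply Rnot_lt_le. intros Hlt. rewrite <- (pow2_abs (v n r - v m r)) in ST. nra.
    + apply Rnot_lt_le. intros Hlt. rewrite <- (pow2_abs (v1 n r - v1 m r)) in ST. nra.
  - intros n x y Hx Hy. rewrite !second_derivative_eq by lra.
    replace (- / y * v1 n y - l * f (v n y) - (- / x * v1 n x - l * f (v n x)))
      with (- / y * (v1 n y - v1 n x) + (/ x * / y * (y - x) * v1 n x + - l * (f (v n y) - f (v n x))))
      by (field; lra).
    destruct (Hinv x Hx) as [X1 X2]. destruct (Hinv y Hy) as [Y1 Y2].
    pose proof (Rabs_pos (y - x)) as Hyx.
    assert (T1 : Rabs (- / y * (v1 n y - v1 n x)) <= M / a * Rabs (y - x)).
    { rewrite Rabs_mult, Rabs_Ropp, (Rabs_right (/ y)) by lra. specialize (HM n x y Hx Hy).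
      replace (M / a * Rabs (y - x)) with (/ a * (M * Rabs (y - x))) by (unfold Rdiv; ring).
      apply Rmult_le_compat; try lra. apply Rabs_pos. }
    assert (T2 : Rabs (/ x * / y * (y - x) * v1 n x) <= beta / a / (a * a) * Rabs (y - x)).
    { rewrite !Rabs_mult, (Rabs_right (/ x)), (Rabs_right (/ y)) by lra.
      replace (beta / a / (a * a) * Rabs (y - x)) with (/ a * / a * Rabs (y - x) * (beta / a)) by (field; lra).
      apply Rmult_le_compat; [|apply Rabs_pos| |apply Hslope; exact Hx].
      - repeat apply Rmult_le_pos; lra.
      - apply Rmult_le_compat_r; [lra|]. apply Rmult_le_compat; lra. }
    assert (T3 : Rabs (- l * (f (v n y) - f (v n x))) <= l * (L * (beta / a)) * Rabs (y - x)).
    { rewrite Rabs_mult, Rabs_Ropp, (Rabs_right l), !Rmult_assoc by lra. apply Rmult_le_compat_l; [lra|].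
      eapply Rle_trans; [apply HL; apply HvB; assumption|]. apply Rmult_le_compat_l; [lra|]. apply Hv; assumption. }
    eapply Rle_trans; [apply Rabs_triang|]. unfold M3. rewrite !Rmult_plus_distr_r, Rplus_assoc.
    apply Rplus_le_compat; [exact T1|]. eapply Rle_trans; [apply Rabs_triang|]. apply Rplus_le_compat; assumption.
Qed.

Let us (r : R) : R := Lim_seq (fun n => v n r).
Let us1 (r : R) : R := Lim_seq (fun n => v1 n r).
Let us2 (r : R) : R := - / r * us1 r - l * f (us r).

Lemma cauchy_transfer (x : nat -> R) (C : R) :
  0 < C -> (forall n m, Rabs (x n - x m) <= C * Rabs (v1 n 1 - v1 m 1)) ->
  is_lim_seq x (real (Lim_seq x)).
Proof.
  intros HC H.
  assert (Hex : ex_finite_lim_seq x).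
  { apply ex_lim_seq_cauchy_corr. intros eps.
    assert (Hc : ex_lim_seq_cauchy (fun n => v1 n 1)).
    { apply ex_lim_seq_cauchy_corr. exists dinf. exact hd. }
    assert (He : 0 < eps / C) by (apply Rdiv_lt_0_compat; [apply cond_pos|exact HC]).
    destruct (Hc (mkposreal _ He)) as [N HN]. exists N. intros n m Hn Hm.
    specialize (HN n m Hn Hm). simpl in HN. eapply Rle_lt_trans; [apply H|].
    replace (pos eps) with (C * (eps / C)) by (field; lra). apply Rmult_lt_compat_l; assumption. }
  apply Lim_seq_correct' in Hex. exact Hex.
Qed.

Lemma limit_pointwise (r : R) : 0 < r <= 1 ->
  is_lim_seq (fun n => v n r) (us r) /\ is_lim_seq (fun n => v1 n r) (us1 r).
Proof.
  intros Hr. set (a := Rmin r (1 / 2)).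
  assert (Ha : 0 < a < 1 /\ a <= r).
  { unfold a. pose proof (Rmin_l r (1 / 2)). pose proof (Rmin_r r (1 / 2)).
    assert (0 < Rmin r (1 / 2)) by (apply Rmin_pos; lra). lra. }
  destruct (uniform_constants a (proj1 Ha)) as [B [L [C [M [M3 [_ [_ [HC [_ [_ [HD _]]]]]]]]]]].
  split; apply (cauchy_transfer _ C HC); intros n m; apply (HD n m r); lra.
Qed.

Lemma limit_second (r : R) : 0 < r <= 1 -> is_lim_seq (fun n => v2 n r) (us2 r).
Proof.
  intros Hr. destruct (limit_pointwise r Hr) as [H0 H1].
  apply is_lim_seq_ext with (fun n => - / r * v1 n r - l * f (v n r)).
  { intros n. symmetry. apply second_derivative_eq. exact Hr. }
  assert (Hu : 0 <= us r).
  { apply (is_lim_seq_le (fun _ => 0) (fun n => v n r) 0 (us r)); [|apply is_lim_seq_const|exact H0].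
    intros n. apply uniform_value. exact Hr. }
  assert (Hf : is_lim_seq (fun n => f (v n r)) (f (us r))).
  { apply is_lim_seq_spec. intros eps.
    destruct (proj1 (continuous_on_set_eps _ _) (nonlinearity_continuous _ _ _ hf) (us r) Hu eps (cond_pos eps)) as [d [Hd0 Hd]].
    apply is_lim_seq_spec in H0. destruct (H0 (mkposreal d Hd0)) as [N HN]. exists N. intros n Hn.
    apply Hd; [apply uniform_value; exact Hr|]. exact (HN n Hn). }
  apply is_lim_seq_minus'.
  - apply (is_lim_seq_scal_l _ (- / r) (us1 r)). exact H1.
  - apply (is_lim_seq_scal_l _ l (f (us r))). exact Hf.
Qed.

(** The quadratic Taylor bounds of [v n] and [v1 n] have constants independent of n on [[x / 2, 1]],
    so they hold for the limits. *)
Lemma limit_C2 : C2_with (Ioc 0 1) us us1 us2.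
Proof.
  assert (loc : forall x, Ioc 0 1 x -> 0 < x / 2 < 1 /\ forall y, Ioc 0 1 y -> Rabs (y - x) < x / 2 -> x / 2 <= y <= 1).
  { unfold Ioc. intros x Hx. split; [lra|]. intros y Hy Hyx. apply Rabs_def2 in Hyx. lra. }
  assert (pass : forall (z : nat -> R) (zi b : R), is_lim_seq z zi -> (forall n, Rabs (z n) <= b) -> Rabs zi <= b).
  { intros z zi b Hz Hb. apply (is_lim_seq_le (fun n => Rabs (z n)) (fun _ => b) (Rabs zi) b Hb); [|apply is_lim_seq_const].
    apply (is_lim_seq_abs _ zi). exact Hz. }
  assert (remainder : forall (w w1 : nat -> R -> R) (wi wi1 : R -> R) x y,
     is_lim_seq (fun n => w n x) (wi x) -> is_lim_seq (fun n => w n y) (wi y) -> is_lim_seq (fun n => w1 n x) (wi1 x) ->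
     is_lim_seq (fun n => w n y - w n x - (y - x) * w1 n x) (wi y - wi x - (y - x) * wi1 x)).
  { intros w w1 wi wi1 x y Hx Hy H1. apply is_lim_seq_minus'; [apply is_lim_seq_minus'; assumption|].
    apply (is_lim_seq_scal_l _ (y - x) (wi1 x)). exact H1. }
  split; [|split].
  - apply is_derive_on_quadratic. intros x Dx. destruct (loc x Dx) as [Ha Hnear].
    destruct (uniform_constants (x / 2) Ha) as [B [L [C [M [M3 [_ [_ [_ [_ [_ [_ [HM _]]]]]]]]]]]].
    exists (x / 2), M. split; [lra|]. intros y Dy Hy. specialize (Hnear y Dy Hy). unfold Ioc in Dx, Dy.
    apply (pass (fun n => v n y - v n x - (y - x) * v1 n x)).
    + exact (remainder v v1 us us1 x y (proj1 (limit_pointwise x ltac:(lra)))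
        (proj1 (limit_pointwise y ltac:(lra))) (proj2 (limit_pointwise x ltac:(lra)))).
    + intros n. apply (taylor_quadratic (v n) (v1 n) (x / 2) 1 M); try lra; [| |apply HM].
      * apply continuous_on_set_sub with (2 := proj1 (psol_continuous _ _ _ _ _ (hs n))). unfold Icc; intros; lra.
      * intros z Hz. apply (psol_derive _ _ _ _ _ _ (hs n)). lra.
  - apply is_derive_on_quadratic. intros x Dx. destruct (loc x Dx) as [Ha Hnear].
    destruct (uniform_constants (x / 2) Ha) as [B [L [C [M [M3 [_ [_ [_ [_ [_ [_ [_ HM]]]]]]]]]]]].
    exists (x / 2), M3. split; [lra|]. intros y Dy Hy. specialize (Hnear y Dy Hy). unfold Ioc in Dx, Dy.
    apply (pass (fun n => v1 n y - v1 n x - (y - x) * v2 n x)).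
    + exact (remainder v1 v2 us1 us2 x y (proj2 (limit_pointwise x ltac:(lra)))
        (proj2 (limit_pointwise y ltac:(lra))) (limit_second x ltac:(lra))).
    + intros n. apply (taylor_quadratic (v1 n) (v2 n) (x / 2) 1 M3); try lra; [| |apply HM].
      * apply continuous_on_set_sub with (2 := proj2 (psol_continuous _ _ _ _ _ (hs n))). unfold Icc; intros; lra.
      * intros z Hz. apply (psol_derive _ _ _ _ _ _ (hs n)). lra.
  - apply continuous_on_set_eps. intros x Dx eps Heps. destruct (loc x Dx) as [Ha Hnear].
    destruct (uniform_constants (x / 2) Ha) as [B [L [C [M [M3 [_ [_ [_ [_ [_ [_ [_ HM]]]]]]]]]]]].
    assert (HM3 : 0 < Rabs M3 + 1) by (pose proof (Rabs_pos M3); lra).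
    exists (Rmin (x / 2) (eps / (Rabs M3 + 1))).
    split; [apply Rmin_pos; [lra|apply Rdiv_lt_0_compat; lra]|].
    intros y Dy Hy. pose proof (Rmin_l (x / 2) (eps / (Rabs M3 + 1))). pose proof (Rmin_r (x / 2) (eps / (Rabs M3 + 1))).
    specialize (Hnear y Dy ltac:(lra)). unfold Ioc in Dx, Dy.
    assert (HB : Rabs (us2 y - us2 x) <= M3 * Rabs (y - x)).
    { apply (pass (fun n => v2 n y - v2 n x)).
      - apply is_lim_seq_minus'; apply limit_second; lra.
      - intros n. apply HM; lra. }
    assert (Hy2 : Rabs (y - x) < eps / (Rabs M3 + 1)) by lra.
    apply Rmult_lt_compat_r with (r := Rabs M3 + 1) in Hy2; [|lra].
    replace (eps / (Rabs M3 + 1) * (Rabs M3 + 1)) with eps in Hy2 by (field; lra).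
    pose proof (Rle_abs M3). pose proof (Rabs_pos (y - x)). nra.
Qed.

Lemma limit_uniform (a eps : R) : 0 < a < 1 -> 0 < eps ->
  eventually (fun n => forall r, Icc a 1 r ->
    Rabs (v n r - us r) < eps /\ Rabs (v1 n r - us1 r) < eps /\ Rabs (v2 n r - us2 r) < eps).
Proof.
  intros Ha Heps.
  destruct (uniform_constants a Ha) as [B [L [C [M [M3 [HB [HL [HC [Hlip [HvB [HD _]]]]]]]]]]].
  set (K := C + / a * C + l * L * C).
  assert (Hia : 0 < / a) by (apply Rinv_0_lt_compat; lra).
  assert (HK : 0 < / a * C /\ 0 < l * L * C) by (split; repeat apply Rmult_lt_0_compat; lra).
  assert (HKC : C <= K) by (unfold K; lra).
  assert (HeK : 0 < eps / K) by (apply Rdiv_lt_0_compat; lra).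
  pose proof hd as hd'. apply is_lim_seq_spec in hd'. destruct (hd' (mkposreal _ HeK)) as [N HN].
  exists N. intros n Hn r Hr. specialize (HN n Hn). simpl in HN. unfold Icc in Hr.
  destruct (limit_pointwise r ltac:(lra)) as [L0 L1].
  assert (B0 : Rabs (v n r - us r) <= C * Rabs (v1 n 1 - dinf)).
  { apply (lim_seq_Rabs_bound (fun m => v m r) (fun m => v1 m 1)); [|exact L0|exact hd].
    intros m. apply (HD n m r Hr). }
  assert (B1 : Rabs (v1 n r - us1 r) <= C * Rabs (v1 n 1 - dinf)).
  { apply (lim_seq_Rabs_bound (fun m => v1 m r) (fun m => v1 m 1)); [|exact L1|exact hd].
    intros m. apply (HD n m r Hr). }
  pose proof (Rabs_pos (v1 n 1 - dinf)) as Hp. set (D := Rabs (v1 n 1 - dinf)) in *.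
  assert (HKD : K * D < eps).
  { replace eps with (K * (eps / K)) by (field; lra). apply Rmult_lt_compat_l; lra. }
  assert (HusB : 0 <= us r <= B).
  { split.
    - apply (is_lim_seq_le (fun _ => 0) (fun n => v n r) 0 (us r)); [|apply is_lim_seq_const|exact L0].
      intros m. apply HvB. exact Hr.
    - apply (is_lim_seq_le (fun n => v n r) (fun _ => B) (us r) B); [|exact L0|apply is_lim_seq_const].
      intros m. apply HvB. exact Hr. }
  split; [nra|]. split; [nra|].
  rewrite second_derivative_eq by lra. unfold us2.
  replace (- / r * v1 n r - l * f (v n r) - (- / r * us1 r - l * f (us r)))
    with (- / r * (v1 n r - us1 r) + - l * (f (v n r) - f (us r))) by ring.
  eapply Rle_lt_trans; [apply Rabs_triang|]. rewrite !Rabs_mult, !Rabs_Ropp.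
  assert (Hir : 0 < / r <= / a) by (split; [apply Rinv_0_lt_compat; lra|apply Rinv_le_contravar; lra]).
  rewrite (Rabs_right (/ r)), (Rabs_right l) by lra.
  assert (T1 : / r * Rabs (v1 n r - us1 r) <= / a * (C * D)).
  { apply Rmult_le_compat; try lra. apply Rabs_pos. }
  assert (T2 : l * Rabs (f (v n r) - f (us r)) <= l * (L * (C * D))).
  { apply Rmult_le_compat_l; [lra|]. eapply Rle_trans; [apply Hlip; [apply HvB; exact Hr|exact HusB]|].
    apply Rmult_le_compat_l; lra. }
  apply Rle_lt_trans with (K * D); [|exact HKD]. unfold K. assert (0 <= C * D) by nra. lra.
Qed.

Lemma limit_flux (r r' : R) : 0 < r -> r <= r' -> r' <= 1 ->
  r' * us1 r' <= r * us1 r /\ us r' <= us r /\ - (r * us1 r) <= beta /\ 0 <= us r.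
Proof.
  intros H0 H1 H2. destruct (limit_pointwise r ltac:(lra)) as [L0 L1].
  destruct (limit_pointwise r' ltac:(lra)) as [L0' L1'].
  assert (S : forall x, 0 < x <= 1 -> is_lim_seq (fun n => x * v1 n x) (x * us1 x)).
  { intros x Hx. apply (is_lim_seq_scal_l _ x (us1 x)). apply limit_pointwise. exact Hx. }
  split; [|split; [|split]].
  - apply (is_lim_seq_le (fun n => r' * v1 n r') (fun n => r * v1 n r) (r' * us1 r') (r * us1 r)); [|apply S; lra|apply S; lra].
    intros n. apply (flux_nonincr f l (v n) (v1 n) (v2 n) fpos hl (hs n)); lra.
  - apply (is_lim_seq_le (fun n => v n r') (fun n => v n r) (us r') (us r)); [|exact L0'|exact L0].
    intros n. apply (psol_nonincr f l (v n) (v1 n) (v2 n) fpos hl (hs n)); lra.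
  - apply (is_lim_seq_le (fun n => - (r * v1 n r)) (fun _ => beta) (- (r * us1 r)) beta); [| |apply is_lim_seq_const].
    + intros n. pose proof (flux_nonincr f l (v n) (v1 n) (v2 n) fpos hl (hs n) r 1 ltac:(lra) ltac:(lra) ltac:(lra)).
      specialize (hb n). lra.
    + apply (is_lim_seq_opp _ (r * us1 r)). apply S. lra.
  - apply (is_lim_seq_le (fun _ => 0) (fun n => v n r) 0 (us r)); [|apply is_lim_seq_const|exact L0].
    intros n. apply uniform_value. lra.
Qed.

Lemma limit_end : us 1 = 0.
Proof.
  unfold us. rewrite (Lim_seq_ext _ (fun _ => 0)); [rewrite Lim_seq_const; reflexivity|].
  intros n. apply hs.
Qed.

Lemma compactness : exists w w1 w2, C2_with (Ioc 0 1) w w1 w2 /\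
  (forall a, 0 < a < 1 -> forall eps, 0 < eps -> eventually (fun n => forall r, Icc a 1 r ->
    Rabs (v n r - w r) < eps /\ Rabs (v1 n r - w1 r) < eps /\ Rabs (v2 n r - w2 r) < eps)) /\
  (forall r, w2 r = - / r * w1 r - l * f (w r)) /\ w 1 = 0 /\
  (forall r r', 0 < r -> r <= r' -> r' <= 1 ->
     r' * w1 r' <= r * w1 r /\ w r' <= w r /\ - (r * w1 r) <= beta /\ 0 <= w r).
Proof.
  exists us, us1, us2. split; [exact limit_C2|]. split; [intros; apply limit_uniform; assumption|].
  split; [reflexivity|]. split; [exact limit_end|]. exact limit_flux.
Qed.

End Compactness.

(** The integrand is the derivative of [H r = - r w'(r)], so its integral from e to 1 is H 1 - H e;
    [H] is monotone and bounded, hence has a limit at 0. *)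
Lemma weak_limit_integrable (f : R -> R) (l beta : R) (w w1 w2 : R -> R) :
  continuous_on_set (Ici 0) f -> C2_with (Ioc 0 1) w w1 w2 ->
  (forall r, w2 r = - / r * w1 r - l * f (w r)) ->
  (forall r r', 0 < r -> r <= r' -> r' <= 1 ->
     r' * w1 r' <= r * w1 r /\ w r' <= w r /\ - (r * w1 r) <= beta /\ 0 <= w r) ->
  ex_RInt_gen (fun r => l * f (w r) * r) (at_right 0) (at_point 1).
Proof.
  intros Cf [D0 [D1 _]] E HF.
  pose (H := fun r => - (r * w1 r)). pose (g := fun r => l * f (w r) * r).
  assert (HI : forall y, 0 < y < 1 -> Ioc 0 1 y) by (unfold Ioc; intros; lra).
  assert (Cg : continuous_on_set (Ioc 0 1) g).
  { apply continuous_on_set_mult.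
    - apply continuous_on_set_mult; [apply continuous_on_set_const|].
      apply continuous_on_set_comp with (Ici 0); [|exact (is_derive_on_continuous _ _ _ D0)|exact Cf].
      intros y [Hy Hy1]. apply (HF y y); lra.
    - apply continuous_on_set_of_ex_derive. intros x. auto_derive. exact I. }
  assert (CH : continuous_on_set (Ioc 0 1) H).
  { apply (continuous_on_set_comp (Ioc 0 1) (fun _ => True) (fun r => r * w1 r) Ropp); [auto| |].
    - apply continuous_on_set_mult; [|exact (is_derive_on_continuous _ _ _ D1)].
      apply continuous_on_set_of_ex_derive. intros x. auto_derive. exact I.
    - apply continuous_on_set_of_ex_derive. intros x. auto_derive. exact I. }
  assert (DH : forall r, 0 < r < 1 -> is_derive H r (g r)).
  { intros r Hr. pose proof (is_derive_on_interior _ _ _ 0 1 r D1 HI Hr) as D. unfold H.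
    derive_known. rewrite E. unfold g. field. lra. }
  assert (HR : forall e, 0 < e < 1 -> is_RInt g e 1 (H 1 - H e)).
  { intros e He. pose (gc := fun r => g (clamp e 1 r)).
    assert (Hsub : forall x, Icc e 1 x -> Ioc 0 1 x) by (unfold Icc, Ioc; intros; lra).
    assert (Cgc : forall x, continuous gc x).
    { intros x. apply clamp_continuous; [lra|]. apply continuous_on_set_sub with (1 := Hsub). exact Cg. }
    assert (Hex : forall a b, ex_RInt gc a b).
    { intros a b. apply (@ex_RInt_continuous R_CompleteNormedModule). intros; apply Cgc. }
    assert (EQ : RInt gc e 1 = H 1 - H e).
    (* [H] is known to be differentiable only inside (0, 1), so the fundamental theorem of calculus
       up to r = 1 goes through the mean value theorem for the difference of the two primitives. *)
    { destruct (MVT_on (fun x => RInt gc e x + (-1) * H x) (fun x => gc x + (-1) * g x) e 1 (proj2 He)) as [c [Hc Ec]].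
      - apply continuous_on_set_plus.
        + apply continuous_on_of_continuous. intros x _.
          apply (@ex_derive_continuous R_AbsRing R_NormedModule). exists (gc x).
          apply is_derive_RInt with (a := e); [|apply Cgc].
          apply filter_forall. intros y. apply (RInt_correct gc). apply Hex.
        + apply continuous_on_set_mult; [apply continuous_on_set_const|].
          apply continuous_on_set_sub with (1 := Hsub). exact CH.
      - intros x Hx. apply (@is_derive_plus R_AbsRing R_NormedModule).
        + apply is_derive_RInt with (a := e); [|apply Cgc].
          apply filter_forall. intros y. apply (RInt_correct gc). apply Hex.
        + apply (is_derive_scal H x (-1) (g x)). apply DH. lra.
      - rewrite RInt_point in Ec. unfold gc in Ec at 2. rewrite clamp_id in Ec by lra.
        unfold zero in Ec; simpl in Ec. lra. }
    apply is_RInt_ext with gc.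
    - intros x Hx. rewrite Rmin_left, Rmax_right in Hx by lra. unfold gc. rewrite clamp_id; [reflexivity|lra].
    - rewrite <- EQ. apply (RInt_correct gc). apply Hex. }
  (* By monotonicity the supremum [m] is minus the limit of [H] at 0, so the improper integral is
     [H 1 + m]. *)
  destruct (completeness (fun y => exists r, 0 < r < 1 /\ y = - H r)) as [m [Hub Hlub]].
  { exists 0. intros y [r [Hr Ey]]. subst y. unfold H.
    destruct (HF r 1 ltac:(lra) ltac:(lra) ltac:(lra)) as [A _].
    assert (w1n : r * w1 r <= 0).
    { apply Rnot_lt_le. intros Hpos.
      pose proof (is_derive_on_interior _ _ _ 0 1 r D0 HI Hr) as D.
      assert (Hw1 : 0 < w1 r) by nra.
      destruct (derive_pos_local w r (w1 r) D Hw1) as [d [Hd0 Hd]].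
      set (y := r + Rmin (d / 2) ((1 - r) / 2)).
      assert (Hm : 0 < Rmin (d / 2) ((1 - r) / 2)) by (apply Rmin_pos; lra).
      pose proof (Rmin_l (d / 2) ((1 - r) / 2)). pose proof (Rmin_r (d / 2) ((1 - r) / 2)).
      destruct (Hd y) as [Hy _]. specialize (Hy ltac:(unfold y; lra)).
      destruct (HF r y ltac:(lra) ltac:(unfold y; lra) ltac:(unfold y; lra)) as [_ [B _]]. lra. }
    lra. }
  { exists (- H (1 / 2)). exists (1 / 2). split; [lra|reflexivity]. }
  exists (H 1 + m). intros P [eps HP].
  assert (Hex : exists r0, 0 < r0 < 1 /\ m - eps < - H r0).
  { apply NNPP. intros Hn. assert (m <= m - eps); [|pose proof (cond_pos eps); lra].
    apply Hlub. intros y [r [Hr Ey]]. subst y. apply Rnot_lt_le. intros Hlt. apply Hn. exists r. split; assumption. }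
  destruct Hex as [r0 [Hr0 Hm0]].
  apply Filter_prod with (Q := fun e => 0 < e <= r0) (R := fun b => b = 1).
  - exists (mkposreal r0 (proj1 Hr0)). intros y Hy Hy0. change (Rabs (y - 0) < r0) in Hy.
    rewrite Rabs_right in Hy by lra. lra.
  - reflexivity.
  - intros e b He Hb. subst b. exists (H 1 - H e). split; [apply HR; lra|].
    apply HP. change (Rabs ((H 1 - H e) - (H 1 + m)) < eps).
    assert (- H e <= m) by (apply Hub; exists e; split; [lra|reflexivity]).
    assert (- H r0 <= - H e) by (unfold H; destruct (HF e r0 ltac:(lra) ltac:(lra) ltac:(lra)); lra).
    apply Rabs_def1; lra.
Qed.

(** * Amplitude of the oscillations *)

(** With w = v (1/2), monotonicity gives f (v) >= c w on (0, 1/2). The flux at 1/2 is then at most -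
    l c w / 8 and can only decrease afterwards, so [v] loses at least l c w / 16 on (1/2, 1), but it
    has only w to lose. *)
Lemma lambda_upper (f : R -> R) (l c : R) (v v1 v2 : R -> R) :
  (forall t, 0 <= t -> 0 <= f t) -> 0 < c -> (forall t, 0 < t -> c * t <= f t) ->
  0 < l -> psol f l v v1 v2 -> l <= 16 / c.
Proof.
  intros fpos hc hfc hl Hs.
  destruct (psol_derive _ _ (1 / 2) _ _ _ Hs ltac:(lra)) as [_ [_ [_ Hv]]].
  set (w := v (1 / 2)) in *.
  assert (H1 : (1 / 2) * v1 (1 / 2) + l * c * w * (1 / 2) ^ 2 / 2 <= 0 * v1 0 + l * c * w * 0 ^ 2 / 2).
  { apply (nonincr_on (fun r => r * v1 r + l * c * w * r ^ 2 / 2) (fun r => - (r * (l * f (v r))) + l * c * w * r)); [lra| |].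
    - apply continuous_on_set_plus.
      + apply continuous_on_set_sub with (2 := flux_continuous f l v v1 v2 Hs). unfold Icc; intros; lra.
      + apply continuous_on_set_of_ex_derive. intros x. auto_derive. exact I.
    - intros x Hx. split.
      + apply (@is_derive_plus R_AbsRing R_NormedModule); [apply flux_derive with v2; [exact Hs|lra]|].
        auto_derive; [exact I|]. field.
      + destruct (psol_derive _ _ x _ _ _ Hs ltac:(lra)) as [_ [_ [_ Hvx]]].
        assert (Hwx : w <= v x) by (apply (psol_nonincr f l v v1 v2 fpos hl Hs); lra).
        specialize (hfc (v x) Hvx).
        assert (c * w <= f (v x)) by nra.
        assert (0 <= x * l) by nra.
        assert (x * l * (c * w) <= x * l * f (v x)) by nra. lra. }
  assert (H2 : v 1 + l * c * w / 8 * 1 <= v (1 / 2) + l * c * w / 8 * (1 / 2)).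
  { apply (nonincr_on (fun r => v r + l * c * w / 8 * r) (fun r => v1 r + l * c * w / 8)); [lra| |].
    - apply continuous_on_set_plus.
      + apply continuous_on_set_sub with (2 := proj1 (psol_continuous _ _ _ _ _ Hs)). unfold Icc; intros; lra.
      + apply continuous_on_set_of_ex_derive. intros x. auto_derive. exact I.
    - intros x Hx. split.
      + apply (@is_derive_plus R_AbsRing R_NormedModule); [apply (psol_derive _ _ _ _ _ _ Hs); lra|].
        auto_derive; [exact I|]. field.
      + pose proof (flux_nonincr f l v v1 v2 fpos hl Hs (1 / 2) x ltac:(lra) ltac:(lra) ltac:(lra)) as HF.
        pose proof (psol_v1_nonpos f l v v1 v2 fpos hl Hs x ltac:(lra)). nra. }
  destruct Hs as [_ [_ [_ E1]]]. rewrite E1 in H2. fold w in H2.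
  assert (H3 : l * c * w <= 16 * w) by lra. apply Rmult_le_reg_r in H3; [|exact Hv].
  apply Rmult_le_reg_r with c; [lra|]. unfold Rdiv. rewrite Rmult_assoc, Rinv_l by lra. lra.
Qed.

Lemma height_continuous (p a b : R) (X X1 : R -> R) :
  traj p a b X X1 -> continuous_on_set (Icc a b) (height p X).
Proof.
  intros HT. apply continuous_on_of_continuous. intros x Hx. destruct (HT x Hx) as [HX [D _]].
  apply (@ex_derive_continuous R_AbsRing R_NormedModule). unfold height. auto_derive.
  repeat split; [eexists; exact D|exact HX].
Qed.

Lemma X_le_2 (p xi : R) (X : R -> R) :
  2 < p -> 0 < X xi -> height p X xi <= 2 * exp (- xi) -> X xi <= 2.
Proof.
  intros hp HX H. rewrite height_eq in H. pose proof (exp_pos (- xi)).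
  assert (E : exp (p * ln (X xi)) <= 2) by nra.
  apply Rnot_lt_le. intros Hl.
  assert (Hln : ln 2 < ln (X xi)) by (apply ln_increasing; lra).
  assert (0 < ln 2) by (rewrite <- ln_1; apply ln_increasing; lra).
  assert (exp (ln 2) < exp (p * ln (X xi))) by (apply exp_increasing; nra).
  rewrite exp_ln in H2 by lra. lra.
Qed.

(* Beyond X = 1 the potential grows like exp (s (X^p - 1)) / s, which confines s (X^p - 1) to
   O(ln s); the power s^(1/4) is enough below. *)
Lemma wall (p : R) : 2 < p -> exists S, 1 <= S /\
  forall a b X X1, traj p a b X X1 -> S <= exp (- b) ->
    (forall xi, a <= xi <= b -> energy p X X1 xi <= 0) -> height p X a <= exp (- a) ->
    forall xi, a <= xi <= b -> height p X xi - exp (- xi) < exp (- xi / 4).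
Proof.
  intros hp. pose proof (kap_bounds p hp) as Hk. pose proof (kap_div_pos p hp) as Hkp.
  (* 131072 = 32 * 8^4: at the contact point the argument yields exp (sg / 2) <= 32 p sg^3, whereas
     exp (sg / 2) >= (sg / 8)^4. *)
  set (s0 := 131072 * p + 1). exists (s0 ^ 4).
  assert (Hs0 : 1 < s0) by (unfold s0; lra).
  split; [assert (1 <= s0 ^ 2) by nra; replace (s0 ^ 4) with (s0 ^ 2 * s0 ^ 2) by ring; nra|].
  intros a b X X1 HT HS HE Ha xi Hxi. apply Rnot_le_lt. intros Hge.
  destruct (IVT_on (fun x => height p X x - exp (- x) - exp (- x / 4)) a xi 0 ltac:(lra)) as [x [Hx Ex]].
  { repeat apply continuous_on_set_minus;
      try (apply continuous_on_set_of_ex_derive; intros x; auto_derive; exact I).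
    apply continuous_on_set_sub with (2 := height_continuous p a b X X1 HT). unfold Icc; intros; lra. }
  { left. pose proof (exp_pos (- a / 4)). lra. }
  destruct (HT x ltac:(lra)) as [HX _]. specialize (HE x ltac:(lra)).
  set (sg := exp (- x / 4)) in *. set (s := exp (- x)) in *. set (y := height p X x) in *.
  assert (Es : s = sg ^ 4).
  { unfold s, sg. replace (exp (- x / 4) ^ 4) with (exp (- x / 4) * exp (- x / 4) * (exp (- x / 4) * exp (- x / 4))) by ring.
    rewrite <- !exp_plus. f_equal. field. }
  assert (Hsg0 : 0 < sg) by apply exp_pos.
  assert (Hsg : s0 <= sg).
  { apply Rnot_lt_le. intros Hlt.
    assert (sg ^ 4 < s0 ^ 4).
    {
      assert (sg * sg < s0 * s0) by nra. nra. }
    assert (exp (- b) <= s) by (apply exp_le; lra). lra. }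
  assert (Hsgs : sg <= s).
  { rewrite Es. assert (1 <= sg ^ 3) by nra. nra. }
  assert (HX2 : X x <= 2) by (apply X_le_2 with p; try assumption; fold y s; lra).
  (* At the contact point y = s + sg; integrating [psi] over the upper half of [s, y] gains the
     factor exp (sg / 2). *)
  destruct (MVT_is_derive (Psi p) (psi p) (s + sg / 2) y ltac:(lra)) as [c [Hc Ec]].
  { intros t Ht. apply Psi_derive. lra. }
  assert (HPs : Psi p s <= Psi p (s + sg / 2)) by (apply Psi_increasing; lra).
  (* As c <= 2 s and the exponent of the power in [psi] exceeds -3, the power factor loses at most
     2^3 = 8. *)
  assert (Hpc : psi p s * / 8 * exp (sg / 2) <= psi p c).
  { unfold psi. replace (/ 8) with (exp (-3 * ln 2)).
    - rewrite <- !exp_plus. apply exp_le.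
      assert (Hl : ln c <= ln 2 + ln s).
      { rewrite <- ln_mult by lra. left. apply ln_increasing; lra. }
      assert (0 < ln 2) by (rewrite <- ln_1; apply ln_increasing; lra).
      assert ((-1 - 2 * kap p) * (ln 2 + ln s) <= (-1 - 2 * kap p) * ln c) by nra.
      assert (-3 * ln 2 <= (-1 - 2 * kap p) * ln 2) by nra. lra.
    - replace (-3 * ln 2) with (- (ln 2 + (ln 2 + ln 2))) by ring.
      rewrite exp_Ropp, !exp_plus, exp_ln by lra. field. }
  pose proof (weight_mul_psi p x) as Hw. fold s in Hw.
  assert (Hg : 0 < weight p x) by apply exp_pos.
  assert (Hpot : pot p X x <= 2 * (kap p / p)).
  { unfold energy in HE. pose proof (pow2_ge_0 (X1 x)).
    assert (X x ^ 2 <= 4) by nra.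
    assert (kap p / (2 * p) * X x ^ 2 <= kap p / (2 * p) * 4).
    { apply Rmult_le_compat_l; [|lra]. left. apply Rdiv_lt_0_compat; lra. }
    replace (kap p / (2 * p) * 4) with (2 * (kap p / p)) in H1 by (field; lra). lra. }
  set (g := weight p x) in *.
  assert (H1 : g * (psi p s * / 8 * exp (sg / 2) * (sg / 2)) <= g * (Psi p y - Psi p s)).
  { apply Rmult_le_compat_l; [lra|]. rewrite <- (Rplus_0_r (Psi p y - Psi p s)).
    apply Rle_trans with (psi p c * (sg / 2)); [apply Rmult_le_compat_r; lra|].
    replace (sg / 2) with (y - (s + sg / 2)) by lra. lra. }
  replace (g * (psi p s * / 8 * exp (sg / 2) * (sg / 2))) with ((g * psi p s) * (exp (sg / 2) * sg / 16)) in H1 by field.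
  rewrite Hw in H1.
  assert (H2 : kap p / p ^ 2 * (/ s * (exp (sg / 2) * sg / 16)) <= 2 * (kap p / p)).
  { eapply Rle_trans; [|exact Hpot]. apply Rmult_le_compat_l; [lra|exact H1]. }
  assert (H3 : exp (sg / 2) <= 32 * p * sg ^ 3).
  { apply Rmult_le_reg_l with (kap p / p ^ 2 * (/ s * (sg / 16))).
    - apply Rmult_lt_0_compat; [exact Hkp|]. apply Rmult_lt_0_compat; [apply Rinv_0_lt_compat; lra|lra].
    - replace (kap p / p ^ 2 * (/ s * (sg / 16)) * exp (sg / 2)) with (kap p / p ^ 2 * (/ s * (exp (sg / 2) * sg / 16))) by (field; lra).
      replace (kap p / p ^ 2 * (/ s * (sg / 16)) * (32 * p * sg ^ 3)) with (2 * (kap p / p)); [exact H2|].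
      rewrite Es. field. lra. }
  pose proof (exp_ge_pow4 (sg / 2) ltac:(lra)) as H4.
  unfold s0 in Hsg. nra.
Qed.

Lemma pot_nonneg (p xi : R) (X : R -> R) :
  2 < p -> exp (- xi) <= height p X xi -> 0 <= pot p X xi.
Proof.
  intros hp H. unfold pot. pose proof (kap_div_pos p hp).
  pose proof (Psi_increasing p (exp (- xi)) (height p X xi) (exp_pos _) H).
  apply Rmult_le_pos; [lra|]. apply Rmult_le_pos; [left; apply exp_pos|lra].
Qed.

Lemma kap_div_le_1 (p : R) : 2 < p -> kap p / p ^ 2 <= 1.
Proof.
  intros hp. pose proof (kap_bounds p hp). apply Rmult_le_reg_r with (p ^ 2); [simpl; nra|].
  replace (kap p / p ^ 2 * p ^ 2) with (kap p) by (field; lra). simpl; nra.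
Qed.

Lemma sq_le_4 (x : R) : x ^ 2 <= 4 -> -2 <= x <= 2.
Proof. intros H. split; nra. Qed.

Lemma is_derive_mul_exp (h : R -> R) (x h1 k a : R) :
  is_derive h x h1 ->
  is_derive (fun x => h x * exp (k * (x - a))) x ((h1 + k * h x) * exp (k * (x - a))).
Proof.
  intros D. derive_known. unfold Rminus. ring.
Qed.

Lemma force_height (p xi : R) (X : R -> R) :
  force p (exp (- xi)) (X xi) = exp ((1 - 2 * p) * ln (X xi) + (height p X xi - exp (- xi))).
Proof. unfold force. rewrite height_eq. f_equal. ring. Qed.

(* For X <= 1 the dissipation is O(1/s). For X > 1 it is bounded by a small multiple of the force,
   and by the equation the force is a derivative up to bounded terms; this leads to the corrected
   energy [h] below. *)
Lemma amplitude (p y0 Theta : R) : 2 < p -> 0 < y0 -> 0 < Theta -> exists S delta, 1 <= S /\ 0 < delta /\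
  forall a b X X1, traj p a b X X1 -> a <= b <= a + Theta -> S <= exp (- b) ->
    (forall xi, a <= xi <= b -> energy p X X1 xi <= - e0 p /\ y0 <= height p X xi) ->
    height p X a <= exp (- a) / 2 ->
    forall xi, a <= xi <= b -> delta <= energy p X X1 xi + kap p / (2 * p) /\ X xi <= 2 /\ X1 xi ^ 2 <= 4.
Proof.
  intros hp Hy0 HTh. pose proof (kap_bounds p hp) as Hk. pose proof (e0_pos p hp) as He0.
  pose proof (kap_div_pos p hp) as Hkp2.
  set (d := 1 - 2 / p).
  assert (Hd : 0 < d < 1) by (apply damping_bounds; exact hp).
  destruct (pot_lower p y0 hp Hy0) as [C1 [HC1 HP]].
  destruct (dissip_below p y0 hp Hy0) as [C2 [HC2 HD]].
  destruct (wall p hp) as [S2 [HS2 HW]].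
  (* Half height at the start means X^p <= 1/2, that is, X^2 <= 2^(-2/p) = [qq]; the resulting
     surplus of energy above the rest level is [eps1], up to the error in the potential. *)
  set (qq := exp (- (2 * ln 2 / p))).
  assert (Hln2 : 0 < ln 2) by (rewrite <- ln_1; apply ln_increasing; lra).
  assert (Hqq : qq < 1).
  { unfold qq. rewrite <- exp_0. apply exp_increasing. assert (0 < 2 * ln 2 / p) by (apply Rdiv_lt_0_compat; lra). lra. }
  assert (Hqq0 : 0 < qq) by apply exp_pos.
  assert (Hk2p : 0 < kap p / (2 * p) < 1 / 2).
  { split; [apply Rdiv_lt_0_compat; lra|]. apply Rmult_lt_reg_r with (2 * p); [lra|].
    replace (kap p / (2 * p) * (2 * p)) with (kap p) by (field; lra). lra. }
  assert (Hkp : kap p / p = 2 * (kap p / (2 * p))) by (field; lra).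
  set (eps1 := kap p / (2 * p) * (1 - qq)).
  assert (Heps1 : 0 < eps1 < 1 / 2) by (unfold eps1; split; nra).
  set (Q := 2 * C1 + 1 + C2 + 8 + 64 * p). set (K := Q / (2 * d)).
  assert (HK : 0 < K) by (unfold K, Q; apply Rdiv_lt_0_compat; lra).
  set (ex := exp (- (2 * Theta))).
  assert (Hex : 0 < ex < 1).
  { unfold ex. split; [apply exp_pos|]. rewrite <- exp_0. apply exp_increasing. lra. }
  set (delta := ex * eps1 / 4). assert (Hdelta : 0 < delta) by (unfold delta; nra).
  set (N := C1 + 32 * p + K + 2 * C1 + 1). assert (HN : 1 < N) by (unfold N; lra).
  exists (S2 + 7 + (N / delta) ^ 2), delta.
  pose proof (pow2_ge_0 (N / delta)) as HNd2. split; [lra|]. split; [exact Hdelta|].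
  intros a b X X1 HT Hab HS HX Ha.
  assert (Hb0 : b < 0).
  { apply Rnot_le_lt. intros Hge. assert (exp (- b) <= exp 0) by (apply exp_le; lra). rewrite exp_0 in H. lra. }
  (* This is s^(-1/2) at the end of the range, where it is largest; all error terms are bounded by
     multiples of it. *)
  set (eta := exp (b / 2)). assert (Heta0 : 0 < eta) by apply exp_pos.
  assert (HNeta : N * eta <= delta).
  { assert (H1 : N / delta <= exp (- b / 2)).
    { apply Rnot_lt_le. intros Hlt. pose proof (exp_pos (- b / 2)) as Hpos.
      assert (E : exp (- b) = exp (- b / 2) ^ 2).
      { simpl. rewrite Rmult_1_r, <- exp_plus. f_equal. field. }
      assert (exp (- b / 2) ^ 2 < (N / delta) ^ 2) by (simpl; nra). lra. }
    assert (E : eta * exp (- b / 2) = 1).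
    { unfold eta. rewrite <- exp_plus. replace (b / 2 + - b / 2) with 0 by field. apply exp_0. }
    apply Rmult_le_reg_r with (exp (- b / 2)); [apply exp_pos|].
    rewrite Rmult_assoc, E. apply Rmult_le_reg_l with (/ delta); [apply Rinv_0_lt_compat; lra|].
    replace (/ delta * (N * 1)) with (N / delta) by (field; lra).
    replace (/ delta * (delta * exp (- b / 2))) with (exp (- b / 2)) by (field; lra). exact H1. }
  assert (Hdl : delta < eps1 / 4) by (unfold delta; nra).
  assert (Hwall : forall xi, a <= xi <= b -> height p X xi - exp (- xi) < exp (- xi / 4)).
  { apply HW with X1; [exact HT|lra| |].
    - intros xi Hxi. destruct (HX xi Hxi) as [HE _]. lra.
    - pose proof (exp_pos (- a)). lra. }
  set (Et := fun xi => energy p X X1 xi + kap p / (2 * p)).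
  assert (facts : forall xi, a <= xi <= b -> 0 < X xi <= 2 /\ - (C1 * eta) <= pot p X xi /\
     X1 xi ^ 2 <= 2 * Et xi + (2 * C1 + 1) * eta /\ X1 xi ^ 2 <= 4 /\
     dissip p X xi <= eta * (C2 + 4 * force p (exp (- xi)) (X xi))).
  { intros xi Hxi. destruct (HT xi Hxi) as [HXp _]. destruct (HX xi Hxi) as [HE Hh]. specialize (Hwall xi Hxi).
    set (s := exp (- xi)) in *. set (y := height p X xi) in *. set (sg := exp (- xi / 4)) in *.
    assert (Hsb : exp (- b) <= s) by (apply exp_le; lra).
    assert (Hsg1 : 1 <= sg) by (unfold sg; rewrite <- exp_0; apply exp_le; lra).
    assert (Es : s = sg ^ 4).
    { unfold s, sg. replace (exp (- xi / 4) ^ 4) with (exp (- xi / 4) * exp (- xi / 4) * (exp (- xi / 4) * exp (- xi / 4))) by ring.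
      rewrite <- !exp_plus. f_equal. field. }
    assert (Hsg2 : / sg ^ 2 <= eta).
    { unfold sg, eta. simpl. rewrite Rmult_1_r, <- exp_plus, <- exp_Ropp. apply exp_le. lra. }
    assert (Hsg2' : 1 <= sg ^ 2) by (apply pow_R1_Rle; exact Hsg1).
    assert (Hsinv : / s <= eta).
    { eapply Rle_trans; [|exact Hsg2]. apply Rinv_le_contravar; [lra|]. rewrite Es.
      nra. }
    assert (Hsgs : sg / s <= eta).
    { eapply Rle_trans; [|exact Hsg2]. rewrite Es. replace (sg / sg ^ 4) with (/ sg ^ 3) by (field; lra).
      apply Rinv_le_contravar; [lra|]. nra. }
    assert (Hsgles : sg <= s) by (rewrite Es; replace (sg ^ 4) with (sg * (sg ^ 2 * sg)) by ring; nra).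
    assert (HX2 : X xi <= 2) by (apply X_le_2 with p; try assumption; fold s y; lra).
    assert (Hpot : - (C1 * eta) <= pot p X xi).
    { destruct (Rle_lt_dec y s) as [L|L].
      - specialize (HP X xi (conj Hh L) ltac:(fold s; lra)). fold s in HP.
        assert (C1 * / s <= C1 * eta) by (apply Rmult_le_compat_l; lra). unfold Rdiv in HP. lra.
      - pose proof (pot_nonneg p xi X hp ltac:(fold s y; lra)). nra. }
    pose proof (height_eq p X xi) as Eh. fold s y in Eh.
    assert (Hs0 : 0 < s) by lra.
    assert (Hlog : s < y -> 0 < ln (X xi)).
    { intros L. apply Rnot_le_lt. intros Hle. assert (exp (p * ln (X xi)) <= 1) by (rewrite <- exp_0; apply exp_le; nra). nra. }
    assert (Hxsq : X xi ^ 2 <= 1 + eta).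
    { destruct (Rle_lt_dec y s) as [L|L].
      - assert (X xi <= 1) by (apply height_le_time with p; [lra|exact HXp|exact L]). simpl. nra.
      - specialize (Hlog L).
        assert (E2 : X xi ^ 2 <= exp (p * ln (X xi))).
        { rewrite <- (exp_ln (X xi) HXp) at 1. simpl. rewrite Rmult_1_r, <- exp_plus. apply exp_le. nra. }
        assert (exp (p * ln (X xi)) = 1 + (y - s) / s) by (rewrite Eh; field; lra).
        assert ((y - s) / s <= sg / s) by (apply Rmult_le_compat_r; [left; apply Rinv_0_lt_compat; lra|lra]). lra. }
    assert (HX1 : X1 xi ^ 2 <= 2 * Et xi + (2 * C1 + 1) * eta).
    { unfold Et, energy.
      assert (kap p / (2 * p) * X xi ^ 2 <= kap p / (2 * p) * (1 + eta)) by (apply Rmult_le_compat_l; lra).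
      nra. }
    split; [lra|]. split; [exact Hpot|]. split; [exact HX1|]. split.
    { assert (Et xi < 1 / 2) by (unfold Et; lra).
      assert ((2 * C1 + 1) * eta <= N * eta) by (apply Rmult_le_compat_r; unfold N; lra). lra. }
    assert (Hf0 : 0 < force p s (X xi)) by apply exp_pos.
    destruct (Rle_lt_dec y s) as [L|L].
    - specialize (HD X xi HXp (conj Hh L) ltac:(fold s; lra)). fold s in HD.
      assert (C2 * / s <= C2 * eta) by (apply Rmult_le_compat_l; lra).
      assert (0 < eta * (4 * force p s (X xi))) by (apply Rmult_lt_0_compat; lra). lra.
    - pose proof (dissip_above p X xi hp HXp ltac:(fold s y; lra)) as HDa. fold s y in HDa.
      specialize (Hlog L). eapply Rle_trans; [exact HDa|].
      assert (Hk1 : kap p / p ^ 2 <= 1).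
      { apply kap_div_le_1. exact hp. }
      (* [wall] bounds (y - s)^2 by s^(1/2), which is what makes the dissipation a small multiple of
         the force. *)
      assert (Hz2 : (y - s) ^ 2 / s <= eta).
      { eapply Rle_trans; [|exact Hsg2]. apply Rmult_le_reg_r with s; [lra|].
        replace ((y - s) ^ 2 / s * s) with ((y - s) ^ 2) by (field; lra).
        rewrite Es at 2. replace (/ sg ^ 2 * sg ^ 4) with (sg ^ 2) by (field; lra).
        apply pow_incr. lra. }
      assert (Hez : exp (y - s) <= 4 * force p s (X xi)).
      { unfold s, y. rewrite force_height. fold y s.
        replace (y - s) with ((2 * p - 1) * ln (X xi) + ((1 - 2 * p) * ln (X xi) + (y - s))) at 1 by ring.
        rewrite exp_plus. apply Rmult_le_compat_r; [left; apply exp_pos|].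
        assert (Hyx : exp (p * ln (X xi)) <= 2).
        { apply Rmult_le_reg_l with s; [lra|]. rewrite <- Eh. lra. }
        pose proof (exp_pos (p * ln (X xi))).
        apply Rle_trans with (exp (p * ln (X xi) + p * ln (X xi))); [apply exp_le; lra|]. rewrite exp_plus.
        apply Rle_trans with (2 * 2); [apply Rmult_le_compat; lra|lra]. }
      pose proof (exp_pos (y - s)) as Hepos.
      assert (Hq0 : 0 <= (y - s) ^ 2 / s).
      { apply Rmult_le_pos; [apply pow2_ge_0|]. left. apply Rinv_0_lt_compat. lra. }
      assert (H1 : exp (y - s) * ((y - s) ^ 2 / s) <= 4 * force p s (X xi) * eta) by (apply Rmult_le_compat; lra).
      assert (H0 : 0 <= exp (y - s) * ((y - s) ^ 2 / s)) by (apply Rmult_le_pos; lra).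
      assert (kap p / p ^ 2 * (exp (y - s) * ((y - s) ^ 2 / s)) <= 1 * (exp (y - s) * ((y - s) ^ 2 / s)))
        by (apply Rmult_le_compat_r; lra).
      assert (0 < eta * C2) by (apply Rmult_lt_0_compat; lra). lra. }
  (* By the equation X' + d X has derivative [kap p / p] (X - force); the coefficient [A] makes its
     contribution to [h] cancel the term 4 eta force in the bound on the dissipation. *)
  set (A := 4 * eta * (p / kap p)).
  assert (HA : 0 < A <= 8 * p * eta).
  { unfold A. assert (0 < p / kap p <= 2 * p).
    { split; [apply Rdiv_lt_0_compat; lra|]. apply Rmult_le_reg_r with (kap p); [lra|].
      replace (p / kap p * kap p) with p by (field; lra). nra. }
    split; [apply Rmult_lt_0_compat; lra|]. nra. }
  pose (h := fun xi => Et xi - A * (X1 xi + d * X xi) + K * eta).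
  assert (Dh : forall xi, a <= xi <= b -> is_derive h xi
     (- d * X1 xi ^ 2 - dissip p X xi - 4 * eta * (X xi - force p (exp (- xi)) (X xi)))).
  { intros xi Hxi. pose proof (energy_derive p a b X X1 xi hp HT Hxi) as DE.
    destruct (HT xi Hxi) as [_ [D0 D1]]. fold d in DE, D1.
    unfold h, Et. revert DE. generalize (energy p X X1). intros E DE. derive_known.
      unfold A. field. lra. }
  assert (slope : forall xi, a <= xi <= b -> -4 <= X1 xi + d * X xi <= 4).
  { intros xi Hxi. destruct (facts xi Hxi) as [F1 [_ [_ [F4 _]]]]. pose proof (sq_le_4 _ F4).
    assert (0 < d * X xi <= 1 * 2) by (split; [apply Rmult_lt_0_compat; lra|apply Rmult_le_compat; lra]). lra. }
  (* X'^2 is at most twice the surplus plus O(eta), so the surplus decays at rate at most 2 d; the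
     constant [K * eta] in [h] absorbs the errors. *)
  assert (Hgrow : forall xi, a <= xi <= b -> h a * exp (- (2 * d * (xi - a))) <= h xi).
  { intros xi Hxi.
    assert (DG : forall x, a <= x <= b -> is_derive (fun x => h x * exp (2 * d * (x - a))) x
       ((- d * X1 x ^ 2 - dissip p X x - 4 * eta * (X x - force p (exp (- x)) (X x)) + 2 * d * h x) * exp (2 * d * (x - a)))).
    { intros x Hx. exact (is_derive_mul_exp h x _ (2 * d) a (Dh x Hx)). }
    assert (HM : h a * exp (2 * d * (a - a)) <= h xi * exp (2 * d * (xi - a))).
    { apply (nondecr_on (fun x => h x * exp (2 * d * (x - a)))
        (fun x => (- d * X1 x ^ 2 - dissip p X x - 4 * eta * (X x - force p (exp (- x)) (X x)) + 2 * d * h x) * exp (2 * d * (x - a)))); [lra| |].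
      - eapply continuous_on_of_derive. intros x [Hx Hx']. apply DG. lra.
      - intros x Hx. split; [apply DG; lra|]. apply Rmult_le_pos; [|left; apply exp_pos].
        destruct (facts x ltac:(lra)) as [F1 [F2 [F3 [F4 F5]]]]. pose proof (slope x ltac:(lra)) as Hsl.
        unfold h. set (F := force p (exp (- x)) (X x)) in *.
        assert (G1 : - d * X1 x ^ 2 >= - d * (2 * Et x) - (2 * C1 + 1) * eta).
        { assert (d * X1 x ^ 2 <= d * (2 * Et x + (2 * C1 + 1) * eta)) by (apply Rmult_le_compat_l; lra).
          assert (0 <= (1 - d) * ((2 * C1 + 1) * eta)) by (apply Rmult_le_pos; [lra|apply Rmult_le_pos; lra]). lra. }
        assert (G2 : 2 * d * (A * (X1 x + d * X x)) <= 64 * p * eta).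
        { assert (A * (X1 x + d * X x) <= 8 * p * eta * 4).
          { apply Rle_trans with (A * 4); [apply Rmult_le_compat_l; lra|lra]. }
          assert (0 < p * eta) by nra. nra. }
        assert (G3 : 2 * d * (K * eta) = Q * eta) by (unfold K; field; lra).
        assert (G4 : 4 * eta * X x <= 8 * eta) by nra.
        unfold Q in G3. lra. }
    replace (2 * d * (a - a)) with 0 in HM by ring. rewrite exp_0, Rmult_1_r in HM.
    apply Rmult_le_reg_r with (exp (2 * d * (xi - a))); [apply exp_pos|].
    rewrite Rmult_assoc, <- exp_plus. replace (- (2 * d * (xi - a)) + 2 * d * (xi - a)) with 0 by ring.
    rewrite exp_0. lra. }
  assert (Hha : eps1 / 2 <= h a).
  { destruct (facts a ltac:(lra)) as [F1 [F2 _]]. pose proof (slope a ltac:(lra)) as Hsl.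
    assert (Hxa : X a ^ 2 <= qq).
    { rewrite height_eq in Ha. pose proof (exp_pos (- a)) as Hsa.
      assert (E : exp (p * ln (X a)) <= exp (- ln 2)).
      { rewrite exp_Ropp, exp_ln by lra. apply Rmult_le_reg_l with (exp (- a)); [exact Hsa|]. lra. }
      assert (Hl : p * ln (X a) <= - ln 2).
      { apply Rnot_lt_le. intros Hlt. apply exp_increasing in Hlt. lra. }
      rewrite <- (exp_ln (X a)) at 1 by lra. simpl. rewrite Rmult_1_r, <- exp_plus. apply exp_le.
      apply Rmult_le_reg_l with p; [lra|]. replace (p * - (2 * ln 2 / p)) with (- (2 * ln 2)) by (field; lra). lra. }
    unfold h, Et, energy.
    assert (kap p / (2 * p) * X a ^ 2 <= kap p / (2 * p) * qq) by nra.
    pose proof (pow2_ge_0 (X1 a)).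
    assert (A * (X1 a + d * X a) <= 8 * p * eta * 4) by nra.
    assert ((C1 + 32 * p) * eta <= N * eta) by (apply Rmult_le_compat_r; unfold N; lra).
    assert (0 < K * eta) by nra.
    unfold eps1 in *. lra. }
  intros xi Hxi. destruct (facts xi Hxi) as [F1 [_ [_ [F4 _]]]]. split; [|split; [lra|exact F4]].
  specialize (Hgrow xi Hxi). pose proof (slope xi Hxi) as Hsl. change (delta <= Et xi).
  assert (Hexp : ex <= exp (- (2 * d * (xi - a)))).
  { apply exp_le. assert (d * (xi - a) <= 1 * Theta) by (apply Rmult_le_compat; lra). lra. }
  assert (Hh : 2 * delta <= h xi).
  { eapply Rle_trans; [|exact Hgrow]. unfold delta.
    replace (2 * (ex * eps1 / 4)) with (eps1 / 2 * ex) by field. apply Rmult_le_compat; lra. }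
  unfold h in Hh.
  assert (- (8 * p * eta * 4) <= A * (X1 xi + d * X xi)).
  { apply Rle_trans with (A * -4); [lra|]. apply Rmult_le_compat_l; lra. }
  assert ((K + 32 * p) * eta <= N * eta) by (apply Rmult_le_compat_r; unfold N; lra).
  lra.
Qed.

Lemma excess_bound (p xi : R) (X : R -> R) : 1 <= p -> 0 < X xi ->
  (1 <= X xi -> exp (- xi) * (X xi - 1) <= height p X xi - exp (- xi)) /\
  (X xi <= 1 -> height p X xi - exp (- xi) <= exp (- xi) * (X xi - 1)).
Proof.
  intros hp HX. rewrite height_eq. pose proof (exp_pos (- xi)) as Hs.
  assert (E : exp (ln (X xi)) = X xi) by (apply exp_ln; exact HX). split; intros H.
  - assert (Hl : 0 <= ln (X xi)) by (rewrite <- ln_1; apply ln_le; lra).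
    assert (exp (ln (X xi)) <= exp (p * ln (X xi))) by (apply exp_le; nra). nra.
  - assert (Hl : ln (X xi) <= 0) by (rewrite <- ln_1; apply ln_le; lra).
    assert (exp (p * ln (X xi)) <= exp (ln (X xi))) by (apply exp_le; nra). nra.
Qed.

(** At the crossing X'^2 >= 2 delta, so [X] passes 1 with speed at least [m], and bounded
    acceleration keeps half of it for a time [h] independent of s. A displacement of m h / 2 to
    either side changes s (X^p - 1) by at least [kmax] when s is large, and the intermediate value
    theorem yields every level in between. *)
Lemma levels_near_crossing (p delta kmax : R) : 2 < p -> 0 < delta -> 0 <= kmax -> exists S, 1 <= S /\
  forall X X1 c, traj p (c - 1) (c + 1) X X1 -> S <= exp (- (c + 1)) ->
    (forall xi, c - 1 <= xi <= c + 1 -> (X xi <= 1 -> x0 p <= X xi) /\ X xi <= 2 /\ X1 xi ^ 2 <= 4) ->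
    X c = 1 -> delta <= energy p X X1 c + kap p / (2 * p) ->
    forall k, Rabs k <= kmax -> exists xi, c - 1 <= xi <= c + 1 /\ height p X xi - exp (- xi) = k.
Proof.
  intros hp Hdelta Hkm. pose proof (kap_bounds p hp) as Hk. pose proof (x0_pos p hp) as Hx0.
  set (m := sqrt (2 * delta)). assert (Hm : 0 < m) by (apply sqrt_lt_R0; lra).
  assert (Hm2 : m ^ 2 = 2 * delta) by (unfold m; simpl; rewrite Rmult_1_r; apply sqrt_sqrt; lra).
  set (Cf := exp ((2 * p - 1) * Rabs (ln (x0 p)) + kmax)). assert (HCf : 0 < Cf) by apply exp_pos.
  set (Q := 4 + Cf). set (h := Rmin 1 (m / (2 * Q))).
  assert (HmQ : 0 < m / (2 * Q)) by (apply Rdiv_lt_0_compat; unfold Q; lra).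
  assert (Hh : 0 < h <= 1 /\ Q * h <= m / 2).
  { unfold h. pose proof (Rmin_l 1 (m / (2 * Q))). pose proof (Rmin_r 1 (m / (2 * Q))).
    split; [split; [apply Rmin_pos; lra|lra]|].
    replace (m / 2) with (Q * (m / (2 * Q))) by (field; unfold Q; lra).
    apply Rmult_le_compat_l; [unfold Q; lra|lra]. }
  destruct Hh as [Hh HQh].
  assert (Hmh : 0 < m * h) by (apply Rmult_lt_0_compat; lra).
  assert (HS0 : 0 <= 2 * kmax / (m * h)) by (apply Rmult_le_pos; [lra|left; apply Rinv_0_lt_compat; lra]).
  exists (1 + 2 * kmax / (m * h)). split; [lra|].
  intros X X1 c HT HS HX EX HE k Hkk.
  set (d := 1 - 2 / p).
  assert (Hd : 0 < d < 1) by (apply damping_bounds; exact hp).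
  assert (Hkp : 0 < kap p / p <= 1).
  { split; [apply Rdiv_lt_0_compat; lra|]. apply Rmult_le_reg_r with p; [lra|].
    replace (kap p / p * p) with (kap p) by (field; lra). lra. }
  pose (X2 := fun xi => - d * X1 xi + kap p / p * (X xi - force p (exp (- xi)) (X xi))).
  assert (HX2up : forall xi, c - 1 <= xi <= c + 1 -> X2 xi <= Q).
  { intros xi Hxi. destruct (HX xi Hxi) as [_ [A B]]. destruct (HT xi Hxi) as [HXp _]. pose proof (sq_le_4 _ B).
    assert (0 < force p (exp (- xi)) (X xi)) by apply exp_pos.
    assert (kap p / p * (X xi - force p (exp (- xi)) (X xi)) <= 2).
    { apply Rle_trans with (kap p / p * 2); [apply Rmult_le_compat_l; lra|lra]. }
    assert (d * X1 xi >= - 2) by nra. unfold X2, Q. lra. }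
  (* The force is not bounded uniformly in s above X = 1, so this side holds only while the level
     [kmax] is not reached. Reaching it is what is wanted, hence the arguments by contradiction in
     [high_low]. *)
  assert (HX2low : forall xi, c - 1 <= xi <= c + 1 -> height p X xi - exp (- xi) < kmax -> - Q <= X2 xi).
  { intros xi Hxi Hz. destruct (HX xi Hxi) as [A0 [A B]]. destruct (HT xi Hxi) as [HXp _]. pose proof (sq_le_4 _ B).
    assert (HF : force p (exp (- xi)) (X xi) <= Cf).
    { rewrite force_height. apply exp_le. apply Rplus_le_compat; [|lra].
      pose proof (Rle_abs (- ln (x0 p))) as Ha. rewrite Rabs_Ropp in Ha.
      assert (- ln (X xi) <= Rabs (ln (x0 p))).
      { destruct (Rle_lt_dec (X xi) 1) as [L|L].
        - specialize (A0 L). assert (ln (x0 p) <= ln (X xi)).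
          { apply ln_le; lra. } lra.
        - assert (0 < ln (X xi)) by (rewrite <- ln_1; apply ln_increasing; lra).
          pose proof (Rabs_pos (ln (x0 p))). lra. }
      nra. }
    assert (kap p / p * (X xi - force p (exp (- xi)) (X xi)) >= - Cf).
    { assert (0 < force p (exp (- xi)) (X xi)) by apply exp_pos. nra. }
    assert (d * X1 xi <= 2) by nra. unfold X2, Q. lra. }
  assert (HX1c : m ^ 2 <= X1 c ^ 2).
  { unfold energy in HE. rewrite pot_crossing in HE by exact EX. rewrite EX in HE. rewrite Hm2. lra. }
  assert (sbound : forall xi, c - 1 <= xi <= c + 1 -> kmax <= exp (- xi) * (m * h / 2)).
  { intros xi Hxi. assert (exp (- (c + 1)) <= exp (- xi)) by (apply exp_le; lra).
    assert (2 * kmax / (m * h) * (m * h / 2) <= exp (- xi) * (m * h / 2)) by nra.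
    replace (2 * kmax / (m * h) * (m * h / 2)) with kmax in H0 by (field; lra). exact H0. }
  assert (up : forall xi, c - 1 <= xi <= c + 1 -> 1 + m * h / 2 <= X xi -> kmax <= height p X xi - exp (- xi)).
  { intros xi Hxi H. destruct (HT xi Hxi) as [HXp _].
    destruct (excess_bound p xi X ltac:(lra) HXp) as [A _]. eapply Rle_trans; [|apply A; lra].
    eapply Rle_trans; [apply (sbound xi Hxi)|]. apply Rmult_le_compat_l; [left; apply exp_pos|lra]. }
  assert (down : forall xi, c - 1 <= xi <= c + 1 -> X xi <= 1 - m * h / 2 -> height p X xi - exp (- xi) <= - kmax).
  { intros xi Hxi H. destruct (HT xi Hxi) as [HXp _].
    destruct (excess_bound p xi X ltac:(lra) HXp) as [_ A]. eapply Rle_trans; [apply A; lra|].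
    pose proof (sbound xi Hxi). pose proof (exp_pos (- xi)).
    assert (exp (- xi) * (X xi - 1) <= exp (- xi) * (- (m * h / 2))) by nra. lra. }
  assert (right_step : exists y z, c < z < y /\ y = c + h /\ c < y /\ X y - 1 = X1 z * h /\
     exists w, c < w < z /\ X1 z = X1 c + X2 w * (z - c)).
  { destruct (MVT_is_derive X X1 c (c + h) ltac:(lra)) as [z [Hz Ez]].
    - intros t Ht. apply HT. lra.
    - destruct (MVT_is_derive X1 X2 c z ltac:(lra)) as [w [Hw Ew]].
      + intros t Ht. apply HT. lra.
      + exists (c + h), z. split; [lra|]. split; [reflexivity|]. split; [lra|].
        split; [rewrite <- EX; rewrite Ez; ring|]. exists w. split; [exact Hw|lra]. }
  assert (left_step : exists y z, y < z < c /\ y = c - h /\ 1 - X y = X1 z * h /\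
     exists w, z < w < c /\ X1 z = X1 c - X2 w * (c - z)).
  { destruct (MVT_is_derive X X1 (c - h) c ltac:(lra)) as [z [Hz Ez]].
    - intros t Ht. apply HT. lra.
    - destruct (MVT_is_derive X1 X2 z c ltac:(lra)) as [w [Hw Ew]].
      + intros t Ht. apply HT. lra.
      + exists (c - h), z. split; [lra|]. split; [reflexivity|].
        split; [rewrite <- EX; rewrite Ez; ring|]. exists w. split; [exact Hw|lra]. }
  destruct right_step as [yr [zr [Hzr [Eyr [_ [Exr [wr [Hwr Ewr]]]]]]]].
  destruct left_step as [yl [zl [Hzl [Eyl [Exl [wl [Hwl Ewl]]]]]]].
  assert (small : forall t, 0 <= t <= h -> forall D, D <= Q -> D * t <= m / 2).
  { intros t Ht D HD. apply Rle_trans with (Q * t); [apply Rmult_le_compat_r; lra|].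
    apply Rle_trans with (Q * h); [apply Rmult_le_compat_l; unfold Q; lra|lra]. }
  assert (high_low : (exists xi, c - 1 <= xi <= c + 1 /\ kmax <= height p X xi - exp (- xi)) /\
                     (exists xi, c - 1 <= xi <= c + 1 /\ height p X xi - exp (- xi) <= - kmax)).
  { destruct (Rle_lt_dec 0 (X1 c)) as [Hs|Hs].
    - assert (Hmc : m <= X1 c) by nra. split.
      + apply NNPP. intros Hn.
        assert (Hz : forall xi, c - 1 <= xi <= c + 1 -> height p X xi - exp (- xi) < kmax).
        { intros xi Hxi. apply Rnot_le_lt. intros Hle. apply Hn. exists xi. split; assumption. }
        pose proof (HX2low wr ltac:(lra) (Hz wr ltac:(lra))) as HL.
        pose proof (small (zr - c) ltac:(lra) (- X2 wr) ltac:(lra)).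
        specialize (up yr ltac:(lra)). specialize (Hz yr ltac:(lra)).
        assert (m / 2 * h <= X1 zr * h) by nra.
        specialize (up ltac:(lra)). lra.
      + exists yl. split; [lra|]. apply down; [lra|].
        pose proof (small (c - zl) ltac:(lra) (X2 wl) (HX2up wl ltac:(lra))).
        assert (m / 2 * h <= X1 zl * h) by nra. lra.
    - assert (Hmc : X1 c <= - m) by nra. split.
      + apply NNPP. intros Hn.
        assert (Hz : forall xi, c - 1 <= xi <= c + 1 -> height p X xi - exp (- xi) < kmax).
        { intros xi Hxi. apply Rnot_le_lt. intros Hle. apply Hn. exists xi. split; assumption. }
        pose proof (HX2low wl ltac:(lra) (Hz wl ltac:(lra))) as HL.
        pose proof (small (c - zl) ltac:(lra) (- X2 wl) ltac:(lra)).
        specialize (up yl ltac:(lra)). specialize (Hz yl ltac:(lra)).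
        assert (m / 2 * h <= - X1 zl * h) by (apply Rmult_le_compat_r; lra).
        specialize (up ltac:(lra)). lra.
      + exists yr. split; [lra|]. apply down; [lra|].
        pose proof (small (zr - c) ltac:(lra) (X2 wr) (HX2up wr ltac:(lra))).
        assert (m / 2 * h <= - X1 zr * h) by (apply Rmult_le_compat_r; lra). lra. }
  destruct high_low as [[a [Ha Hza]] [b [Hb Hzb]]].
  assert (Hkk2 : - kmax <= k <= kmax) by (apply Rabs_le_between; exact Hkk).
  assert (Cz : continuous_on_set (Icc (c - 1) (c + 1)) (fun xi => height p X xi - exp (- xi))).
  { apply continuous_on_set_minus; [exact (height_continuous _ _ _ _ _ HT)|].
    apply continuous_on_set_of_ex_derive. intros x. auto_derive. exact I. }
  destruct (Rle_lt_dec a b) as [L|L].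
  - destruct (IVT_on (fun xi => height p X xi - exp (- xi)) a b k L) as [xi [Hxi Exi]].
    + apply continuous_on_set_sub with (2 := Cz). unfold Icc; intros; lra.
    + right. lra.
    + exists xi. split; [lra|exact Exi].
  - destruct (IVT_on (fun xi => height p X xi - exp (- xi)) b a k ltac:(lra)) as [xi [Hxi Exi]].
    + apply continuous_on_set_sub with (2 := Cz). unfold Icc; intros; lra.
    + left. lra.
    + exists xi. split; [lra|exact Exi].
Qed.

Lemma many_level_crossings (p tau0 kmax : R) (f : R -> R) (M : nat) :
  2 < p -> 0 < tau0 -> nonlinearity p tau0 f -> 0 <= kmax -> exists mu0, 1 < mu0 /\
  forall l v v1 v2, 0 < l -> psol f l v v1 v2 -> mu0 <= v 0 ->
    forall k, Rabs k <= kmax -> exists zs : nat -> R,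
      (forall i, (i < M)%nat -> rr l (zs i) < 1 /\ 0 < v (rr l (zs i)) /\
         exp (p * ln tau0) <= exp (- zs i) + k /\ exp (p * ln (v (rr l (zs i)))) = exp (- zs i) + k) /\
      (forall i j, (i < j)%nat -> (j < M)%nat -> zs i < zs j).
Proof.
  intros hp ht hf Hkm.
  destruct (frequent_crossings p tau0 f hp ht hf) as [S1 [T [mb [HS1 [HS1' [HT [Hmb HF]]]]]]].
  (* Each block holds a window of length [T] for the crossing, a unit margin on either side for
     [levels_near_crossing], and one more unit to separate the blocks. [Theta] covers all blocks, so
     [delta] is fixed before mu. *)
  set (D := T + 3). set (Theta := INR (S M) * D + 2).
  assert (HTheta : 0 < Theta).
  { unfold Theta, D. pose proof (pos_INR (S M)). nra. }
  destruct (amplitude p (exp (p * ln tau0)) Theta hp (exp_pos _) HTheta) as [S2 [delta [HS2 [Hdelta HA]]]].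
  destruct (levels_near_crossing p delta kmax hp Hdelta Hkm) as [S3 [HS3 HL]].
  set (Sm := S1 + S2 + S3).
  exists (mb + Sm * exp Theta). pose proof (exp_pos Theta) as HeT.
  assert (HSm : 0 < Sm * exp Theta) by (apply Rmult_lt_0_compat; unfold Sm; lra).
  split; [lra|].
  intros l v v1 v2 hl Hs Hmu k Hk.
  destruct (HF l v v1 v2 hl Hs ltac:(lra)) as [Hst [HPb HFb]].
  set (a := start p (v 0)) in *. set (b := a + Theta).
  assert (Ha : 2 * v 0 <= exp (- a)).
  { unfold a. rewrite start_time. pose proof (exp_p_ln_ge p (v 0) ltac:(lra) ltac:(lra)). lra. }
  assert (Hb : Sm <= exp (- b)).
  { unfold b. replace (- (a + Theta)) with (- a + - Theta) by ring. rewrite exp_plus, (exp_Ropp Theta).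
    apply Rmult_le_reg_r with (exp Theta); [exact HeT|].
    replace (exp (- a) * / exp Theta * exp Theta) with (exp (- a)) by (field; lra). lra. }
  destruct (HPb b ltac:(unfold b; lra) ltac:(unfold Sm in Hb; lra)) as [Hr1 [Hvb [HTr HX]]].
  set (X := Xf l v p) in *. set (X1 := Xf1 l v v1 p) in *.
  assert (Hha : height p X a <= exp (- a) / 2).
  { destruct (HTr a ltac:(unfold b; lra)) as [HXa _].
    assert (Hva : 0 < v (rr l a)).
    { apply (psol_derive _ _ _ _ _ _ Hs). split; [apply rr_pos; exact hl|].
      eapply Rle_lt_trans; [apply (rr_increasing l hl a b); unfold b; lra|exact Hr1]. }
    unfold X. rewrite Xf_height by (try lra; exact Hva). unfold a. rewrite start_time. fold a.
    replace (2 * exp (p * ln (v 0)) / 2) with (exp (p * ln (v 0))) by field. apply exp_le.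
    apply Rmult_le_compat_l; [lra|].
    assert (v (rr l a) <= v 0).
    { apply (psol_nonincr f l v v1 v2 (proj1 (proj2 hf)) hl Hs); [lra|left; apply rr_pos; exact hl|].
      apply Rle_trans with (rr l b); [apply (rr_increasing l hl a b); unfold b; lra|lra]. }
    apply ln_le; lra. }
  pose proof (HA a b X X1 HTr ltac:(unfold b; lra) ltac:(unfold Sm in Hb; lra)
    ltac:(intros xi Hxi; destruct (HX xi Hxi) as [E1 [E2 _]]; split; assumption) Hha) as HAm.
  assert (Hex : forall i : nat, exists xi, (i < M)%nat -> a + INR i * D <= xi <= a + INR i * D + (T + 2) /\
     height p X xi - exp (- xi) = k).
  { intros i. destruct (Compare_dec.le_lt_dec M i) as [Hi|Hi]; [exists 0; intros; lia|].
    assert (HiM : INR i + 1 <= INR M) by (rewrite <- S_INR; apply le_INR; lia).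
    pose proof (pos_INR i) as Hi0.
    assert (HiD : 0 <= INR i * D /\ INR i * D + D <= INR (S M) * D).
    { rewrite S_INR. unfold D in *. split; nra. }
    destruct (HFb (a + INR i * D + 1) ltac:(lra)) as [c [Hc Ec]].
    { apply Rle_trans with (exp (- b)); [unfold Sm in Hb; lra|]. apply exp_le. unfold b, Theta, D in *. lra. }
    assert (Hcb : a <= c - 1 /\ c + 1 <= b) by (unfold b, Theta, D in *; lra).
    destruct (HL X X1 c) with (k := k) as [xi [Hxi Exi]]; try assumption.
    - apply traj_sub with a b; [lra|lra|exact HTr].
    - apply Rle_trans with (exp (- b)); [unfold Sm in Hb; lra|]. apply exp_le. lra.
    - intros xi Hxi. destruct (HX xi ltac:(lra)) as [_ [_ E3]]. destruct (HAm xi ltac:(lra)) as [_ [A1 A2]].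
      split; [exact E3|]. split; assumption.
    - apply HAm. lra.
    - exists xi. intros _. split; [lra|exact Exi]. }
  assert (Hz : exists zs : nat -> R, forall i, (i < M)%nat ->
     a + INR i * D <= zs i <= a + INR i * D + (T + 2) /\ height p X (zs i) - exp (- zs i) = k).
  { exists (fun i => proj1_sig (constructive_indefinite_description _ (Hex i))).
    intros i. exact (proj2_sig (constructive_indefinite_description _ (Hex i))). }
  destruct Hz as [zs Hz]. exists zs. split.
  - intros i Hi. destruct (Hz i Hi) as [Hzi Ezi].
    assert (HiM : INR i + 1 <= INR M) by (rewrite <- S_INR; apply le_INR; lia).
    pose proof (pos_INR i) as Hi0.
    assert (HiD : 0 <= INR i * D /\ INR i * D + D <= INR (S M) * D).
    { rewrite S_INR. unfold D in *. split; nra. }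
    assert (Hzb : a <= zs i <= b) by (unfold b, Theta, D in *; lra).
    assert (Hrz : rr l (zs i) < 1).
    { eapply Rle_lt_trans; [apply (rr_increasing l hl (zs i) b); lra|exact Hr1]. }
    assert (Hvz : 0 < v (rr l (zs i))).
    { apply (psol_derive _ _ _ _ _ _ Hs). split; [apply rr_pos; exact hl|exact Hrz]. }
    destruct (HX (zs i) Hzb) as [_ [Hh _]].
    split; [exact Hrz|]. split; [exact Hvz|]. split; [lra|].
    unfold X in Ezi. rewrite Xf_height in Ezi by (try lra; exact Hvz). lra.
  - intros i j Hij Hj. destruct (Hz i ltac:(lia)) as [Hzi _]. destruct (Hz j Hj) as [Hzj _].
    assert (INR i + 1 <= INR j) by (rewrite <- S_INR; apply le_INR; lia).
    assert ((INR i + 1) * D <= INR j * D) by (apply Rmult_le_compat_r; unfold D; lra). unfold D in *. lra.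
Qed.

(** * The theorem *)

Lemma choose_seq {A : Type} (P : nat -> A -> Prop) :
  (forall n, exists x, P n x) -> exists s, forall n, P n (s n).
Proof.
  intros H. exists (fun n => proj1_sig (constructive_indefinite_description _ (H n))).
  intros n. exact (proj2_sig (constructive_indefinite_description _ (H n))).
Qed.

Lemma is_lim_seq_above_INR (s : nat -> R) : (forall n, INR n < s n) -> is_lim_seq s p_infty.
Proof.
  intros H. apply is_lim_seq_le_p_loc with INR; [|apply is_lim_seq_INR].
  exists 0%nat. intros n _. left. apply H.
Qed.

Lemma is_derive_on_rescale (V V1 : R -> R) (c : R) : 0 < c ->
  is_derive_on (Ioc 0 c) V V1 -> is_derive_on (Ioc 0 1) (fun r => V (c * r)) (fun r => c * V1 (c * r)).
Proof.
  intros Hc H. apply is_derive_on_eps. intros x Dx eps Heps.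
  assert (Hsub : forall x, Ioc 0 1 x -> Ioc 0 c (c * x)).
  { unfold Ioc. intros y Hy. split; [apply Rmult_lt_0_compat; lra|nra]. }
  destruct (proj1 (is_derive_on_eps _ _ _) H (c * x) (Hsub x Dx) (eps / c)) as [d [Hd0 Hd]];
    [apply Rdiv_lt_0_compat; assumption|].
  exists (d / c). split; [apply Rdiv_lt_0_compat; assumption|]. intros y Dy Hy.
  assert (E : Rabs (c * y - c * x) = c * Rabs (y - x)).
  { replace (c * y - c * x) with (c * (y - x)) by ring. rewrite Rabs_mult, (Rabs_right c) by lra. reflexivity. }
  specialize (Hd (c * y) (Hsub y Dy)). rewrite E in Hd.
  assert (Hcd : c * Rabs (y - x) < d).
  { replace d with (c * (d / c)) by (field; lra). apply Rmult_lt_compat_l; assumption. }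
  specialize (Hd Hcd). replace ((y - x) * (c * V1 (c * x))) with ((c * y - c * x) * V1 (c * x)) by ring.
  replace (eps * Rabs (y - x)) with (eps / c * (c * Rabs (y - x))) by (field; lra). exact Hd.
Qed.

Lemma continuous_on_rescale (V : R -> R) (c : R) : 0 < c ->
  continuous_on_set (Ioc 0 c) V -> continuous_on_set (Ioc 0 1) (fun r => V (c * r)).
Proof.
  intros Hc. apply continuous_on_set_comp.
  - unfold Ioc. intros y Hy. split; [apply Rmult_lt_0_compat; lra|nra].
  - apply continuous_on_set_of_ex_derive. intros x. auto_derive. exact I.
Qed.

Lemma num_zeros_gt (I : R -> Prop) (v : R -> R) (M : R) (n : nat) (zs : nat -> R) :
  M < INR n -> (forall i, (i < n)%nat -> I (zs i) /\ v (zs i) = 0) ->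
  (forall i j, (i < j)%nat -> (j < n)%nat -> zs i < zs j) -> Rbar_lt M (num_zeros I v).
Proof.
  intros HM Hz Hinc. apply Rbar_lt_le_trans with (INR n); [exact HM|].
  unfold num_zeros. apply Lub_Rbar_correct. exists (map zs (List.seq 0 n)). split; [|split].
  - apply NoDup_map_NoDup_ForallPairs; [|apply seq_NoDup].
    intros i j Hi Hj E. apply in_seq in Hi. apply in_seq in Hj.
    destruct (Nat.lt_trichotomy i j) as [L|[L|L]]; [|exact L|].
    + pose proof (Hinc i j L ltac:(lia)). lra.
    + pose proof (Hinc j i L ltac:(lia)). lra.
  - intros x Hx. apply in_map_iff in Hx. destruct Hx as [i [Ei Hi]]. subst x.
    apply in_seq in Hi. apply Hz. lia.
  - rewrite length_map, length_seq. reflexivity.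
Qed.

(** Interleaving the two families yields disjoint intervals, on each of which a continuous [lam]
    sweeps a neighbourhood of [ls]; solutions found in different intervals then differ by their
    values at 0. *)
Lemma oscillating_levels (lam : R -> R) (ls : R) :
  (forall N, (exists mu, N < mu /\ 0 < mu /\ ls < lam mu) /\ (exists mu, N < mu /\ 0 < mu /\ lam mu < ls)) ->
  exists a b : nat -> R, forall i, 0 < a i /\ a i < b i /\ b i < a (S i) /\ lam (b i) < ls < lam (a i).
Proof.
  intros H.
  set (A := fun N => proj1_sig (constructive_indefinite_description _ (proj1 (H N)))).
  assert (HA : forall N, N < A N /\ 0 < A N /\ ls < lam (A N)).
  { intros N. exact (proj2_sig (constructive_indefinite_description _ (proj1 (H N)))). }
  set (B := fun N => proj1_sig (constructive_indefinite_description _ (proj2 (H N)))).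
  assert (HB : forall N, N < B N /\ 0 < B N /\ lam (B N) < ls).
  { intros N. exact (proj2_sig (constructive_indefinite_description _ (proj2 (H N)))). }
  set (a := nat_rect (fun _ => R) (A 0) (fun _ x => A (B x))).
  exists a, (fun i => B (a i)). intros i.
  assert (Ha : 0 < a i /\ ls < lam (a i)).
  { destruct i; simpl; split; apply HA. }
  split; [apply Ha|]. split; [apply HB|]. split; [apply HA|]. split; [apply HB|apply Ha].
Qed.

Lemma finite_gap (lam : R -> R) (ls : R) (a b : nat -> R) (N : nat) :
  (forall i, lam (b i) < ls < lam (a i)) ->
  exists eps, 0 < eps /\ forall i, (i < N)%nat -> lam (b i) <= ls - eps /\ ls + eps <= lam (a i).
Proof.
  intros H. induction N as [|N [eps [He IH]]].
  - exists 1. split; [lra|]. intros; lia.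
  - destruct (H N) as [H1 H2]. set (e := Rmin eps (Rmin (ls - lam (b N)) (lam (a N) - ls))).
    assert (He1 : 0 < e) by (unfold e; repeat apply Rmin_pos; lra).
    assert (He2 : e <= eps /\ e <= ls - lam (b N) /\ e <= lam (a N) - ls).
    { unfold e. pose proof (Rmin_l eps (Rmin (ls - lam (b N)) (lam (a N) - ls))).
      pose proof (Rmin_r eps (Rmin (ls - lam (b N)) (lam (a N) - ls))).
      pose proof (Rmin_l (ls - lam (b N)) (lam (a N) - ls)). pose proof (Rmin_r (ls - lam (b N)) (lam (a N) - ls)). lra. }
    exists e. split; [exact He1|]. intros i Hi. destruct (Nat.eq_dec i N) as [E|E].
    + subst. lra.
    + specialize (IH i ltac:(lia)). lra.
Qed.

Theorem theorem5p9
  (p tau0 alpha : R) (f : R -> R)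
  (lam : R -> R) (u : R -> R -> R)
  (Rstar : R) (Ubar : R -> R)
  (hp : 2 < p) (htau0 : 0 < tau0)
  (hf : nonlinearity p tau0 f)
  (halpha : 0 < alpha < 1)
  (hcurve : C1_curve alpha lam u)
  (hsol : forall mu, 0 < mu -> unique_P_solution_with_max f mu (lam mu) (u mu))
  (hsing : singular_profile p tau0 f Rstar Ubar) :
  let ls := lambda_star Rstar in
  let Us := U_star Rstar Ubar in
  (exists mu mu' : nat -> R,
     (forall n, 0 < mu n) /\ (forall n, 0 < mu' n) /\
     is_lim_seq mu p_infty /\ is_lim_seq mu' p_infty /\
     forall n, lam (mu' n) < ls < lam (mu n)) /\
  (* (i) *)
  solves_singular f ls Us /\
  (* (ii) *)
  (exists (mu : nat -> R) (us : R -> R),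
     (forall n, 0 < mu n) /\
     (forall r s, 0 < r -> r <= s -> s <= 1 -> us s <= us r) /\
     is_lim_seq mu p_infty /\
     is_lim_seq (fun n => lam (mu n)) ls /\
     cvg_C2_loc (fun n => u (mu n)) us /\
     weak_singular_limit f ls us) /\
  (* (iii) *)
  ((forall N : nat, exists eps, 0 < eps < ls /\
      forall l, ls - eps < l < ls + eps ->
        exists v : nat -> R -> R,
          (forall i, (i < N)%nat -> solves_P f l (v i)) /\
          (forall i j, (i < N)%nat -> (j < N)%nat -> i <> j ->
             ~ eq_on (Icc 0 1) (v i) (v j))) /\
   (exists v : nat -> R -> R,
      (forall i, solves_P f ls (v i)) /\
      (forall i j, i <> j -> ~ eq_on (Icc 0 1) (v i) (v j)))) /\
  (* (iv) *)
  (Rbar_lt 0 (Glb_Rbar (fun y => exists t, 0 < t /\ y = f t / t)) ->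
   forall M : R, Rbar_locally p_infty (fun mu =>
     Rbar_lt M (num_zeros (Ioo 0 1) (fun r => u mu r - Us r)))).
Proof.
  intros ls Us.
  assert (fpos : forall t, 0 <= t -> 0 <= f t) by apply hf.
  assert (hlam : forall mu, 0 < mu -> 0 < lam mu) by (intros mu Hmu; apply (hsol mu Hmu)).
  assert (hu0 : forall mu, 0 < mu -> u mu 0 = mu) by (intros mu Hmu; apply (hsol mu Hmu)).
  (* The derivatives are chosen for all real mu at once, with a dummy pair when mu <= 0. *)
  assert (Hex : forall mu, exists vv : (R -> R) * (R -> R), 0 < mu -> psol f (lam mu) (u mu) (fst vv) (snd vv)).
  { intros mu. destruct (Rlt_dec 0 mu) as [L|L].
    - destruct (hsol mu L) as [[_ [[v1 [v2 H]] _]] _]. exists (v1, v2). intros _. exact H.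
    - exists (fun _ => 0, fun _ => 0). intros; contradiction. }
  set (u1 := fun mu => fst (proj1_sig (constructive_indefinite_description _ (Hex mu)))).
  set (u2 := fun mu => snd (proj1_sig (constructive_indefinite_description _ (Hex mu)))).
  assert (hu : forall mu, 0 < mu -> psol f (lam mu) (u mu) (u1 mu) (u2 mu)).
  { intros mu. exact (proj2_sig (constructive_indefinite_description _ (Hex mu))). }
  clearbody u1 u2. clear Hex.
  destruct (proj1 (proj2 (proj2 hsing))) as [U1 [U2 [hU hUeq]]].
  pose proof (Rstar_pos p tau0 f Rstar Ubar hsing) as HR0.
  assert (osc : forall N, (exists mu, N < mu /\ 0 < mu /\ ls < lam mu) /\ (exists mu, N < mu /\ 0 < mu /\ lam mu < ls)).
  { exact (lambda_oscillates p tau0 alpha f lam u u1 u2 Rstar Ubar U1 U2 hp htau0 hf hcurve hlam hu hu0 hsing hU hUeq). }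
  assert (Esq : sqrt (lambda_star Rstar) = Rstar) by (unfold lambda_star; apply sqrt_pow2; lra).
  assert (Hls : 0 < ls) by (unfold ls, lambda_star; apply pow_lt; exact HR0).
  assert (lamc : forall a b, 0 < a -> continuous_on_set (Icc a b) lam).
  { intros a b Ha. apply continuous_on_of_continuous. intros x [Hx _].
    apply (lam_continuous alpha lam u hcurve). lra. }
  assert (hP : forall mu, 0 < mu -> solves_P f (lam mu) (u mu)) by (intros mu Hmu; apply (hsol mu Hmu)).
  assert (hdist : forall m m', 0 < m -> 0 < m' -> m <> m' -> ~ eq_on (Icc 0 1) (u m) (u m')).
  { intros m m' Hm Hm' Hne E. apply Hne. rewrite <- (hu0 m Hm), <- (hu0 m' Hm').
    apply E. unfold Icc; lra. }
  destruct (oscillating_levels lam ls osc) as [a [b Hab]].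
  assert (Hinc : forall i j, (i < j)%nat -> b i < a j).
  { intros i j Hij. induction Hij as [|j Hij IH]; [apply Hab|].
    destruct (Hab j) as [_ [H1 [H2 _]]]. lra. }
  assert (pick : forall l i, lam (b i) <= l <= lam (a i) -> exists c, a i <= c <= b i /\ lam c = l).
  { intros l i Hl. destruct (Hab i) as [H0 [H1 _]]. apply (IVT_on lam (a i) (b i) l); [lra|apply lamc; exact H0|right; exact Hl]. }
  split; [|split; [|split; [|split]]].
  - destruct (choose_seq (fun n mu => INR n < mu /\ 0 < mu /\ ls < lam mu)) as [s Hs].
    { intros n. apply (osc (INR n)). }
    destruct (choose_seq (fun n mu => INR n < mu /\ 0 < mu /\ lam mu < ls)) as [s' Hs'].
    { intros n. apply (osc (INR n)). }
    exists s, s'. split; [apply Hs|]. split; [apply Hs'|].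
    split; [apply is_lim_seq_above_INR; apply Hs|]. split; [apply is_lim_seq_above_INR; apply Hs'|].
    intros n. split; [apply Hs'|apply Hs].
  - unfold Us, U_star. rewrite Esq. destruct hU as [D0 [D1 C2]]. split; [|split; [|split]].
    + exists (fun r => Rstar * U1 (Rstar * r)), (fun r => Rstar * (Rstar * U2 (Rstar * r))). split.
      * split; [exact (is_derive_on_rescale Ubar U1 Rstar HR0 D0)|].
        split; [exact (is_derive_on_scal _ _ _ Rstar (is_derive_on_rescale U1 U2 Rstar HR0 D1))|].
        do 2 (apply continuous_on_set_mult; [apply continuous_on_set_const|]).
        apply continuous_on_rescale; assumption.
      * intros r Hr. unfold Ioo in Hr. assert (Hr2 : Ioo 0 Rstar (Rstar * r)) by (unfold Ioo; split; nra).
        pose proof (hUeq _ Hr2) as E. unfold radial_eq in *. unfold ls, lambda_star. rewrite <- E. field. lra.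
    + intros r Hr. unfold Ioo in Hr. apply hsing. unfold Ioo. split; nra.
    + intros P [M HP]. destruct (Ubar_blowup p tau0 f Rstar Ubar hsing M) as [d [Hd0 Hd]].
      assert (Hdr : 0 < d / Rstar) by (apply Rdiv_lt_0_compat; assumption).
      exists (mkposreal _ Hdr). intros r Hr Hr0. change (Rabs (r - 0) < d / Rstar) in Hr.
      rewrite Rabs_right in Hr by lra. apply HP. apply Hd. split; [nra|].
      replace d with (Rstar * (d / Rstar)) by (field; lra). apply Rmult_lt_compat_l; lra.
    + rewrite Rmult_1_r. apply hsing.
  - destruct (end_slope_bound p tau0 ls f hp htau0 hf) as [beta [mu0 [Hbeta [Hmu0 HB]]]].
    assert (Hat : forall N, exists mu, N < mu /\ mu0 < mu /\ lam mu = ls).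
    { intros N. destruct (proj1 (osc (Rmax N mu0))) as [m1 [H1 [_ H3]]].
      destruct (proj2 (osc m1)) as [m2 [H4 [_ H6]]].
      pose proof (Rmax_l N mu0). pose proof (Rmax_r N mu0).
      destruct (IVT_on lam m1 m2 ls ltac:(lra)) as [c [Hc Ec]]; [apply lamc; lra|right; lra|].
      exists c. repeat split; lra. }
    destruct (choose_seq (fun n mu => INR n < mu /\ mu0 < mu /\ lam mu = ls) (fun n => Hat (INR n))) as [nu Hnu].
    assert (Hslope : forall n, - beta <= u1 (nu n) 1 <= 0).
    { intros n. destruct (Hnu n) as [_ [H2 H3]]. pose proof (hu (nu n) ltac:(lra)) as Hs.
      pose proof (psol_v1_nonpos f _ _ _ _ fpos (hlam (nu n) ltac:(lra)) Hs 1 ltac:(lra)).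
      rewrite H3 in Hs. pose proof (HB ls _ _ _ ltac:(lra) Hs ltac:(rewrite hu0; lra)). lra. }
    destruct (Bolzano_Weierstrass (fun n => u1 (nu n) 1) (fun x => - beta <= x <= 0)) as [dinf Hdinf].
    { apply compact_P3. }
    { exact Hslope. }
    (* [sub] need not be increasing: [n <= sub n] alone forces [mu n] to infinity. *)
    destruct (choose_seq (fun n k => (n <= k)%nat /\ Rabs (u1 (nu k) 1 - dinf) < / (INR n + 1))) as [sub Hsub].
    { intros n. assert (Hp : 0 < / (INR n + 1)) by (apply Rinv_0_lt_compat; pose proof (pos_INR n); lra).
      destruct (Hdinf (disc dinf (mkposreal _ Hp)) n) as [k [Hk1 Hk2]].
      - exists (mkposreal _ Hp). intros x Hx. exact Hx.
      - exists k. split; [exact Hk1|exact Hk2]. }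
    set (mu := fun n => nu (sub n)).
    assert (Hmu : forall n, INR n < mu n /\ mu0 < mu n /\ lam (mu n) = ls).
    { intros n. unfold mu. destruct (Hnu (sub n)) as [H1 [H2 H3]]. destruct (Hsub n) as [H4 _].
      apply le_INR in H4. repeat split; lra. }
    assert (Hs : forall n, psol f ls (u (mu n)) (u1 (mu n)) (u2 (mu n))).
    { intros n. destruct (Hmu n) as [_ [H2 H3]]. rewrite <- H3. apply hu. lra. }
    assert (Hd : is_lim_seq (fun n => u1 (mu n) 1) dinf).
    { apply is_lim_seq_spec. intros eps. destruct (archimed_cor1 eps (cond_pos eps)) as [N [HN HN0]].
      exists N. intros n Hn. eapply Rlt_trans; [apply Hsub|]. apply Rle_lt_trans with (/ INR N); [|exact HN].
      apply Rinv_le_contravar; [apply lt_0_INR; exact HN0|]. apply le_INR in Hn. lra. }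
    destruct (compactness p tau0 ls beta dinf f (fun n => u (mu n)) (fun n => u1 (mu n)) (fun n => u2 (mu n))
      hf Hls Hbeta Hs ltac:(intros n; specialize (Hslope (sub n)); unfold mu; lra) Hd) as [w [w1 [w2 [HC [HU [HE [H1 HF]]]]]]].
    exists mu, w. split; [intros n; destruct (Hmu n); lra|].
    split; [intros r s Hr Hrs Hs1; apply (HF r s Hr Hrs Hs1)|].
    split; [apply is_lim_seq_above_INR; apply Hmu|].
    split; [apply is_lim_seq_ext with (fun _ => ls); [intros n; symmetry; apply Hmu|apply is_lim_seq_const]|].
    split.
    + exists (fun n => u1 (mu n)), (fun n => u2 (mu n)), w1, w2. split; [|split; [exact HC|exact HU]].
      intros n. destruct (Hs n) as [[D0 [D1 C2]] _].
      assert (Hsubset : forall x, Ioc 0 1 x -> Icc 0 1 x) by (unfold Ioc, Icc; intros; lra).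
      split; [exact (is_derive_on_sub _ _ _ _ Hsubset D0)|].
      split; [exact (is_derive_on_sub _ _ _ _ Hsubset D1)|exact (continuous_on_set_sub _ _ _ Hsubset C2)].
    + split; [|split; [|split]].
      * exists w1, w2. split; [exact HC|]. intros r Hr. unfold radial_eq. rewrite HE. ring.
      * intros r Hr. unfold Ioo in Hr. apply (HF r r); lra.
      * exact H1.
      * apply weak_limit_integrable with beta w1 w2; try assumption.
        apply (nonlinearity_continuous p tau0 f hf).
  - split.
    + intros N. destruct (finite_gap lam ls a b N) as [eps [He Hgap]]; [intros i; apply Hab|].
      exists (Rmin eps (ls / 2)). pose proof (Rmin_l eps (ls / 2)). pose proof (Rmin_r eps (ls / 2)).
      split; [split; [apply Rmin_pos; lra|lra]|]. intros l Hl.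
      destruct (choose_seq (fun i c => (i < N)%nat -> a i <= c <= b i /\ lam c = l)) as [c Hc].
      { intros i. destruct (Compare_dec.le_lt_dec N i) as [Hi|Hi]; [exists 0; intros; lia|].
        specialize (Hgap i Hi). destruct (pick l i ltac:(lra)) as [c Hc]. exists c. intros _. exact Hc. }
      exists (fun i => u (c i)). split.
      * intros i Hi. destruct (Hc i Hi) as [H1 H2]. destruct (Hab i) as [H3 _].
        rewrite <- H2. apply hP. lra.
      * intros i j Hi Hj Hij. destruct (Hc i Hi) as [H1 _]. destruct (Hc j Hj) as [H2 _].
        destruct (Hab i) as [H3 _]. destruct (Hab j) as [H4 _]. apply hdist; try lra.
        destruct (Nat.lt_gt_cases i j) as [[L|L] _]; [exact Hij| |].
        -- pose proof (Hinc i j L). lra.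
        -- pose proof (Hinc j i L). lra.
    + destruct (choose_seq (fun i c => a i <= c <= b i /\ lam c = ls)) as [c Hc].
      { intros i. apply pick. destruct (Hab i) as [_ [_ [_ H]]]. lra. }
      exists (fun i => u (c i)). split.
      * intros i. destruct (Hc i) as [H1 H2]. destruct (Hab i) as [H3 _]. rewrite <- H2. apply hP. lra.
      * intros i j Hij. destruct (Hc i) as [H1 _]. destruct (Hc j) as [H2 _].
        destruct (Hab i) as [H3 _]. destruct (Hab j) as [H4 _]. apply hdist; try lra.
        destruct (Nat.lt_gt_cases i j) as [[L|L] _]; [exact Hij| |].
        -- pose proof (Hinc i j L). lra.
        -- pose proof (Hinc j i L). lra.
  - intros Hinf M.
    assert (Hc : exists c, 0 < c /\ forall t, 0 < t -> c * t <= f t).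
    { pose proof (Glb_Rbar_correct (fun y => exists t, 0 < t /\ y = f t / t)) as [Hlb _].
      destruct (Glb_Rbar (fun y => exists t, 0 < t /\ y = f t / t)) as [c| |].
      - exists c. split; [exact Hinf|]. intros t Ht.
        assert (Hle : c <= f t / t) by (apply (Hlb (f t / t)); exists t; split; [exact Ht|reflexivity]).
        apply Rmult_le_compat_r with (r := t) in Hle; [|lra].
        replace (f t / t * t) with (f t) in Hle by (field; lra). exact Hle.
      - exfalso. apply (Hlb (f 1 / 1)). exists 1. split; [lra|reflexivity].
      - destruct Hinf. }
    destruct Hc as [c [Hc0 Hc]].
    destruct (crossing_bounds p tau0 f hp htau0 hf) as [C [mu1 [HC [Hmu1 HCB]]]].
    (* The shift k = ln (lam mu / ls) is bounded because exp (- C) <= lam mu <= 16 / c; the upper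
       bound is where the positive infimum enters. *)
    set (kmax := C + Rabs (ln (16 / c)) + 2 * Rabs (ln Rstar)).
    assert (Hkmax : 0 <= kmax) by (unfold kmax; pose proof (Rabs_pos (ln (16 / c))); pose proof (Rabs_pos (ln Rstar)); lra).
    destruct (INR_unbounded M) as [n Hn].
    destruct (many_level_crossings p tau0 kmax f n hp htau0 hf Hkmax) as [mu2 [Hmu2 HL]].
    exists (mu1 + mu2). intros mu Hmu.
    assert (Hmu0 : 0 < mu) by lra. pose proof (hu mu Hmu0) as Hs. pose proof (hlam mu Hmu0) as Hl.
    destruct (HCB _ _ _ _ Hl Hs ltac:(rewrite hu0; lra)) as [_ [_ [_ [_ Hlow]]]].
    pose proof (lambda_upper f (lam mu) c _ _ _ fpos Hc0 Hc Hl Hs) as Hup.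
    set (k := ln (lam mu) - 2 * ln Rstar).
    assert (Hk : Rabs k <= kmax).
    { assert (H1 : - C <= ln (lam mu)).
      { rewrite <- (ln_exp (- C)). destruct Hlow as [h|h]; [left; apply ln_increasing; [apply exp_pos|exact h]|rewrite h; lra]. }
      assert (H2 : ln (lam mu) <= ln (16 / c)).
      { apply ln_le; lra. }
      unfold k, kmax. pose proof (Rle_abs (ln (16 / c))). pose proof (Rabs_pos (ln (16 / c))).
      pose proof (Rle_abs (ln Rstar)). pose proof (Rle_abs (- ln Rstar)) as H5. rewrite Rabs_Ropp in H5.
      apply Rabs_le. lra. }
    destruct (HL (lam mu) _ _ _ Hl Hs ltac:(rewrite hu0; lra) k Hk) as [zs [Hz Hzinc]].
    apply num_zeros_gt with n (fun i => rr (lam mu) (zs i)); [exact Hn| |].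
    + intros i Hi. destruct (Hz i Hi) as [Hr1 [Hv [Hy0 Hyk]]].
      split; [split; [apply rr_pos; exact Hl|exact Hr1]|].
      unfold Us, U_star. rewrite Esq.
      assert (Hsl : 0 < sqrt (lam mu)) by (apply sqrt_lt_R0; exact Hl).
      (* In logarithmic variables the argument of [Ubar] corresponds to s + k, where the profile is
         explicitly (s + k)^(1/p); equality with [u] is u^p = s + k, the level obtained above. *)
      assert (E : Rstar * rr (lam mu) (zs i) = exp (- ((exp (- zs i) + k) / 2))).
      { replace (- ((exp (- zs i) + k) / 2)) with (- (exp (- zs i) / 2) + (ln Rstar + - (ln (lam mu) / 2)))
          by (unfold k; field).
        rewrite !exp_plus, exp_ln by exact HR0. unfold rr. rewrite (exp_Ropp (ln (lam mu) / 2)).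
        replace (exp (ln (lam mu) / 2)) with (sqrt (lam mu)); [field; lra|].
        apply Rsqr_inj; [lra|left; apply exp_pos|]. unfold Rsqr. rewrite sqrt_sqrt, <- exp_plus by lra.
        replace (ln (lam mu) / 2 + ln (lam mu) / 2) with (ln (lam mu)) by field. symmetry. apply exp_ln. exact Hl. }
      rewrite E, (Ubar_value p tau0 f Rstar Ubar hp hsing) by exact Hy0.
      rewrite <- Hyk, ln_exp. replace (p * ln (u mu (rr (lam mu) (zs i))) / p) with (ln (u mu (rr (lam mu) (zs i)))) by (field; lra).
      rewrite exp_ln by exact Hv. ring.
    + intros i j Hij Hj. apply rr_strict; [exact Hl|]. apply Hzinc; assumption.
Qed.
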